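(* Let $G$ be a compact Lie group, let $s>1/2$, and let $(X,\omega,\mu)$ be a Hamiltonian $L_sG$-space with proper moment map. Let $\hat X$ be the associated infinite approximating space and let $\hat f\colon\hat X\to\mathbb R$ be the energy function. Let $Y_n$ ($n\ge1$) be the finite approximating manifolds, and let $f_n\colon Y_n\to\mathbb R$ be the energy functions. If the restriction maps $H_G^*(Y_n)\to H_G^*(f_n^{-1}(0))$ are all surjections, then the restriction map $H_G^*(\hat X)\to H_G^*(\hat f^{-1}(0))$ is a surjection.
   Context: All cohomology has rational coefficients, and $H_G^*$ denotes $G$-equivariant cohomology. Fix an invariant inner product on $\mathfrak g$. $L_sG$ is the Banach Lie group of maps $S^1\to G$ of Sobolev class $s$, with Lie algebra $L_s\mathfrak g=\Omega^0_s(S^1)\otimes\mathfrak g$. Set $L_s\mathfrak g^*:=\Omega^1_{s-1}(S^1)\otimes\mathfrak g$ (Sobolev class $s-1$), paired with $L_s\mathfrak g$ by integration and the inner product. $L_sG$ acts on $L_s\mathfrak g^*$ (identified with connections on the trivial $G$-bundle on $S^1$) by $\lambda\cdot\gamma=\lambda^{-1}d\lambda+\lambda^{-1}\gamma\lambda$. A Hamiltonian $L_sG$-space is a triple $(X,\omega,\mu)$: $X$ a Banach manifold with an $L_sG$-action, $\omega$ a closed two-form on $X$ with $\omega^\flat\colon T_pX\to T_pX^*$ injective for each $p$, and $\mu\colon X\to L_s\mathfrak g^*$ an $L_sG$-equivariant map (moment map) with $\langle d\mu,\xi\rangle=i_{\xi^X}\omega$ for all $\xi\in L_s\mathfrak g$.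 Associated space $M$: the group $\Omega_sG=\{\lambda\in L_sG\mid\lambda(0)=e\}$ acts freely on $X$; when $\mu$ is proper, $M=X/\Omega_sG$ is a compact finite-dimensional manifold with an action of $L_sG/\Omega_sG=G$. The map $\mathrm{Hol}\colon L_s\mathfrak g^*\to G$ given by the time-one value of the holonomy of the connection is a principal $\Omega_sG$-fibration, and $\mu$ induces a $G$-equivariant map $\Phi\colon M\to G$ (adjoint action on $G$). Infinite approximating space: let $\widehat{P_eG}$ be the space of piecewise smooth paths $\lambda\colon[0,1]\to G$ with $\lambda(0)=e$, with metric $\delta(\lambda,\lambda')=\max_{t\in[0,1]}d(\lambda(t),\lambda'(t))+|J(\lambda)-J(\lambda')|$, where $d$ is an invariant metric on $G$ and $J$ is the length function. $G$ acts by $(g\cdot\lambda)(t)=g^{-1}\lambda(t)g$. Then $\hat X:=\{(\lambda,m)\in\widehat{P_eG}\times M\mid\Phi(m)=\lambda(1)\}$ with the diagonal $G$-action, and $\hat f(\lambda,m)=\int_{[0,1]}\left|\lambda^{-1}\frac{d\lambda}{dt}\right|^2dt$. Finite approximating manifolds: let $\rho(\cdot,\cdot)$ be the Riemannian distance on $G$ for the bi-invariant metric, and fix $\overline\rho>0$ such that any two points of $G$ at distance less than $\overline\rho$ are joined by a unique shortest geodesic. For each positive integer $n$ let $X_n:=\{(g_1,\dots,g_n,m)\in G^n\times M\mid g_n=\Phi(m)\}$, with the diagonal $G$-action (adjoint action on each copy of $G$); with $g_0=e$ let $f_n(g_1,\dots,g_n,m)=n\sum_{i=0}^{n-1}\rho(g_i,g_{i+1})^2$,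 and let $Y_n:=f_n^{-1}(-\infty,\frac12n\overline\rho^2)\subset X_n$, with $f_n$ restricted to $Y_n$. *)

(* Defs.v *)
From HB Require Import structures.
From mathcomp Require Import all_boot all_order all_algebra.
From mathcomp Require Import generic_quotient.
From mathcomp Require Import all_classical all_reals all_analysis.
From mathcomp Require Import ring lra.

Set Implicit Arguments.
Unset Strict Implicit.
Unset Printing Implicit Defensive.

Import Order.TTheory GRing.Theory Num.Theory.
Import numFieldTopology.Exports numFieldNormedType.Exports.

Local Open Scope classical_set_scope.
Local Open Scope ring_scope.

Section Cohomology.
Context (R : realType).

Definition std_simplex (k : nat) : set 'rV[R]_k.+1 :=
  [set x | (forall i, 0 <= x ord0 i) /\ \sum_i x ord0 i = 1].
Arguments std_simplex : clear implicits.

Definition insert0 k (i : 'I_k.+2) (x : 'rV[R]_k.+1) : 'rV[R]_k.+2 :=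
  \row_j oapp (x ord0) 0 (unlift i j).

Lemma insert0_simplex k (i : 'I_k.+2) x :
  std_simplex k x -> std_simplex k.+1 (insert0 i x).
Proof.
move=> [x0 x1]; split=> [j|].
  by rewrite mxE; case: (unlift i j) => /=.
rewrite (bigD1 i) //= mxE unlift_none /= add0r -[RHS]x1.
rewrite (reindex_onto (lift i) (fun j => odflt ord0 (unlift i j))) /=; last first.
  by move=> j ji; case: unliftP => //= eji; rewrite eji eqxx in ji.
apply: eq_big => [j|j _]; last by rewrite mxE liftK.
by rewrite liftK /= eqxx andbT eq_sym neq_lift.
Qed.

Definition face k (i : 'I_k.+2) (x : std_simplex k) : std_simplex k.+1 :=
  SigSub (mem_set (insert0_simplex i (set_valP x))).

Lemma insert0_continuous k (i : 'I_k.+2) : continuous (insert0 i).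
Proof.
move=> x A [P nP PA].
exists (fun a c => P a (lift i c)) => [a c|y yP].
  by have := nP a (lift i c); rewrite mxE liftK (ord1 a).
apply: PA => a b; have := nP a b; rewrite !mxE.
case: unliftP => [c bE _|_ /nbhs_singleton//].
by have := yP a c; rewrite bE (ord1 a).
Qed.

Lemma face_continuous k (i : 'I_k.+2) : continuous (face i).
Proof.
apply/continuousP => _ [B oB <-].
exists (insert0 i @^-1` B); last by [].
by move/continuousP: (@insert0_continuous k i); exact.
Qed.

Section spaces.
Context (W : topologicalType).
Implicit Types A B : set W.

(* Since a subspace carries the subspace topology, its singular simplices are
   those of W with image in it. *)
Definition singular_simplex k A : Type :=
  {sigma : std_simplex k -> W | continuous sigma /\ forall x, A (sigma x)}.

Definition cochain k A : Type := singular_simplex k A -> rat.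

Lemma face_subproof k A (i : 'I_k.+2) (sigma : singular_simplex k.+1 A) :
  continuous (sval sigma \o face i) /\ forall x, A ((sval sigma \o face i) x).
Proof.
case: sigma => s [cs As]; split=> [x|x] /=; last exact: As.
apply: continuous_comp; first exact: face_continuous.
exact: cs.
Qed.

Definition simplex_face k A (i : 'I_k.+2) (sigma : singular_simplex k.+1 A) :
  singular_simplex k A := exist _ _ (face_subproof i sigma).

Definition coboundary k A (c : cochain k A) : cochain k.+1 A :=
  fun sigma => \sum_(i < k.+2) (-1) ^+ i * c (simplex_face i sigma).

Definition cocycle k A : Type :=
  {classic {c : cochain k A | coboundary c = fun=> 0}}.

Definition is_coboundary k A : cochain k A -> Prop :=
  if k is k'.+1 then fun c => exists b : cochain k' A, c = coboundary b
  else fun c => c = fun=> 0.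

Definition cohomologous k A (c c' : cocycle k A) : bool :=
  `[< is_coboundary (fun sigma => sval c sigma - sval c' sigma) >].

Lemma is_coboundaryN k A (c : cochain k A) :
  is_coboundary c -> is_coboundary (fun x => - c x).
Proof.
case: k c => [c ->|k c [b ->]] /=; first by apply/funext => x; rewrite oppr0.
exists (fun x => - b x); apply/funext => x; rewrite /coboundary -sumrN.
by apply: eq_bigr => i _; rewrite mulrN.
Qed.

Lemma is_coboundaryD k A (c c' : cochain k A) :
  is_coboundary c -> is_coboundary c' -> is_coboundary (fun x => c x + c' x).
Proof.
case: k c c' => [c c' -> ->|k c c' [b ->] [b' ->]] /=.
  by apply/funext => x; rewrite addr0.
exists (fun x => b x + b' x); apply/funext => x.
by rewrite /coboundary -big_split; apply: eq_bigr => i _; rewrite mulrDr.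
Qed.

Lemma is_coboundary0 k A : is_coboundary ((fun=> 0) : cochain k A).
Proof.
case: k => [//|k] /=; exists (fun=> 0); apply/funext => x.
by rewrite /coboundary big1 // => i _; rewrite mulr0.
Qed.

Lemma cohomologous_refl k A : reflexive (@cohomologous k A).
Proof.
move=> c; apply/asboolP; rewrite (_ : (fun _ => _) = fun=> 0).
  exact: is_coboundary0.
by apply/funext => x; rewrite subrr.
Qed.

Lemma cohomologous_sym k A : symmetric (@cohomologous k A).
Proof.
suff H (c c' : cocycle k A) : cohomologous c c' -> cohomologous c' c.
  by move=> c c'; apply/idP/idP; exact: H.
move=> /asboolP /is_coboundaryN h; apply/asboolP.
by move: h; under eq_fun do rewrite opprB.
Qed.

Lemma cohomologous_trans k A : transitive (@cohomologous k A).
Proof.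
move=> c' c c'' /asboolP h /asboolP h'; apply/asboolP.
by move: (is_coboundaryD h h'); under eq_fun do rewrite subrKA.
Qed.

Canonical cohomologous_equiv k A := EquivRel (@cohomologous k A)
  (@cohomologous_refl k A) (@cohomologous_sym k A) (@cohomologous_trans k A).

Definition cohomology k A : Type :=
  {eq_quot (@cohomologous_equiv k A)}%qT.

Section restriction.
Context (k : nat) (A B : set W) (AB : A `<=` B).

Definition simplex_incl l (sigma : singular_simplex l A) : singular_simplex l B :=
  exist _ (sval sigma)
    (conj (svalP sigma).1 (fun x => AB ((svalP sigma).2 x))).

Lemma coboundary_incl (c : cochain k B) :
  coboundary (c \o @simplex_incl k) = coboundary c \o @simplex_incl k.+1.
Proof.
apply/funext => s; rewrite /coboundary /=; apply: eq_bigr => i _.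
congr (_ * c _); exact: eq_exist.
Qed.

Lemma cocycle_incl (c : cocycle k B) :
  coboundary (sval c \o @simplex_incl k) = fun=> 0.
Proof. by rewrite coboundary_incl (svalP c). Qed.

Definition restrict_cocycle (c : cocycle k B) : cocycle k A :=
  exist _ _ (cocycle_incl c).

Definition restriction (h : cohomology k B) : cohomology k A :=
  (\pi_({eq_quot (@cohomologous_equiv k A)}) (restrict_cocycle (repr h)))%qT.

End restriction.
End spaces.
End Cohomology.

Section SobolevSpace.
Context (R : realType) (d : nat) (s : R).

(* The index j runs over the real orthonormal Fourier basis of the circle R/Z:
   1, sqrt 2 cos(2 pi t), sqrt 2 sin(2 pi t), sqrt 2 cos(4 pi t), ... *)
Definition freq (j : nat) : nat := uphalf j.

Definition fourier (j : nat) (t : R) : R :=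
  if j is 0 then 1
  else Num.sqrt 2 * (if odd j then cos else sin) (2 * pi * (freq j)%:R * t).

Definition sobolev_weight (j : nat) : R := (1 + (freq j)%:R ^+ 2) `^ s.

Implicit Types c : nat -> 'rV[R]_d.

Definition partial_norm c (n : nat) : R :=
  Num.sqrt (\sum_(j < n) sobolev_weight j * `|c j| ^+ 2).

Definition sobolev_seq : {pred nat -> 'rV[R]_d} :=
  fun c => `[< has_ubound (range (partial_norm c)) >].

Lemma sobolev_weight_gt0 j : 0 < sobolev_weight j.
Proof. by rewrite powR_gt0 // ltr_wpDr // sqr_ge0. Qed.

Lemma sqrt_minkowski (A B x y : R) : 0 <= A -> 0 <= B ->
  Num.sqrt ((A + B) ^+ 2 + (x + y) ^+ 2) <=
  Num.sqrt (A ^+ 2 + x ^+ 2) + Num.sqrt (B ^+ 2 + y ^+ 2).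
Proof.
move=> A0 B0.
have Ax : 0 <= A ^+ 2 + x ^+ 2 by rewrite addr_ge0 // sqr_ge0.
have By : 0 <= B ^+ 2 + y ^+ 2 by rewrite addr_ge0 // sqr_ge0.
rewrite -[leRHS]ger0_norm ?addr_ge0 ?sqrtr_ge0 // -sqrtr_sqr ler_wsqrtr //.
rewrite [leRHS]sqrrD !sqr_sqrtr // -sqrtrM //.
suff : A * B + x * y <= Num.sqrt ((A ^+ 2 + x ^+ 2) * (B ^+ 2 + y ^+ 2)).
  move=> h; rewrite (_ : (A + B) ^+ 2 + (x + y) ^+ 2 =
    (A ^+ 2 + x ^+ 2) + (A * B + x * y) *+ 2 + (B ^+ 2 + y ^+ 2)).
    by rewrite lerD2r lerD2l lerMn2r h.
  by ring.
apply: le_trans (ler_norm _) _; rewrite -sqrtr_sqr ler_wsqrtr //.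
by rewrite -subr_ge0 (_ : _ - _ = (A * y - B * x) ^+ 2) ?sqr_ge0 //; ring.
Qed.

Lemma partial_normS c n : partial_norm c n.+1 =
  Num.sqrt (partial_norm c n ^+ 2 +
            (Num.sqrt (sobolev_weight n) * `|c n|) ^+ 2).
Proof.
rewrite /partial_norm big_ord_recr /= sqr_sqrtr; last first.
  by apply: sumr_ge0 => i _; rewrite mulr_ge0 ?sqr_ge0 ?ltW ?sobolev_weight_gt0.
by rewrite exprMn sqr_sqrtr ?ltW ?sobolev_weight_gt0.
Qed.

Lemma partial_normD c c' n :
  partial_norm (c + c') n <= partial_norm c n + partial_norm c' n.
Proof.
elim: n => [|n ih]; first by rewrite /partial_norm !big_ord0 sqrtr0 addr0.
rewrite !partial_normS; apply: le_trans; last first.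
  by apply: sqrt_minkowski; rewrite sqrtr_ge0.
rewrite ler_wsqrtr // lerD // ler_sqr ?nnegrE ?addr_ge0 ?sqrtr_ge0 //;
  rewrite ?mulr_ge0 ?sqrtr_ge0 //.
by rewrite -mulrDr ler_wpM2l ?sqrtr_ge0 // ler_normD.
Qed.

Lemma partial_normZ (a : R) c n :
  partial_norm (a *: c) n = `|a| * partial_norm c n.
Proof.
rewrite /partial_norm -sqrtr_sqr -sqrtrM ?sqr_ge0 //.
by rewrite mulr_sumr; congr Num.sqrt; apply: eq_bigr => j _;
  rewrite /GRing.scale /= normrZ exprMn real_normK ?num_real // mulrCA.
Qed.

Lemma partial_norm_ge0 c n : 0 <= partial_norm c n.
Proof. exact: sqrtr_ge0. Qed.

Lemma sobolev_submod_closed : submod_closed sobolev_seq.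
Proof.
split.
  apply/asboolP; exists 0 => _ [n _ <-].
  by rewrite -[0 : nat -> _](scale0r 0) partial_normZ normr0 mul0r.
move=> a c c' /asboolP [M hM] /asboolP [M' hM'].
apply/asboolP; exists (`|a| * M + M') => _ [n _ <-].
apply: le_trans (partial_normD _ _ _) _; rewrite partial_normZ lerD //.
  by rewrite ler_wpM2l //; apply: hM; exists n.
by apply: hM'; exists n.
Qed.

HB.instance Definition _ :=
  GRing.isSubmodClosed.Build R (nat -> 'rV[R]_d) sobolev_seq
    sobolev_submod_closed.

(* R^d-valued functions (distributions, for s < 0) on the circle of Sobolev
   class s: sequences of Fourier coefficients with
   \sum_j (1 + freq j ^ 2)^s |c j|^2 < +oo *)
Record sobolev : Type := Sobolev {
  coef :> nat -> 'rV[R]_d;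
  coefP : coef \in sobolev_seq
}.

HB.instance Definition _ := [isSub for coef].
HB.instance Definition _ := [Choice of sobolev by <:].
HB.instance Definition _ := [SubChoice_isSubLmodule of sobolev by <:].

Definition sobolev_norm (c : sobolev) : R := sup (range (partial_norm c)).

Lemma sobolev_has_sup (c : sobolev) : has_sup (range (partial_norm c)).
Proof.
split; first by exists (partial_norm c 0), 0.
by case: c => c /= /asboolP.
Qed.

Lemma sobolev_norm_ub (c : sobolev) n : partial_norm c n <= sobolev_norm c.
Proof. by apply: sup_upper_bound; [exact: sobolev_has_sup|exists n]. Qed.

Lemma sobolev_normD (c c' : sobolev) :
  sobolev_norm (c + c') <= sobolev_norm c + sobolev_norm c'.
Proof.
apply: ge_sup => [|_ [n _ <-]]; first by exists (partial_norm (c + c') 0), 0.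
apply: le_trans (partial_normD _ _ _) _.
by rewrite lerD ?sobolev_norm_ub.
Qed.

Lemma sobolev_normZ_le (a : R) (c : sobolev) :
  sobolev_norm (a *: c) <= `|a| * sobolev_norm c.
Proof.
apply: ge_sup => [|_ [n _ <-]]; first by exists (partial_norm (a *: c) 0), 0.
by rewrite partial_normZ ler_wpM2l ?sobolev_norm_ub.
Qed.

Lemma sobolev_normZ (a : R) (c : sobolev) :
  sobolev_norm (a *: c) = `|a| * sobolev_norm c.
Proof.
apply/eqP; rewrite eq_le sobolev_normZ_le /=.
have [->|a0] := eqVneq a 0.
  rewrite normr0 mul0r; apply: le_trans (sobolev_norm_ub _ 0).
  exact: partial_norm_ge0.
rewrite -ler_pdivlMl ?normr_gt0 // -normfV.
by apply: le_trans (sobolev_normZ_le _ _); rewrite scalerA mulVf // scale1r.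
Qed.

Lemma sobolev_norm0_eq0 (c : sobolev) : sobolev_norm c = 0 -> c = 0.
Proof.
move=> c0; apply: val_inj; apply/funext => j /=.
have : partial_norm c j.+1 = 0.
  by apply/eqP; rewrite eq_le partial_norm_ge0 andbT -c0 sobolev_norm_ub.
rewrite partial_normS => /eqP; rewrite sqrtr_eq0 => h.
have : (Num.sqrt (sobolev_weight j) * `|c j|) ^+ 2 <= 0.
  by apply: le_trans h; rewrite lerDr sqr_ge0.
rewrite le_eqVlt ltNge sqr_ge0 orbF sqrf_eq0 mulf_eq0 sqrtr_eq0.
by rewrite leNgt sobolev_weight_gt0 normr_eq0 => /eqP.
Qed.

HB.instance Definition _ := Lmodule_isNormed.Build R sobolev
  sobolev_normD sobolev_normZ sobolev_norm0_eq0.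

End SobolevSpace.

(* f is C^0 if it is continuous, and C^(k+1) if it is differentiable with
   tangent map (x, v) |-> 'd f x v of class C^k.  Asking this for every k is
   equivalent to being C^oo with respect to the operator norms.  The set U is
   meant to be open. *)
Fixpoint class_C {R : realType} (k : nat) {E F : normedModType R}
    (U : set E) (f : E -> F) {struct k} : Prop :=
  if k is k'.+1 then
    (forall x, U x -> differentiable f x) /\
    class_C k' (U `*` [set: E]) (fun p : E * E => 'd f (p.1) p.2)
  else forall x, U x -> {for x, continuous f}.

Definition smooth_on {R : realType} {E F : normedModType R} (U : set E)
  (f : E -> F) : Prop := forall k, class_C k U f.

Record chart (R : realType) (T : Type) (E : normedModType R) := Chart {
  cdom : set T;
  cmap : T -> E;
  cinv : E -> T
}.

Definition cimg (R : realType) T (E : normedModType R) (c : chart T E) : set E :=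
  cmap c @` cdom c.

Record atlas (R : realType) (T : Type) := Atlas {
  aidx : Type;
  amodel : aidx -> normedModType R;
  achart :> forall i, chart T (amodel i)
}.
Arguments amodel {R T} a i : rename.

Section manifolds.
Context (R : realType).

Definition is_chart (T : topologicalType) (E : normedModType R)
    (c : chart T E) : Prop :=
  [/\ open (cdom c), open (cimg c),
      forall p, cdom c p -> cinv c (cmap c p) = p,
      forall p, cdom c p -> {for p, continuous (cmap c)} &
      forall x, cimg c x -> {for x, continuous (cinv c)}].

Definition is_manifold (T : topologicalType) (A : atlas R T) : Prop :=
  [/\ hausdorff_space T,
      forall i, is_chart (A i),
      forall p, exists i, cdom (A i) p &
      forall i j, smooth_on (cmap (A i) @` (cdom (A i) `&` cdom (A j)))
                            (cmap (A j) \o cinv (A i))].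

Definition smooth (S T : topologicalType) (A : atlas R S) (B : atlas R T)
    (f : S -> T) : Prop :=
  continuous f /\
  forall i j, smooth_on (cmap (A i) @` (cdom (A i) `&` f @^-1` cdom (B j)))
                        (cmap (B j) \o f \o cinv (A i)).

Definition vec_atlas (E : normedModType R) : atlas R E :=
  @Atlas R E unit (fun=> E) (fun=> Chart [set: E] id id).

Definition prod_chart S T (E F : normedModType R) (c : chart S E)
    (c' : chart T F) : chart (S * T) (E * F)%type :=
  Chart (cdom c `*` cdom c') (fun p => (cmap c p.1, cmap c' p.2))
        (fun x => (cinv c x.1, cinv c' x.2)).

Definition prod_atlas S T (A : atlas R S) (B : atlas R T) : atlas R (S * T) :=
  Atlas (fun i : aidx A * aidx B => prod_chart (A i.1) (B i.2)).

Definition banach (E : normedModType R) : Prop :=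
  forall F : set_system E, ProperFilter F -> cauchy F -> cvg F.

End manifolds.

Record banach_manifold (R : realType) := BanachManifold {
  bm_space :> topologicalType;
  bm_atlas : atlas R bm_space;
  bm_manifold : is_manifold bm_atlas;
  bm_banach : forall i, banach (amodel bm_atlas i)
}.

#[short(type="topGroupType")]
HB.structure Definition TopGroup := {G of Group G & Topological G}.

Record lie_group (R : realType) := LieGroup {
  lie_sort :> topGroupType;
  lie_dim : nat;
  lie_idx : Type;
  lie_chart : lie_idx -> chart lie_sort 'rV[R]_lie_dim;
  lie_atlas := Atlas lie_chart;
  lie_manifold : is_manifold lie_atlas;
  lie_mul_smooth : smooth (prod_atlas lie_atlas lie_atlas) lie_atlas
                     (fun q => q.1 * q.2)%g;
  lie_inv_smooth : smooth lie_atlas lie_atlas (fun g => g^-1)%g;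
  (* a chart at the identity; it identifies the Lie algebra with R^dim *)
  lie_one : lie_idx;
  lie_oneP : cdom (lie_chart lie_one) 1%g
}.

Section LieGroups.
Context (R : realType) (G : lie_group R).
Local Notation lalg := 'rV[R]_(lie_dim G).

Definition phi1 : G -> lalg := cmap (lie_chart (lie_one G)).
Definition psi1 : lalg -> G := cinv (lie_chart (lie_one G)).

Definition smooth_path (c : R -> G) : Prop :=
  smooth (vec_atlas R) (lie_atlas G) c.

Definition smooth_fun (f : G -> R) : Prop :=
  smooth (lie_atlas G) (vec_atlas R) f.

(* c^-1 dc/dt *)
Definition velocity (c : R -> G) (t : R) : lalg :=
  derive1 (fun h : R => phi1 ((c t)^-1 * c (t + h))%g) 0.

Definition lie_exp (v : lalg) : G :=
  xget 1%g [set g | exists c : R -> G, [/\ smooth_path c,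
    forall a b, c (a + b) = (c a * c b)%g, velocity c 0 = v & g = c 1]].

Definition Ad (g : G) (v : lalg) : lalg :=
  'd (fun x => phi1 (g * psi1 x * g^-1)%g) (phi1 1%g) v.

(* the derivative of f along the left-invariant vector field defined by v *)
Definition left_deriv (f : G -> R) (v : lalg) (g : G) : R :=
  'd (fun x => f (g * psi1 x)%g) (phi1 1%g) v.

Definition invariant_inner_product (B : lalg -> lalg -> R) : Prop :=
  [/\ forall a u v w, B (a *: u + v) w = a * B u w + B v w,
      forall u v, B u v = B v u,
      forall u, u != 0 -> 0 < B u u &
      forall g u v, B (Ad g u) (Ad g v) = B u v].

Definition invariant_metric (dist : G -> G -> R) : Prop :=
  [/\ [/\ forall x y, 0 <= dist x y,
          forall x y, dist x y = 0 <-> x = y,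
          forall x y, dist x y = dist y x &
          forall x y z, dist x z <= dist x y + dist y z],
      forall U : set G, open U <-> forall x, U x ->
        exists2 e : R, 0 < e & forall y, dist x y < e -> U y &
      forall g x y, dist (g * x)%g (g * y)%g = dist x y /\
                    dist (x * g)%g (y * g)%g = dist x y].

Definition piecewise_smooth (c : R -> G) : Prop :=
  exists r : seq R, [/\ sorted <%R (0 :: r), last 0 r = 1 &
    forall i, (i < size r)%N -> exists2 sigma, smooth_path sigma &
      forall t, (0 :: r)`_i <= t <= (0 :: r)`_i.+1 -> c t = sigma t].

(* A path [0, 1] -> G is encoded as a function on R by extending it by constants
   outside [0, 1], so that equality of functions is equality of paths. *)
Definition pw_path (c : R -> G) : Prop :=
  piecewise_smooth c /\ forall t, c t = c (Num.max 0 (Num.min 1 t)).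

Context (B : lalg -> lalg -> R).

Definition speed (c : R -> G) (t : R) : R :=
  Num.sqrt (B (velocity c t) (velocity c t)).

Definition path_length (c : R -> G) : R :=
  \int[lebesgue_measure]_(t in `[0, 1]) speed c t.

Definition path_energy (c : R -> G) : R :=
  \int[lebesgue_measure]_(t in `[0, 1]) (speed c t ^+ 2).

(* +oo when a and b lie in different components of G *)
Definition riem_dist (a b : G) : \bar R :=
  ereal_inf [set (path_length c)%:E |
             c in [set c | [/\ pw_path c, c 0 = a & c 1 = b]]].

(* smooth paths of constant speed that realize the distance *)
Definition shortest_geodesic (a b : G) (c : R -> G) : Prop :=
  [/\ pw_path c, c 0 = a, c 1 = b, (path_length c)%:E = riem_dist a b &
      exists sigma, [/\ smooth_path sigma, {in `[0, 1], c =1 sigma} &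
        {in `[0, 1] &, forall t t', speed sigma t = speed sigma t'}]].

(* the pairing, over D, of the distribution with Fourier coefficients a and the
   function whose value at t is the covector alpha t *)
Definition pairing (D : set R) (a : nat -> lalg) (alpha : R -> lalg -> R) : R :=
  limn (fun n => \sum_(j < n)
    \int[lebesgue_measure]_(t in D) (fourier j t * alpha t (a j))).

Definition test_function (chi : R -> R) : Prop :=
  smooth_on [set: R] chi /\ exists N : R, forall t, N <= `|t| -> chi t = 0.

(* c is locally of class s: so is f \o c for every smooth f.  Here chi * (f \o c)
   is made into a function on R/Z by summing its translates, whose Fourier
   coefficients are the integrals below. *)
Definition sobolev_path (s : R) (c : R -> G) : Prop :=
  continuous c /\ forall f chi, smooth_fun f -> test_function chi ->
    (fun j => const_mx (\int[lebesgue_measure]_(t in [set: R])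
                          (chi t * f (c t) * fourier j t)))
      \in @sobolev_seq R 1 s.

Definition loop (s : R) (c : R -> G) : Prop :=
  sobolev_path s c /\ forall t, c (t + 1) = c t.

Definition based_loop (s : R) (c : R -> G) : Prop := loop s c /\ c 0 = 1%g.

(* A one-form a dt of class s - 1, that is an element of the dual L_s g^*, is
   given by its coefficient a. *)
Definition loop_algebra (s : R) := sobolev (lie_dim G) s.
Definition connection (s : R) := sobolev (lie_dim G) (s - 1).

(* c^-1 dc = a in the sense of distributions: d(f \o c) = (df)(c a) for every
   smooth f *)
Definition log_derivative (c : R -> G) (a : nat -> lalg) : Prop :=
  forall f chi, smooth_fun f -> test_function chi ->
    pairing [set: R] a (fun t v => chi t * left_deriv f v (c t)) =
    - \int[lebesgue_measure]_(t in [set: R]) (f (c t) * derive1 chi t).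

Definition value s (xi : sobolev (lie_dim G) s) (t : R) : lalg :=
  limn (fun n => \sum_(j < n) fourier j t *: xi j).

Definition loop_exp s (xi : sobolev (lie_dim G) s) : R -> G :=
  fun t => lie_exp (value xi t).

Definition loop_pairing s (gamma : connection s) (xi : loop_algebra s) : R :=
  pairing `[0, 1] gamma (fun t v => B v (value xi t)).

(* gamma' = c^-1 dc + c^-1 gamma c; the second term is paired with xi using the
   invariance of the inner product *)
Definition gauge s (c : R -> G) (gamma gamma' : connection s) : Prop :=
  exists2 theta : connection s, log_derivative c theta &
    forall xi : loop_algebra s,
      loop_pairing gamma' xi = loop_pairing theta xi +
        pairing `[0, 1] gamma (fun t v => B v (Ad (c t) (value xi t))).

(* the time-one value of the solution of c^-1 dc = gamma, c 0 = 1 *)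
Definition holonomy s (gamma : connection s) : G :=
  xget 1%g [set g | exists c, [/\ sobolev_path s c, c 0 = 1%g,
                                  log_derivative c gamma & c 1 = g]].

Section hamiltonian.
Context (s : R) (X : banach_manifold R).
Local Notation A := (bm_atlas X).

(* The formulas for the action on connections and for the conjugation action on
   paths define right actions, and so do all the actions below:
   act (c * c') = act c' \o act c.
   The maps xi |-> c * exp xi near 0 are inverses of charts of the Banach Lie
   group of loops, whence the formulation of the smoothness of the action. *)
Record loop_action (act : (R -> G) -> X -> X) : Prop := {
  loop_act1 : forall p, act (fun=> 1%g) p = p;
  loop_actM : forall c c' p, loop s c -> loop s c' ->
    act (fun t => c t * c' t)%g p = act c' (act c p);
  loop_act_smooth : forall c, loop s c ->
    smooth (prod_atlas (vec_atlas (loop_algebra s)) A) A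
      (fun q => act (fun t => c t * loop_exp q.1 t)%g q.2)
}.

(* the vector field defined by xi, at the point p of the i-th chart *)
Definition fundamental_field (act : (R -> G) -> X -> X) (xi : loop_algebra s)
    (i : aidx A) (p : X) : amodel A i :=
  derive1 (fun t : R => cmap (A i) (act (loop_exp (t *: xi)) p)) 0.

(* Two-forms are given by their expressions in the charts. *)
Definition local_forms : Type :=
  forall i : aidx A, amodel A i -> amodel A i -> amodel A i -> R.

Record two_form (w : local_forms) : Prop := {
  two_form_linear : forall i x, cimg (A i) x -> forall a u v z,
    w i x (a *: u + v) z = a * w i x u z + w i x v z;
  two_form_alternating : forall i x, cimg (A i) x ->
    forall u v, w i x u v = - w i x v u;
  two_form_smooth : forall i,
    smooth_on (cimg (A i) `*` [set: amodel A i] `*` [set: amodel A i])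
      (fun q : (amodel A i * amodel A i) * amodel A i => w i q.1.1 q.1.2 q.2);
  two_form_compatible : forall i j p, cdom (A i) p -> cdom (A j) p ->
    let D := 'd (cmap (A j) \o cinv (A i)) (cmap (A i) p) in
    forall u v, w i (cmap (A i) p) u v = w j (cmap (A j) p) (D u) (D v)
}.

Definition closed_form (w : local_forms) : Prop :=
  forall i x, cimg (A i) x -> forall u v z,
    'D_u (fun y => w i y v z) x - 'D_v (fun y => w i y u z) x +
    'D_z (fun y => w i y u v) x = 0.

Definition weakly_nondegenerate (w : local_forms) : Prop :=
  forall i x, cimg (A i) x ->
    forall u, (forall v, w i x u v = 0) -> u = 0.

Record hamiltonian_space (act : (R -> G) -> X -> X) (w : local_forms)
    (mu : X -> connection s) : Prop := {
  ham_action : loop_action act;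
  ham_form : two_form w;
  ham_closed : closed_form w;
  ham_nondegenerate : weakly_nondegenerate w;
  ham_smooth : smooth A (vec_atlas (connection s)) mu;
  ham_equivariant : forall c p, loop s c -> gauge c (mu p) (mu (act c p));
  ham_moment : forall (xi : loop_algebra s) i p v, cdom (A i) p ->
    'D_v (fun x => loop_pairing (mu (cinv (A i) x)) xi) (cmap (A i) p) =
    w i (cmap (A i) p) (fundamental_field act xi i p) v
}.

Definition proper_map (mu : X -> connection s) : Prop :=
  forall K, compact K -> compact (mu @^-1` K).

End hamiltonian.
End LieGroups.

(* The quotient of T by an equivalence relation r: the set of classes r x, with
   the quotient topology. *)
Definition quotient (T : Type) (r : T -> set T) : Type :=
  {classic {C : set T | exists x, C = r x}}.

Section quotient.
Context (T : topologicalType) (r : T -> set T).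

Definition to_quotient (x : T) : quotient r :=
  exist _ (r x) (ex_intro _ x erefl).

Definition representative (q : quotient r) : T := sval (cid (svalP q)).

HB.instance Definition _ := Choice.on (quotient r).

Definition quotient_op : set_system (quotient r) :=
  [set U | open (to_quotient @^-1` U)].

Let quotient_opT : quotient_op setT.
Proof. exact: openT. Qed.

Let quotient_opI : setI_closed quotient_op.
Proof. by move=> U V; exact: openI. Qed.

Let quotient_op_bigU (I : Type) (f : I -> set (quotient r)) :
  (forall i, quotient_op (f i)) -> quotient_op (\bigcup_i f i).
Proof. by move=> h; apply: bigcup_open => i _; exact: h. Qed.

HB.instance Definition _ := isOpenTopological.Build (quotient r)
  quotient_opT quotient_opI quotient_op_bigU.

End quotient.

(* A universal G-bundle, with G acting on the right: act (g * h) = act h \o act g.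
   Its local triviality is expressed by equivariant maps to G. *)
Record universal_bundle (R : realType) (G : topGroupType) := UniversalBundle {
  ub_space :> topologicalType;
  ub_act : G -> ub_space -> ub_space;
  ub_act1 : forall x, ub_act 1%g x = x;
  ub_actM : forall g h x, ub_act (g * h)%g x = ub_act h (ub_act g x);
  ub_act_continuous : continuous (fun q : G * ub_space => ub_act q.1 q.2);
  ub_principal : forall x, exists U, [/\ open U, U x,
    forall g y, U y -> U (ub_act g y) &
    exists2 tau : ub_space -> G, forall y, U y -> {for y, continuous tau} &
      forall g y, U y -> tau (ub_act g y) = (tau y * g)%g];
  ub_contractible : exists (x0 : ub_space) (h : R * ub_space -> ub_space),
    [/\ {within `[0, 1] `*` [set: ub_space], continuous h},
        forall x, h (0, x) = x & forall x, h (1, x) = x0]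
}.

Section equivariant_cohomology.
Context (R : realType) (G : topGroupType) (E : universal_bundle R G).
Context (T : topologicalType) (act : G -> T -> T).

Definition borel_orbit (p : E * T) : set (E * T) :=
  [set q | exists g, q = (ub_act g p.1, act g p.2)].

Definition borel_construction : topologicalType := quotient borel_orbit.

(* For an invariant subset A of T, the projection of E * T to its quotient being
   open, the quotient of E * A is a subspace of that of E * T. *)
Definition borel_subspace (A : set T) : set borel_construction :=
  @to_quotient _ borel_orbit @` ([set: E] `*` A).

Definition equivariant_cohomology (k : nat) (A : set T) : Type :=
  cohomology R k (borel_subspace A).

Lemma borel_subspaceS (A B : set T) :
  A `<=` B -> borel_subspace A `<=` borel_subspace B.
Proof. by move=> AB; apply: image_subset => p [? /AB]. Qed.

Definition equivariant_restriction (k : nat) (A B : set T) (AB : A `<=` B) :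
    equivariant_cohomology k B -> equivariant_cohomology k A :=
  restriction (borel_subspaceS AB).

Definition restriction_surjective (A B : set T) (AB : A `<=` B) : Prop :=
  forall k, set_surj [set: equivariant_cohomology k B]
    [set: equivariant_cohomology k A] (equivariant_restriction (k := k) AB).

End equivariant_cohomology.

Section associated_space.
Context (R : realType) (G : lie_group R).

Definition conjugate (I : Type) (g : G) (x : I -> G) : I -> G :=
  fun i => (g^-1 * x i * g)%g.

Context (s : R) (X : banach_manifold R).
Context (act : (R -> G) -> X -> X) (mu : X -> connection G s).

Definition based_orbit (p : X) : set X :=
  [set q | exists2 c, based_loop s c & q = act c p].

Definition assoc_space : topologicalType := quotient based_orbit.

(* G acts through constant loops *)
Definition assoc_act (g : G) (m : assoc_space) : assoc_space :=
  to_quotient based_orbit (act (fun=> g) (representative m)).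

Definition assoc_Phi (m : assoc_space) : G := holonomy (mu (representative m)).

End associated_space.

Section paths.
Context (R : realType) (G : lie_group R).
Context (B : 'rV[R]_(lie_dim G) -> 'rV[R]_(lie_dim G) -> R).

Definition based_path : Type :=
  {classic {c : R -> G | pw_path c /\ c 0 = 1%g}}.

Section path_space.
Context (dist : G -> G -> R).

Definition path_metric (c c' : based_path) : R :=
  sup [set dist (sval c t) (sval c' t) | t in `[0, 1]] +
  `|path_length B (sval c) - path_length B (sval c')|.

Definition path_open : set_system based_path :=
  [set U | forall c, U c ->
     exists2 e : R, 0 < e & forall c', path_metric c c' < e -> U c'].

Lemma path_openT : path_open setT.
Proof. by move=> c _; exists 1. Qed.

Lemma path_openI : setI_closed path_open.
Proof.
move=> U V oU oV c [/oU [e e0 eU] /oV [e' e'0 eV]].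
exists (Num.min e e'); first by rewrite lt_min e0.
by move=> c'; rewrite lt_min => /andP[/eU ? /eV].
Qed.

Lemma path_open_bigU (I : Type) (f : I -> set based_path) :
  (forall i, path_open (f i)) -> path_open (\bigcup_i f i).
Proof.
move=> h c [i _ /h [e e0 eU]]; exists e => // c' /eU ?.
by exists i.
Qed.

End path_space.
End paths.

Definition path_space (R : realType) (G : lie_group R)
  (B : 'rV[R]_(lie_dim G) -> 'rV[R]_(lie_dim G) -> R) (dist : G -> G -> R) :
  Type := based_path G.

Section path_space_topology.
Context (R : realType) (G : lie_group R).
Context (B : 'rV[R]_(lie_dim G) -> 'rV[R]_(lie_dim G) -> R) (dist : G -> G -> R).

HB.instance Definition _ := Choice.on (path_space B dist).
HB.instance Definition _ := isOpenTopological.Build (path_space B dist)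
  (path_openT B dist) (@path_openI _ _ B dist) (@path_open_bigU _ _ B dist).

(* The conjugate of a based path is a based path, so the second case of the
   definition never occurs. *)
Definition path_act (g : G) (c : path_space B dist) : path_space B dist :=
  if pselect (pw_path (conjugate g (sval c)) /\ conjugate g (sval c) 0 = 1%g)
    is left h then exist _ _ h else c.

End path_space_topology.

Section approximations.
Context (R : realType) (G : lie_group R).
Context (B : 'rV[R]_(lie_dim G) -> 'rV[R]_(lie_dim G) -> R).
Context (M : topologicalType) (actM : G -> M -> M) (Phi : M -> G).

Section infinite.
Context (dist : G -> G -> R).

Definition hat_act (g : G) (x : path_space B dist * M) : path_space B dist * M :=
  (path_act g x.1, actM g x.2).

Definition hat_space : set (path_space B dist * M) :=
  [set x | Phi x.2 = sval x.1 1].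

Definition hat_energy (x : path_space B dist * M) : R :=
  path_energy B (sval x.1).

Definition hat_zero : set (path_space B dist * M) :=
  hat_space `&` hat_energy @^-1` [set 0].

Lemma hat_zeroS : hat_zero `<=` hat_space.
Proof. exact: subIsetl. Qed.

End infinite.

Section finite.
Context (n : nat) (rhobar : R).

(* g_i for 0 <= i <= n, where g_0 = e and g = (g_1, ..., g_n) *)
Definition vertex (g : 'I_n -> G) (i : nat) : G :=
  if i is i'.+1 then oapp g 1%g (insub i') else 1%g.

Definition fin_act (g : G) (x : {ptws 'I_n -> G} * M) : {ptws 'I_n -> G} * M :=
  (conjugate g x.1, actM g x.2).

Definition fin_space : set ({ptws 'I_n -> G} * M) :=
  [set x | vertex x.1 n = Phi x.2].

Definition fin_energy (x : {ptws 'I_n -> G} * M) : \bar R :=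
  (n%:R%:E *
   \sum_(0 <= i < n) riem_dist B (vertex x.1 i) (vertex x.1 i.+1) ^+ 2)%E.

Definition fin_manifold : set ({ptws 'I_n -> G} * M) :=
  fin_space `&` [set x | fin_energy x < (2^-1 * n%:R * rhobar ^+ 2)%:E]%E.

Definition fin_zero : set ({ptws 'I_n -> G} * M) :=
  fin_manifold `&` fin_energy @^-1` [set 0%E].

Lemma fin_zeroS : fin_zero `<=` fin_manifold.
Proof. exact: subIsetl. Qed.

End finite.
End approximations.

Arguments assoc_act {R G} s {X} act g m.
Arguments assoc_Phi {R G s X} act mu m.
Arguments hat_act {R G B M} actM dist g x.
Arguments hat_zeroS {R G} B {M} Phi dist.
Arguments fin_act {R G M} actM n g x.
Arguments fin_zeroS {R G} B {M} Phi n rhobar.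

(* Main.v *)
From HB Require Import structures.
Require Import Defs.
From mathcomp Require Import all_boot all_order all_algebra.
From mathcomp Require Import generic_quotient.
From mathcomp Require Import all_classical all_reals all_analysis.
From mathcomp Require Import measurable_realfun.
From mathcomp Require Import ring lra zify.
Import Order.TTheory GRing.Theory Num.Theory.
Import numFieldTopology.Exports numFieldNormedType.Exports.
Local Open Scope classical_set_scope.
Local Open Scope ring_scope.
Set Implicit Arguments.
Unset Strict Implicit.
Unset Printing Implicit Defensive.

(** Over a field, a map is surjective in cohomology exactly when it is injective
    in homology, and homology has compact supports. In terms of cocycles: that a
    restriction is surjective means that every cocycle of the subspace is the
    restriction of a cocycle of the space (restriction_surjP). The extensions of
    a given cocycle are the solutions of a system of linear equations over the
    rationals, each in finitely many unknowns, and such a system is solvable as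
    soon as its finite subsystems are (linear_system_compactness). Hence it is
    enough to extend a cocycle so that its coboundary vanishes on finitely many
    given simplices; these may be moved to another space on which the restriction
    is known to be surjective (restriction_surj_finitary).

    The other space is the Borel construction of Y_n, for large n. A path and a
    point (lambda, m) are sent to the inscribed polygon
    (lambda(1/n), ..., lambda(1), m). This is an equivariant continuous map from
    the infinite to the finite approximating space. It does not send the whole
    of the first into Y_n, as the energy of the polygon may be too large; but
    the simplices of a finite chain are compact, and for n large it sends them
    into Y_n. Indeed each edge of the polygon is short when n is large, by
    uniform continuity of lambda and because the Riemannian distance is small
    near the diagonal (slow_path, riem_dist_near1), while the sum of the edges
    is at most the length of lambda (sum_riem_dist). The sum of the squares of
    the edges is therefore small, and it is so uniformly near lambda, because the
    metric of the path space controls both the position and the length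
    (polygon_energy_small). The paths for which this happens from some N on form
    an invariant open set that grows to the whole path space with N (stage), so
    that a compact set is contained in one of them (simplex_in_stage).

    On the zero sets of the energies the map is a homeomorphism: a path without
    energy and a polygon without energy are constant (energy0_cst,
    riem_dist_eq0), so both sets are copies of the fibre of Phi over the
    identity. Thus a cocycle of the zero set of the infinite space is
    carried to that of Y_n, extended to Y_n, and pulled back. *)

(** * Maps of class C^k *)

Lemma near_eq_diff (R : realType) (E F : normedModType R) (f g : E -> F) x :
  {near x, f =1 g} -> differentiable f x ->
  differentiable g x /\ 'd g x = 'd f x :> (E -> F).
Proof.
move=> fg df.
have fgx : f x = g x by exact: (nbhs_singleton fg).
have Hg : g \o shift x = cst (g x) + 'd f x +o_ 0 id.
  have /eqaddoP Hf := diff_locally df.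
  apply/eqaddoP => e e0; have := Hf e e0.
  have fg' : \forall y \near (0 : E), f (y + x) = g (y + x).
    have : \forall y \near x, f y = g y by exact: fg.
    by rewrite (near_shift 0 x) /= subr0.
  by apply: filterS2 fg' => y /= fgy; rewrite /= !fctE /= fgy fgx.
have dg : 'd g x = 'd f x :> (E -> F).
  by apply: diff_unique => //; exact: diff_continuous.
by split => //; apply/diff_locallyP; rewrite dg; split => //; exact: diff_continuous.
Qed.

Lemma open_setX (S T : topologicalType) (U : set S) (V : set T) :
  open U -> open V -> open (U `*` V).
Proof.
rewrite !openE => oU oV [x y] [/= /oU Ux /oV Vy].
by exists (U, V).
Qed.

Lemma continuous_pair (S T T' : topologicalType) (f : S -> T) (g : S -> T') x :
  {for x, continuous f} -> {for x, continuous g} ->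
  {for x, continuous (fun y => (f y, g y))}.
Proof. by move=> cf cg; apply: cvg_pair; [exact: cf|exact: cg]. Qed.

Section class_C_theory.
Context (R : realType).
Implicit Types E F H : normedModType R.

Lemma class_CS k E F (U : set E) (f : E -> F) : class_C k.+1 U f <->
  (forall x, U x -> differentiable f x) /\
  class_C k (U `*` [set: E]) (fun p : E * E => 'd f (p.1) p.2).
Proof. by []. Qed.

Lemma class_C_sub k E F (U V : set E) (f : E -> F) :
  V `<=` U -> class_C k U f -> class_C k V f.
Proof.
elim: k E F U V f => [|k IH] E F U V f VU /=; first by move=> h x /VU; exact: h.
move=> [df Cf]; split=> [x /VU|]; first exact: df.
by apply: IH Cf => -[x v] /= [/VU].
Qed.

Lemma class_C_local k E F (U : set E) (f : E -> F) :
  (forall x, U x -> exists2 V, V x & class_C k V f) -> class_C k U f.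
Proof.
elim: k E F U f => [|k IH] E F U f /= h.
  by move=> x /h[V Vx]; exact.
split=> [x /h[V Vx [+ _]]|]; first exact.
apply: IH => -[x v] [/= /h[V Vx [_ CV]] _].
by exists (V `*` setT).
Qed.

Lemma class_CW k E F (U : set E) (f : E -> F) :
  class_C k.+1 U f -> class_C k U f.
Proof.
elim: k E F U f => [|k IH] E F U f [df Cf]; last by split=> //; exact: IH.
by move=> x /df /differentiable_continuous.
Qed.

Lemma open_setXT E F (U : set E) : open U -> open (U `*` [set: F]).
Proof. by move=> oU; apply: open_setX => //; exact: openT. Qed.

Lemma class_C_congr k E F (U : set E) (f g : E -> F) :
  open U -> (forall x, U x -> f x = g x) -> class_C k U f -> class_C k U g.
Proof.
elim: k E F U f g => [|k IH] E F U f g oU fg.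
  move=> cf x Ux; have nfg : {near x, f =1 g}.
    by apply: filterS (open_nbhs_nbhs (conj oU Ux)) => y /fg.
  rewrite /prop_for /continuous_at -(fg x Ux).
  by apply: cvg_trans (cf x Ux); exact: near_eq_cvg.
move=> /class_CS[df Cf].
have dg x : U x -> differentiable g x /\ 'd g x = 'd f x :> (E -> F).
  move=> Ux; apply: near_eq_diff; last exact: df.
  by apply: filterS (open_nbhs_nbhs (conj oU Ux)) => y /fg.
apply/class_CS; split=> [x /dg[]//|]; apply: IH Cf; first exact: open_setXT.
by move=> [x v] [/dg[_ e] _] /=; rewrite e.
Qed.

Lemma class_C_pair k E F H (U : set E) (f : E -> F) (g : E -> H) :
  open U -> class_C k U f -> class_C k U g ->
  class_C k U (fun x => (f x, g x)).
Proof.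
elim: k E F H U f g => [|k IH] E F H U f g oU.
  by move=> cf cg x Ux; apply: cvg_pair; [exact: cf|exact: cg].
move=> /class_CS[df Cf] /class_CS[dg Cg]; apply/class_CS; split=> [x Ux|].
  by apply: differentiable_pair; [exact: df|exact: dg].
apply: (class_C_congr (f :=
    fun p : E * E => ('d f (p.1) p.2, 'd g (p.1) p.2))).
- exact: open_setXT.
- by move=> [x v] [/= Ux _]; rewrite diff_pair; [|exact: df|exact: dg].
- by apply: IH => //; exact: open_setXT.
Qed.

Lemma class_C_linear k E F (U : set E) (f : {linear E -> F}) :
  continuous f -> class_C k U f.
Proof.
elim: k E F U f => [|k IH] E F U f cf; first by move=> x _; exact: cf.
split=> [x _|]; first exact: linear_differentiable.
pose g : {linear (E * E)%type -> F} := f \o snd.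
have cg : continuous g.
  by move=> p; apply: continuous_comp; [exact: cvg_snd|exact: cf].
rewrite (_ : (fun p => _) = g); first exact: IH.
by apply/funext => -[x v]; rewrite diff_lin.
Qed.

Lemma class_C_cst k E F (U : set E) (a : F) : class_C k U (fun=> a).
Proof.
elim: k E F U a => [|k IH] E F U a; first by move=> x _; exact: cvg_cst.
split=> [x _|]; first exact: differentiable_cst.
rewrite (_ : (fun p => _) = (fun=> 0)); first exact: IH.
by apply/funext => p; rewrite diff_cst.
Qed.

Lemma class_C_fst k E F (U : set (E * F)) : class_C k U fst.
Proof. by apply: (@class_C_linear _ _ _ _ fst) => p; exact: cvg_fst. Qed.

Lemma class_C_snd k E F (U : set (E * F)) : class_C k U snd.
Proof. by apply: (@class_C_linear _ _ _ _ snd) => p; exact: cvg_snd. Qed.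

Lemma class_C_id k E (U : set E) : class_C k U id.
Proof. by apply: (@class_C_linear _ _ _ _ idfun) => p; exact: cvg_id. Qed.

Lemma class_C_scale k E (U : set R) (v : E) :
  class_C k U (fun a : R => a *: v).
Proof.
have lin : linear ( *:%R ^~ v : R -> E) by move=> a x y; rewrite scalerDl scalerA.
pose linM := GRing.isLinear.Build _ _ _ _ _ lin.
pose L : {linear R -> E} := HB.pack (fun a : R => a *: v) linM.
by apply: (@class_C_linear _ _ _ _ L); exact: scalel_continuous.
Qed.

(** The tangent map of g \o f is the tangent map of g after the pair of f and the
    tangent map of f, which is of the order needed for the induction. *)
Lemma class_C_comp k E F H (U : set E) (V : set F) (f : E -> F) (g : F -> H) :
  open U -> open V -> (forall x, U x -> V (f x)) ->
  class_C k U f -> class_C k V g -> class_C k U (g \o f).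
Proof.
elim: k E F H U V f g => [|k IH] E F H U V f g oU oV UV.
  move=> cf cg x Ux; apply: continuous_comp; first exact: cf.
  exact/cg/UV.
move=> Cf Cg; have /class_CS[df Cdf] := Cf.
have /class_CS[dg Cdg] := Cg.
apply/class_CS; split=> [x Ux|].
  by apply: differentiable_comp; [exact: df|exact/dg/UV].
have oUT := @open_setXT E E U oU; have oVT := @open_setXT F F V oV.
apply: (class_C_congr (f := (fun p : F * F => 'd g (p.1) p.2) \o
    (fun p : E * E => ((f \o fst) p, 'd f (p.1) p.2)))) => //.
  by move=> [x v] [/= Ux _]; rewrite (diff_comp (df _ Ux) (dg _ (UV _ Ux))).
apply: (IH _ _ _ _ (V `*` setT)) => // [[x v] [/= Ux _]|].
  by split => //; exact: UV.
apply: class_C_pair => //; apply: (IH _ _ _ _ U) => // [[x v] []//||].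
  exact: class_C_fst.
exact: class_CW.
Qed.

Lemma class_CD k E F (U : set E) (f g : E -> F) : open U ->
  class_C k U f -> class_C k U g -> class_C k U (f \+ g).
Proof.
move=> oU Cf Cg; pose add : {linear (F * F)%type -> F} := fst \+ snd.
apply: (@class_C_comp _ _ _ _ _ setT (fun x => (f x, g x)) add) => //.
- exact: openT.
- exact: class_C_pair.
- by apply: class_C_linear; exact: add_continuous.
Qed.

Lemma class_CM k E (U : set E) (f g : E -> R) : open U ->
  class_C k U f -> class_C k U g -> class_C k U (fun x => f x * g x).
Proof.
elim: k E U f g => [|k IH] E U f g oU.
  by move=> cf cg x Ux; apply: cvgM; [exact: cf|exact: cg].
move=> Cf Cg; have /class_CS[df Cdf] := Cf.
have /class_CS[dg Cdg] := Cg.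
apply/class_CS; split=> [x Ux|].
  by apply: differentiableM; [exact: df|exact: dg].
have oUT := @open_setXT E E U oU.
apply: (class_C_congr (f := (fun p : E * E => (f \o fst) p * 'd g (p.1) p.2) \+
    (fun p : E * E => (g \o fst) p * 'd f (p.1) p.2))) => //=.
  move=> [x v] [/= Ux _].
  have dM : 'd (f * g) x = f x \*: 'd g x + g x \*: 'd f x :> (E -> R).
    exact: diffM (df _ Ux) (dg _ Ux).
  exact: esym (congr1 (fun h => h v) dM).
have Cfst (h : E -> R) : class_C k.+1 U h -> class_C k (U `*` [set: E]) (h \o fst).
  move=> Ch; apply: (@class_C_comp _ _ _ _ _ U) => // [[x v] []//||].
    exact: class_C_fst.
  exact: class_CW.
by apply: class_CD => //; apply: IH => //; exact: Cfst.
Qed.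

End class_C_theory.

(** * Smooth maps between manifolds *)

Section charts.
Context (R : realType).

Lemma chart_image_open (T : topologicalType) (E : normedModType R)
    (c : chart T E) (O : set T) :
  is_chart c -> open O -> open (cmap c @` (cdom c `&` O)).
Proof.
move=> [oD oI cK _ cinvC] oO.
have -> : cmap c @` (cdom c `&` O) =
          [set x | cimg c x /\ (cdom c `&` O) (cinv c x)].
  apply/seteqP; split=> x /=.
    by move=> [p [Dp Op] <-]; rewrite cK //; split => //; exists p.
  move=> [[p Dp <-]]; rewrite cK // => -[_ Op]; by exists p.
rewrite openE => x [Ix Ox]; have nI := open_nbhs_nbhs (conj oI Ix).
have : nbhs x (cinv c @^-1` (cdom c `&` O)).
  apply: cinvC => //; apply: open_nbhs_nbhs; split => //.
  exact: openI.
by apply: filterS2 nI.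
Qed.

Lemma prod_is_chart (S T : topologicalType) (E F : normedModType R)
    (c : chart S E) (c' : chart T F) :
  is_chart c -> is_chart c' -> is_chart (prod_chart c c').
Proof.
move=> [oD oI cK cC cinvC] [oD' oI' cK' cC' cinvC'].
have imE : cimg (prod_chart c c') = cimg c `*` cimg c'.
  apply/seteqP; split=> [_ [[p q] [/= Dp Dq] <-]|[_ _] [/= [p Dp <-] [q Dq <-]]].
    by split; [exists p|exists q].
  by exists (p, q).
split.
- exact: open_setX.
- by rewrite imE; exact: open_setX.
- by move=> [p q] [/= Dp Dq]; rewrite cK ?cK'.
- move=> [p q] [/= Dp Dq]; apply: cvg_pair.
    by apply: (@continuous_comp _ _ _ fst (cmap c)); [exact: cvg_fst|exact: cC].
  by apply: (@continuous_comp _ _ _ snd (cmap c')); [exact: cvg_snd|exact: cC'].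
- move=> [x y]; rewrite imE => -[/= Ix Iy]; apply: cvg_pair.
    by apply: (@continuous_comp _ _ _ fst (cinv c)); [exact: cvg_fst|exact: cinvC].
  by apply: (@continuous_comp _ _ _ snd (cinv c')); [exact: cvg_snd|exact: cinvC'].
Qed.

Lemma vec_is_chart (E : normedModType R) i : is_chart (@vec_atlas R E i).
Proof.
have imE : cimg (@vec_atlas R E i) = setT.
  by apply/seteqP; split=> // x _; exists x.
split=> //=; rewrite ?imE; by [exact: openT|move=> x _; exact: cvg_id].
Qed.

End charts.

Definition charted (R : realType) (T : topologicalType) (A : atlas R T) : Prop :=
  (forall i, is_chart (A i)) /\ (forall p, exists i, cdom (A i) p).

Section smooth_theory.
Context (R : realType).
Implicit Types S T : topologicalType.

Lemma charted_manifold T (A : atlas R T) : is_manifold A -> charted A.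
Proof. by case. Qed.

Lemma charted_prod S T (A : atlas R S) (B : atlas R T) :
  charted A -> charted B -> charted (prod_atlas A B).
Proof.
move=> [cA covA] [cB covB]; split=> [[i j]|[p q]]; first exact: prod_is_chart.
by have [i Di] := covA p; have [j Dj] := covB q; exists (i, j).
Qed.

Lemma charted_vec (E : normedModType R) : charted (vec_atlas E).
Proof. by split=> [i|p]; [exact: vec_is_chart|exists tt]. Qed.

(** Near a point, a chart around its image by f splits the expression of g \o f in
    charts into those of f and of g. *)
Lemma smooth_comp S T T' (A : atlas R S) (B : atlas R T) (C : atlas R T')
    (f : S -> T) (g : T -> T') :
  charted A -> charted B -> charted C ->
  smooth A B f -> smooth B C g -> smooth A C (g \o f).
Proof.
move=> [cA _] [cB covB] [cC _] [fC sf] [gC sg]; split.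
  by move=> p; apply: continuous_comp; [exact: fC|exact: gC].
move=> i l k; apply: class_C_local => _ [p [Dp /= Dl] <-].
have [j Dj] := covB (f p).
have [oDl _ _ _ _] := cC l; have [oDj _ jK _ _] := cB j.
have oO : open (f @^-1` cdom (B j) `&` (g \o f) @^-1` cdom (C l)).
  apply: openI; first by apply: open_comp oDj => ? _; exact: fC.
  apply: (@open_comp _ _ (g \o f)) oDl => q _.
  by apply: continuous_comp; [exact: fC|exact: gC].
exists (cmap (A i) @` (cdom (A i) `&` (f @^-1` cdom (B j) `&`
    (g \o f) @^-1` cdom (C l)))); first by exists p.
have [_ _ iK _ _] := cA i.
apply: (class_C_congr (f := (cmap (C l) \o g \o cinv (B j)) \o
    (cmap (B j) \o f \o cinv (A i)))).
- exact: chart_image_open.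
- by move=> _ [q [Dq [/= fq gq]] <-]; rewrite /= iK // jK.
- apply: (class_C_comp (V := cmap (B j) @` (cdom (B j) `&` g @^-1` cdom (C l)))).
  + exact: chart_image_open.
  + apply: chart_image_open => //.
    by apply: open_comp oDl => ? _; exact: gC.
  + by move=> _ [q [Dq [/= fq gq]] <-]; rewrite /= iK //; exists (f q).
  + apply: class_C_sub (sf i j k) => _ [q [Dq [/= fq gq]] <-].
    by exists q.
  + exact: sg.
Qed.

Lemma smooth_pair S T T' (A : atlas R S) (B : atlas R T) (C : atlas R T')
    (f : S -> T) (g : S -> T') :
  charted A -> charted B -> charted C ->
  smooth A B f -> smooth A C g ->
  smooth A (prod_atlas B C) (fun x => (f x, g x)).
Proof.
move=> [cA _] [cB _] [cC _] [fC sf] [gC sg]; split.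
  by move=> p; apply: cvg_pair; [exact: fC|exact: gC].
move=> i [j l] k.
have [oDj _ _ _ _] := cB j; have [oDl _ _ _ _] := cC l.
apply: class_C_pair.
- apply: chart_image_open => //=.
  have -> : (fun x => (f x, g x)) @^-1` (cdom (B j) `*` cdom (C l)) =
    f @^-1` cdom (B j) `&` g @^-1` cdom (C l) by [].
  by apply: openI; [apply: open_comp oDj|apply: open_comp oDl] => ? _;
    [exact: fC|exact: gC].
- by apply: class_C_sub (sf i j k) => _ [q [Dq [/= fq gq]] <-]; exists q.
- by apply: class_C_sub (sg i l k) => _ [q [Dq [/= fq gq]] <-]; exists q.
Qed.

Lemma smooth_cst S T (A : atlas R S) (B : atlas R T) (a : T) :
  smooth A B (fun=> a).
Proof.
split; first by move=> p; exact: cvg_cst.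
by move=> i j k; exact: class_C_cst.
Qed.

Lemma smooth_id S (A : atlas R S) : is_manifold A -> smooth A A id.
Proof. by move=> [_ _ _ sA]; split=> [p|i j]; [exact: cvg_id|exact: sA]. Qed.

Lemma smooth_fst S T (A : atlas R S) (B : atlas R T) :
  is_manifold A -> charted B -> smooth (prod_atlas A B) A fst.
Proof.
move=> [_ cA _ sA] [cB _]; split; first by move=> p; exact: cvg_fst.
move=> [i j] l k /=; have [oDl _ _ _ _] := cA l.
apply: (class_C_comp (f := fst) (g := cmap (A l) \o cinv (A i))
  (V := cmap (A i) @` (cdom (A i) `&` cdom (A l)))).
- apply: (@chart_image_open _ _ _ (prod_chart (A i) (B j))).
    exact: prod_is_chart.
  by apply: open_comp oDl => ? _; exact: cvg_fst.
- exact: chart_image_open.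
- by move=> _ [[p q] [[/= Dp Dq] Dl] <-]; exists p.
- exact: class_C_fst.
- exact: sA.
Qed.

Lemma smooth_snd S T (A : atlas R S) (B : atlas R T) :
  charted A -> is_manifold B -> smooth (prod_atlas A B) B snd.
Proof.
move=> [cA _] [_ cB _ sB]; split; first by move=> p; exact: cvg_snd.
move=> [i j] l k /=; have [oDl _ _ _ _] := cB l.
apply: (class_C_comp (f := snd) (g := cmap (B l) \o cinv (B j))
  (V := cmap (B j) @` (cdom (B j) `&` cdom (B l)))).
- apply: (@chart_image_open _ _ _ (prod_chart (A i) (B j))).
    exact: prod_is_chart.
  by apply: open_comp oDl => ? _; exact: cvg_snd.
- exact: chart_image_open.
- by move=> _ [[p q] [[/= Dp Dq] Dl] <-]; exists q.
- exact: class_C_snd.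
- exact: sB.
Qed.

(** The charts of a vector space being global, smoothness of a map between
    vector spaces is smoothness in the sense of calculus. *)
Lemma smooth_vec (E F : normedModType R) (f : E -> F) :
  smooth (vec_atlas E) (vec_atlas F) f <-> smooth_on setT f.
Proof.
split=> [[_ sf]|sf].
  by move=> k; apply: class_C_sub (sf tt tt k) => x _; exists x.
split=> [x|i j k]; first exact: (sf 0%N).
exact: class_C_sub (sf k).
Qed.

End smooth_theory.

(** * Velocity of paths in a Lie group *)

Section lie_calculus.
Context (R : realType) (G : lie_group R).
Local Notation lalg := 'rV[R]_(lie_dim G).
Local Notation A := (lie_atlas G).
Local Notation one := (lie_one G).
Local Notation phi := (@phi1 R G).
Local Notation psi := (@psi1 R G).
Local Notation x0 := (phi 1%g).
Local Notation U1 := (cdom (lie_chart one)).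

Lemma lie_charted : charted A.
Proof. exact: charted_manifold (lie_manifold G). Qed.

Lemma smooth_ldiv :
  smooth (prod_atlas A A) A (fun q : G * G => q.1^-1 * q.2)%g.
Proof.
have cA := lie_charted; have cAA := charted_prod cA cA.
apply: (smooth_comp (f := fun q : G * G => (q.1^-1, q.2)%g) _ _ _ _
  (lie_mul_smooth G)) => //.
apply: smooth_pair => //.
  apply: (smooth_comp (f := fst) _ _ _ _ (lie_inv_smooth G)) => //.
  exact: smooth_fst (lie_manifold G) cA.
exact: smooth_snd cA (lie_manifold G).
Qed.

Lemma smooth_lmul (a : G) : smooth A A (fun x => a * x)%g.
Proof.
have cA := lie_charted; have cAA := charted_prod cA cA.
apply: (smooth_comp (f := fun x : G => (a, x)) _ _ _ _
  (lie_mul_smooth G)) => //.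
apply: smooth_pair => //; first exact: smooth_cst.
exact: smooth_id (lie_manifold G).
Qed.

Lemma smooth_rmul (a : G) : smooth A A (fun x => x * a)%g.
Proof.
have cA := lie_charted; have cAA := charted_prod cA cA.
apply: (smooth_comp (f := fun x : G => (x, a)) _ _ _ _
  (lie_mul_smooth G)) => //.
apply: smooth_pair => //; last exact: smooth_cst.
exact: smooth_id (lie_manifold G).
Qed.

Lemma smooth_conj (a : G) : smooth A A (fun x => a * x * a^-1)%g.
Proof.
have cA := lie_charted.
exact: smooth_comp (smooth_lmul a) (smooth_rmul _).
Qed.

Lemma smooth_path_comp (f : G -> G) (c : R -> G) :
  smooth A A f -> smooth_path c -> smooth_path (f \o c).
Proof.
have cA := lie_charted; have cR := charted_vec (R : normedModType R).
by move=> sf sc; apply: smooth_comp sf.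
Qed.

Lemma smooth_path_affine (a b : R) (c : R -> G) :
  smooth_path c -> smooth_path (fun t => c (a + b * t)).
Proof.
have cA := lie_charted; have cR := charted_vec (R : normedModType R).
move=> sc; apply: (smooth_comp (f := fun t : R => a + b * t) cR cR cA _ sc).
apply/smooth_vec => k; apply: class_CD => //; first exact: openT.
  exact: class_C_cst.
by apply: class_CM; [exact: openT|exact: class_C_cst|exact: class_C_id].
Qed.

Lemma lmul_continuous (a : G) : continuous (fun x : G => a * x)%g.
Proof. by have [] := smooth_lmul a. Qed.

Lemma smooth_path_continuous (c : R -> G) : smooth_path c -> continuous c.
Proof. by case. Qed.

Lemma U1_open : open U1.
Proof. by have [cA _] := lie_charted; have [] := cA one. Qed.

Lemma nbhs1U1 : nbhs (1%g : G) U1.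
Proof. by apply: open_nbhs_nbhs; split; [exact: U1_open|exact: lie_oneP]. Qed.

Lemma phi1K g : U1 g -> psi (phi g) = g.
Proof. by have [cA _] := lie_charted; have [_ _ h _ _] := cA one; exact: h. Qed.

Lemma psi1K x : cimg (lie_chart one) x -> phi (psi x) = x.
Proof. by move=> [g Ug <-]; rewrite -/(phi g) phi1K. Qed.

Lemma psi1_dom x : cimg (lie_chart one) x -> U1 (psi x).
Proof. by move=> [g Ug <-]; rewrite -/(phi g) phi1K. Qed.

Lemma psi1_x0 : psi x0 = 1%g.
Proof. by rewrite phi1K //; exact: lie_oneP. Qed.

Lemma cimg1_open : open (cimg (lie_chart one)).
Proof. by have [cA _] := lie_charted; have [] := cA one. Qed.

Lemma nbhs_cimg1 : nbhs x0 (cimg (lie_chart one)).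
Proof.
apply: open_nbhs_nbhs; split; first exact: cimg1_open.
by exists 1%g => //; exact: lie_oneP.
Qed.

Lemma phi1_continuous g : U1 g -> {for g, continuous phi}.
Proof. by have [cA _] := lie_charted; have [_ _ _ h _] := cA one; exact: h. Qed.

Lemma psi1_continuous x :
  cimg (lie_chart one) x -> {for x, continuous psi}.
Proof. by have [cA _] := lie_charted; have [_ _ _ _ h] := cA one; exact: h. Qed.

Lemma smooth_read (f : G -> G) x :
  smooth A A f -> cimg (lie_chart one) x -> U1 (f (psi x)) ->
  differentiable (phi \o f \o psi) x.
Proof.
move=> [_ /(_ one one 1%N) /class_CS[df _]] Ix Uf; apply: df.
by exists (psi x); [split => //; exact: psi1_dom|exact: psi1K].
Qed.

(** Near the identity gamma is psi \o phi \o gamma, and the chain rule applies. *)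
Lemma derive_chart (V : normedModType R) (Q : G -> V) (gamma : R -> G) :
  gamma 0 = 1%g -> {for 0, continuous gamma} ->
  derivable (phi \o gamma) 0 1 -> differentiable (Q \o psi) x0 ->
  derivable (Q \o gamma) 0 1 /\
  derive1 (Q \o gamma) 0 = 'd (Q \o psi) x0 (derive1 (phi \o gamma) 0).
Proof.
move=> g0 cg /derivable1_diffP dg dQ.
have nE : {near (0 : R), (Q \o psi) \o (phi \o gamma) =1 Q \o gamma}.
  have : \forall h \near (0 : R), U1 (gamma h).
    by apply: cg; rewrite g0; exact: nbhs1U1.
  by apply: filterS => h Uh /=; rewrite phi1K.
have dQ' : differentiable (Q \o psi) ((phi \o gamma) 0) by rewrite /= g0.
have [d e] := near_eq_diff nE (differentiable_comp dg dQ').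
split; first exact/derivable1_diffP.
by rewrite derive1E' // e (diff_comp dg dQ') /= (derive1E' dg) g0.
Qed.

(** The velocity of a smooth path, and its continuity, are read off from the
    differential of K (t, u) = phi ((c t)^-1 c u) along the diagonal. *)
Section smooth_velocity.
Context (c : R -> G) (sc : smooth_path c).

Let K (q : R * R) : lalg := phi ((c q.1)^-1 * c q.2)%g.
Let O : set (R * R) := [set q | U1 ((c q.1)^-1 * c q.2)%g].

Let smooth_quotient : smooth (vec_atlas (R * R)%type) A
  (fun q : R * R => (c q.1)^-1 * c q.2)%g.
Proof.
have cA := lie_charted; have cR := charted_vec (R : normedModType R).
have cR2 := charted_vec (R * R)%type; have cAA := charted_prod cA cA.
apply: (smooth_comp (f := fun q : R * R => (c q.1, c q.2)) _ _ _ _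
  smooth_ldiv) => //.
apply: smooth_pair => //.
  apply: (smooth_comp (f := fst) cR2 cR cA _ sc).
  by apply/smooth_vec => k; exact: class_C_fst.
apply: (smooth_comp (f := snd) cR2 cR cA _ sc).
by apply/smooth_vec => k; exact: class_C_snd.
Qed.

Let smoothK : smooth_on O K.
Proof.
move=> k; have [_ /(_ tt one k)] := smooth_quotient.
by apply: class_C_sub => q Oq; exists q.
Qed.

Let diag t : O (t, t).
Proof. by rewrite /O /= mulVg; exact: lie_oneP. Qed.

Let diffK t : differentiable K (t, t).
Proof. by have /class_CS[dK _] := smoothK 1; exact: dK. Qed.

Let diff_shift (t h : R) : differentiable (fun h : R => (t, t + h)) h.
Proof. by apply: differentiable_pair. Qed.

Lemma smooth_path_derivable t :
  derivable (fun h : R => phi ((c t)^-1 * c (t + h))%g) 0 1.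
Proof.
apply/derivable1_diffP.
apply: (differentiable_comp (f := fun h : R => (t, t + h)) (g := K)) => //.
by rewrite addr0.
Qed.

Let velocityE t : velocity c t = 'd K (t, t) (0, 1).
Proof.
rewrite /velocity derive1E'; last exact/derivable1_diffP/smooth_path_derivable.
have dK : differentiable K ((fun h : R => (t, t + h)) 0) by rewrite addr0.
rewrite (diff_comp (diff_shift t 0) dK) /= addr0 diff_pair //=.
by rewrite diff_cst -derive1E' //= derive1E deriveD // derive_cst derive_id add0r.
Qed.

Lemma velocity_continuous : continuous (velocity c).
Proof.
move=> t; have /class_CS[_ CK] := smoothK 1.
rewrite (_ : velocity c = (fun p : (R * R) * (R * R) => 'd K (p.1) p.2) \o
    (fun t : R => ((t, t), (0, 1)))); last exact/funext/velocityE.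
apply: continuous_comp; last by apply: (CK (t, t, (0, 1))); split => //=.
apply: continuous_pair; last exact: cvg_cst.
by apply: continuous_pair; exact: cvg_id.
Qed.

End smooth_velocity.

Lemma velocity_near (c c' : R -> G) t :
  {near t, c =1 c'} -> velocity c t = velocity c' t.
Proof.
move=> cc'; have cc't : c t = c' t by exact: (nbhs_singleton cc').
rewrite /velocity !derive1E; apply: near_eq_derive.
have : \forall x \near t, c x = c' x by exact: cc'.
rewrite (near_shift 0 t) /= subr0; apply: filterS => h /= e.
by rewrite cc't [t + h]addrC e.
Qed.

Lemma velocity_lmul (a : G) (c : R -> G) t :
  velocity (fun t => a * c t)%g t = velocity c t.
Proof.
rewrite /velocity; congr (derive1 _ 0); apply/funext => h.
by rewrite invgM -mulgA mulKg.
Qed.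

Lemma velocity_affine (a b : R) (c : R -> G) t : smooth_path c ->
  velocity (fun t => c (a + b * t)) t = b *: velocity c (a + b * t).
Proof.
move=> sc; rewrite /velocity; set s := a + b * t.
pose F h := phi ((c s)^-1 * c (s + h))%g.
rewrite (_ : (fun h : R => _) = F \o ( *%R b)); last first.
  by apply/funext => h; rewrite /F /= mulrDr addrA.
have dF : differentiable F (b * 0).
  by rewrite mulr0; exact/derivable1_diffP/smooth_path_derivable.
have db : differentiable ( *%R b) (0 : R) by [].
rewrite derive1E'; last exact: differentiable_comp.
rewrite (diff_comp db dF) /= mulr0 derive1E'; last by rewrite mulr0 in dF.
have -> : 'd ( *%R b) (0 : R) 1 = b *: (1 : R).
  by rewrite -derive1E' // derive1E (deriveZ b) // derive_id.
by rewrite linearZ.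
Qed.

Lemma velocity_cst (a : G) t : velocity (fun=> a) t = 0.
Proof. by rewrite /velocity derive1_cst. Qed.

Lemma velocity_conj (g : G) (c : R -> G) t : smooth_path c ->
  velocity (fun t => g * c t * g^-1)%g t = Ad g (velocity c t).
Proof.
move=> sc; rewrite /velocity.
pose gamma h := ((c t)^-1 * c (t + h))%g.
pose Q x := phi (g * x * g^-1)%g.
rewrite (_ : (fun h : R => _) = Q \o gamma); last first.
  by apply/funext => h; rewrite /Q /gamma /= !invgM invgK -!mulgA mulKg.
have [| | | |_ ->] // := @derive_chart _ Q gamma.
- by rewrite /gamma addr0 mulVg.
- rewrite /continuous_at /gamma; apply: (@continuous_comp _ _ _
    (fun h => c (t + h)) (fun x => (c t)^-1 * x)%g).
    apply: (@continuous_comp _ _ _ (fun h : R => t + h) c).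
      by apply: continuousD; [exact: cvg_cst|exact: cvg_id].
    exact: smooth_path_continuous.
  exact: lmul_continuous.
- exact: smooth_path_derivable.
- apply: (@smooth_read (fun x => g * x * g^-1)%g).
  + exact: smooth_conj.
  + exact: nbhs_singleton nbhs_cimg1.
  + by rewrite psi1_x0 mulg1 mulgV; exact: lie_oneP.
Qed.

End lie_calculus.

(** * Paths at rest and slow paths *)

(** Connectedness of the interval, for maps to a set without topology. *)
Lemma locally_cst_itv (R : realType) (T : Type) (f : R -> T) (a b : R) :
  (forall t, a <= t <= b -> \forall u \near t, a <= u <= b -> f u = f t) ->
  forall t, a <= t <= b -> f t = f a.
Proof.
move=> loc t /andP[at_ tb]; have ab : a <= b by exact: le_trans tb.
pose S := [set x | a <= x <= b -> f x = f a].
pose S' := [set x | a <= x <= b -> f x <> f a].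
have itvE x : `[a, b]%classic x <-> a <= x <= b by rewrite /= in_itv.
pose I := `[a, b]%classic `&` S^°.
have SE x : `[a, b]%classic x -> S x -> S^° x.
  move=> /itvE xab Sx; rewrite /interior /=; move: (loc x xab).
  by apply: filterS => u fu uab; rewrite fu //; exact: Sx.
suff IE : I = `[a, b]%classic.
  have : I t by rewrite IE; apply/itvE/andP.
  by move=> [/itvE tab /nbhs_singleton]; exact.
apply: segment_connected.
- by exists a; split; [apply/itvE; rewrite lexx|apply: SE => //; apply/itvE; rewrite lexx].
- by exists S^° => //; exact: open_interior.
- exists (~` S'^°); first by apply: open_closedC; exact: open_interior.
  apply/seteqP; split=> x [xab].
    move=> /nbhs_singleton Sx; split => // /nbhs_singleton S'x.
    by apply: (S'x); [exact/itvE|apply: Sx; exact/itvE].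
  move=> nS'; split=> //; apply: SE => // _; apply: contrapT => nfx.
  apply: nS'; rewrite /interior /=; move/itvE: (xab) => /loc.
  by apply: filterS => u fu uab; rewrite fu.
Qed.

Lemma derive_translate (R : realType) (V : normedModType R) (k : R -> V) w :
  derivable (fun h => k (w + h)) 0 1 ->
  derivable k w 1 /\ derive1 k w = derive1 (fun h => k (w + h)) 0.
Proof.
have e : (fun h : R => h^-1 *: (k (h *: 1 + w) - k w)) =
    (fun h => h^-1 *: ((fun h => k (w + h)) (h *: 1 + 0) - k (w + 0))).
  by apply/funext => h /=; rewrite !addr0 [w + _]addrC.
by rewrite !derive1E /derivable /derive /= e.
Qed.

Lemma class_C_sin_cos (R : realType) k :
  class_C k [set: R] sin /\ class_C k [set: R] cos.
Proof.
elim: k => [|k [Csin Ccos]].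
  by split=> x _; [exact: continuous_sin|exact: continuous_cos].
have oT : open ([set: R] `*` [set: R]) by apply: open_setX; exact: openT.
have C1 (f : R -> R) : class_C k [set: R] f ->
    class_C k ([set: R] `*` [set: R]) (f \o fst).
  move=> Cf; apply: (class_C_comp (V := setT)) => //; first exact: openT.
  exact: class_C_fst.
have dsin (x : R) : differentiable (sin : R -> R) x by exact/derivable1_diffP.
have dcos (x : R) : differentiable (cos : R -> R) x by exact/derivable1_diffP.
split; apply/class_CS; (split=> [x _|]; [by []|]).
- apply: (class_C_congr (f := fun p : R * R => (cos \o fst) p * snd p)) => //.
    move=> [x v] _ /=; rewrite deriv1E; last exact/derivable1_diffP.
    by rewrite derive1E derive_val mulrC.
  by apply: class_CM => //; [exact: C1|exact: class_C_snd].
- apply: (class_C_congr (f := fun p : R * R => (sin \o fst) p * - snd p)) => //.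
    move=> [x v] _ /=; rewrite deriv1E; last exact/derivable1_diffP.
    by rewrite derive1E derive_val /GRing.scale /= mulrN mulrN mulrC.
  apply: class_CM => //; first exact: C1.
  apply: (@class_C_linear _ _ _ _ _ (-%R \o snd)) => p.
  by apply: continuousN; exact: cvg_snd.
Qed.

(** With the parameter t |-> sin (pi t / 2), which runs from 0 to 1 on [0, 1] and
    is bounded, the motion along the segment is defined and smooth on the whole
    line without leaving a ball around its origin. *)
Lemma bounded_segment (R : realType) (V : normedModType R) (x v : V) :
  exists l : R -> V, [/\ smooth_on setT l, l 0 = x, l 1 = x + v,
    forall t, `|l t - x| <= `|v| & forall t, `|derive1 l t| <= 2 * `|v|].
Proof.
pose m (t : R) := pi / 2 * t; pose th (t : R) := sin (m t).
have dth t : differentiable th t.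
  by apply: (@differentiable_comp _ _ _ _ m sin) => //; exact/derivable1_diffP.
have th' t : 'd th t 1 = pi / 2 * cos (m t).
  rewrite -derive1E' // (@derive1_comp _ m sin) //.
  rewrite !derive1E derive_val /m (deriveZ (pi / 2)) // derive_id mulrC.
  by rewrite /GRing.scale /= mulr1.
exists (cst x + (fun t => th t *: v)); split.
- move=> k; apply: class_CD; [exact: openT|exact: class_C_cst|].
  apply: (class_C_comp (V := setT) (f := th) (g := fun a : R => a *: v)) => //;
    try exact: openT; last exact: class_C_scale.
  apply: (class_C_comp (V := setT) (f := m)) => //; try exact: openT.
    by apply: class_CM; [exact: openT|exact: class_C_cst|exact: class_C_id].
  by case: (class_C_sin_cos R k).
- by rewrite !fctE /th /m mulr0 sin0 scale0r addr0.
- by rewrite !fctE /th /m mulr1 sin_pihalf scale1r.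
- by move=> t; rewrite !fctE addrAC subrr add0r normrZ ler_piMl // sin_max.
- move=> t.
  rewrite derive1E deriveD; [|by []|exact/diff_derivable/differentiableZl].
  rewrite derive_cst add0r -derive1E derive1E'; last exact: differentiableZl.
  rewrite diffZl //= th' normrZ ler_wpM2r // normrM -[leRHS]mulr1.
  rewrite ler_pM ?cos_max // ger0_norm ?ltW ?pihalf_lt2 //.
  by case/andP: (pihalf_02 R).
Qed.

Section short_paths.
Context (R : realType) (G : lie_group R).
Local Notation lalg := 'rV[R]_(lie_dim G).
Local Notation A := (lie_atlas G).
Local Notation one := (lie_one G).
Local Notation phi := (@phi1 R G).
Local Notation psi := (@psi1 R G).
Local Notation x0 := (phi 1%g).
Local Notation U1 := (cdom (lie_chart one)).

Lemma derive0_cst n (k : R -> 'rV[R]_n) (x y : R) : x <= y ->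
  (forall u, x < u < y -> derivable k u 1 /\ derive1 k u = 0) ->
  (forall u, x <= u <= y -> {for u, continuous k}) -> k x = k y.
Proof.
move=> xy dk ck; apply/rowP => j.
have [z _] : exists2 z, z \in `[x, y]%R &
    k y ord0 j - k x ord0 j = 0 * (y - x).
  apply: (@MVT_segment R (fun u => k u ord0 j) (fun=> 0)) => //.
    move=> u; rewrite in_itv /= => /dk[dku ku0].
    apply: DeriveDef; first by have /derivable_mxP := dku; exact.
    have := congr1 (fun M : 'rV_n => M ord0 j) (derive_mx dku).
    by rewrite -derive1E ku0 !mxE.
  apply: continuous_in_subspaceT => u; rewrite inE /= in_itv /= => /ck cku.
  apply: (@continuous_comp _ _ _ k (fun M : 'rV_n => M ord0 j)) => //.
  exact: coord_continuous.
by rewrite mul0r => /eqP; rewrite subr_eq0 => /eqP.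
Qed.

(** Near t0 the path is read in the chart at the identity as the function
    k u = phi ((c t0)^-1 * c u). Its derivative at w is the image of the velocity
    by the differential of the left translation by (c t0)^-1 * c w, hence zero. *)
Lemma velocity0_cst (c : R -> G) (a b : R) : smooth_path c ->
  (forall t, a < t < b -> velocity c t = 0) ->
  forall t, a <= t <= b -> c t = c a.
Proof.
move=> sc v0; have cc := smooth_path_continuous sc.
apply: locally_cst_itv => t0 t0ab.
pose q u := ((c t0)^-1 * c u)%g; pose k u := phi (q u).
have cq : continuous q.
  move=> u; apply: (@continuous_comp _ _ _ c (fun x => (c t0)^-1 * x)%g).
    exact: cc.
  exact: lmul_continuous.
have : \forall u \near t0, U1 (q u).
  by apply: cq; rewrite /q mulVg; exact: nbhs1U1.
move=> /nbhs_ballP[e e0 eU].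
have Uq u : `|u - t0| < e -> U1 (q u).
  by move=> ut; apply: eU; rewrite /ball /= distrC.
apply/nbhs_ballP; exists e => // u; rewrite /ball /= distrC => ut uab.
suff : k t0 = k u.
  rewrite /k => /(congr1 psi); rewrite !phi1K; try by apply: Uq; rewrite ?subrr ?normr0.
  by rewrite /q => /mulgI.
have dk w : a < w < b -> `|w - t0| < e -> derivable k w 1 /\ derive1 k w = 0.
  move=> wab wt.
  pose gamma h := ((c w)^-1 * c (w + h))%g.
  have kE : (fun h => k (w + h)) = phi \o (fun x => q w * x)%g \o gamma.
    by apply/funext => h; rewrite /k /q /gamma /= -mulgA mulVKg.
  have g1 : gamma 0 = 1%g by rewrite /gamma addr0 mulVg.
  have gC : {for 0, continuous gamma}.
    apply: (@continuous_comp _ _ _ (fun h => c (w + h)) (fun x => (c w)^-1 * x)%g).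
      apply: (@continuous_comp _ _ _ (fun h : R => w + h) c).
        by apply: continuousD; [exact: cvg_cst|exact: cvg_id].
      exact: cc.
    exact: lmul_continuous.
  have dQ : differentiable (phi \o (fun x => q w * x)%g \o psi) x0.
    apply: smooth_read.
    + exact: smooth_lmul.
    + exact: nbhs_singleton (nbhs_cimg1 G).
    + by rewrite psi1_x0 mulg1; exact: Uq.
  have dg : derivable (phi \o gamma) 0 1 by exact: smooth_path_derivable.
  have [d1 e1] := derive_chart g1 gC dg dQ.
  have vg : derive1 (phi \o gamma) 0 = 0 by exact: v0 wab.
  rewrite vg linear0 -kE in e1; rewrite -kE in d1.
  by have [d2 e2] := derive_translate d1; split => //; rewrite e2.
have ck w : `|w - t0| < e -> {for w, continuous k}.
  move=> wt; apply: continuous_comp; first exact: cq.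
  exact/phi1_continuous/Uq.
move/andP: t0ab => [a0 b0]; move/andP: uab => [au ub].
move: ut; rewrite ltr_distlC => /andP[ue1 ue2].
have [tu|/ltW ut'] := leP t0 u.
  apply: derive0_cst => // w /andP[w1 w2].
    by apply: dk; [|rewrite ltr_distlC]; lra.
  by apply: ck; rewrite ltr_distlC; lra.
apply/esym; apply: derive0_cst => // w /andP[w1 w2].
  by apply: dk; [|rewrite ltr_distlC]; lra.
by apply: ck; rewrite ltr_distlC; lra.
Qed.

(** The path is a segment in the chart at the identity. The velocity of psi \o l
    at t is the differential at (l t, l t) of N (x, y) = phi ((psi x)^-1 * psi y)
    in the direction (0, l' t); the tangent map of N is continuous and vanishes
    in the direction (0, 0), so short segments are followed slowly. *)
Lemma slow_path (e : R) : 0 < e -> \forall x \near x0,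
  exists c, [/\ smooth_path c, c 0 = 1%g, c 1 = psi x &
    forall t, `|velocity c t| < e].
Proof.
move=> e0; pose N (p : lalg * lalg) := phi ((psi p.1)^-1 * psi p.2)%g.
pose W := cmap (prod_chart (lie_chart one) (lie_chart one)) @`
  (cdom (prod_chart (lie_chart one) (lie_chart one)) `&`
   (fun q : G * G => q.1^-1 * q.2)%g @^-1` U1).
have smoothN : smooth_on W N.
  by move=> k; have [_ /(_ (one, one) one k)] := smooth_ldiv G.
have diagW x : cimg (lie_chart one) x -> W (x, x).
  move=> Ix; exists (psi x, psi x); last by congr pair; exact: psi1K.
  by split; [split; exact: psi1_dom|rewrite /= mulVg; exact: lie_oneP].
have /class_CS[dN CN] := smoothN 1.
pose D (p : (lalg * lalg) * (lalg * lalg)) := 'd N (p.1) p.2.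
have x0I := nbhs_singleton (nbhs_cimg1 G).
pose p0 : (lalg * lalg) * (lalg * lalg) := ((x0, x0), (0, 0)).
have cD : {for p0, continuous D}.
  by apply: (CN p0); split => //=; exact: diagW.
have D0 : D p0 = 0 by rewrite /D /= linear0.
have : \forall p \near p0, `|D p| < e.
  have /cvgr_dist_lt /(_ e e0) := cD; apply: filterS => p.
  by rewrite D0 sub0r normrN.
move=> /nbhs_ballP[d d0 dD].
have /nbhs_ballP[d' d'0 dI] := nbhs_cimg1 G.
pose r := Num.min d d' / 2.
have r0 : 0 < r by rewrite divr_gt0 // lt_min d0.
apply/nbhs_ballP; exists r => // x; rewrite -ball_normE /= => xr.
have [l [sl l0 l1 lx l']] := bounded_segment x0 (x - x0).
have vr : `|x - x0| < r by rewrite distrC.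
have lr t : `|x0 - l t| < r by rewrite distrC; exact: le_lt_trans (lx t) vr.
have [rd rd'] : 2 * r <= d /\ 2 * r <= d'.
  by split; rewrite mulrC divfK // ge_min lexx ?orbT.
have l'd t : `|derive1 l t| < d.
  apply: (@le_lt_trans _ _ (2 * `|x - x0|)) (l' t) _; lra.
have dl t : differentiable l t by have /class_CS[h _] := sl 1; exact: h.
have lI t : cimg (lie_chart one) (l t).
  apply: dI; rewrite -ball_normE /=; apply: lt_le_trans (lr t) _; lra.
exists (psi \o l); split.
- have cpl : continuous (psi \o l).
    move=> t; apply: continuous_comp; last exact: psi1_continuous.
    exact: differentiable_continuous.
  split=> // i j k; have [_ cA _ sA] := lie_manifold G.
  have [oj _ _ _ _] := cA j; have oD : open ((psi \o l) @^-1` cdom (lie_chart j)).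
    by apply: open_comp oj => ? _; exact: cpl.
  apply: (class_C_comp (V := cmap (lie_chart one) @`
      (cdom (lie_chart one) `&` cdom (lie_chart j))) (f := l)
      (g := cmap (lie_chart j) \o psi)).
  + apply: chart_image_open; first exact: vec_is_chart.
    exact: oD.
  + exact: (chart_image_open (cA one) oj).
  + move=> _ [t [_ /= Dt] <-]; exists (psi (l t)); last exact: psi1K.
    by split => //; exact: psi1_dom.
  + exact: class_C_sub (sl k).
  + exact: sA.
- by rewrite /= l0 psi1_x0.
- by rewrite /= l1 addrC subrK.
move=> t.
have dNt : differentiable N (l t, l t) by apply: dN; exact: diagW.
have -> : velocity (psi \o l) t = D ((l t, l t), (0, derive1 l t)).
  rewrite /velocity.
  pose p h := (l t, l (t + h)).
  have dsh : differentiable (fun h => l (t + h)) 0.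
    by apply: (@differentiable_comp _ _ _ _ (fun h => t + h) l).
  have dp : differentiable p 0 by exact: differentiable_pair.
  have p0E : p 0 = (l t, l t) by rewrite /p addr0.
  have dNp : differentiable N (p 0) by rewrite p0E.
  rewrite (_ : (fun h => _) = N \o p) // derive1E'; last exact: differentiable_comp.
  have p' : 'd p 0 1 = (0, derive1 l t).
    have -> : 'd p 0 = (fun y => ('d (cst (l t)) (0 : R) y,
        'd (fun h => l (t + h)) 0 y)) :> (R -> _) by exact: diff_pair.
    congr pair; first by have -> : 'd (cst (l t)) (0 : R) = 0 :> (R -> _) by exact: diff_cst.
    have <- := derive1E' dsh.
    by have [_ <-] := @derive_translate _ _ l t (diff_derivable dsh).
  by rewrite (diff_comp dp dNp) /= p' p0E.
apply: dD; have lrt : `|x0 - l t| < d by apply: lt_le_trans (lr t) _; lra.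
split; split; [by rewrite -ball_normE..|exact: ballxx|].
by rewrite -ball_normE /= sub0r normrN.
Qed.

End short_paths.

(** * Piecewise smooth paths *)

Section breakpoints.
Context (R : realType).

Lemma path_locate (x u : R) (r : seq R) : x <= u -> u < last x r ->
  exists i, (i < size r)%N /\ (x :: r)`_i <= u < (x :: r)`_i.+1.
Proof.
elim: r x => [|y r IH] x /= xu ul; first by have := lt_le_trans ul xu; rewrite ltxx.
have [yu|uy] := leP y u; last by exists 0%N; rewrite /= xu uy.
by have [i [ir iu]] := IH y yu ul; exists i.+1.
Qed.

Lemma gap (D : seq R) (t : R) :
  exists2 e, 0 < e & forall d, d \in D -> d != t -> e <= `|d - t|.
Proof.
elim: D => [|x D [e e0 He]]; first by exists 1.
have [->|xt] := eqVneq x t.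
  by exists e => // d; rewrite inE => /predU1P[->|/He//]; rewrite eqxx.
exists (Num.min e `|x - t|); first by rewrite lt_min e0 normr_gt0 subr_eq0.
move=> d; rewrite inE => /predU1P[->|/He h /h]; first by rewrite ge_min lexx orbT.
by rewrite ge_min => ->.
Qed.

Definition clamp (t : R) : R := Num.max 0 (Num.min 1 t).

Lemma clamp_id t : 0 <= t <= 1 -> clamp t = t.
Proof. by move=> /andP[t0 t1]; rewrite /clamp min_r // max_r. Qed.

Lemma clamp_ge0 t : 0 <= clamp t. Proof. by rewrite /clamp le_max lexx. Qed.

Lemma clamp_le1 t : clamp t <= 1.
Proof. by rewrite /clamp ge_max ler01 ge_min lexx. Qed.

Lemma clampK t : clamp (clamp t) = clamp t.
Proof. by rewrite clamp_id // clamp_ge0 clamp_le1. Qed.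

Lemma clamp_le0 t : t <= 0 -> clamp t = 0.
Proof. by move=> t0; rewrite /clamp max_l // ge_min t0 orbT. Qed.

Lemma clamp_ge1 t : 1 <= t -> clamp t = 1.
Proof. by move=> t1; rewrite /clamp min_l // max_r. Qed.

End breakpoints.

Section pieces.
Context (R : realType) (G : lie_group R).
Implicit Types (c : R -> G) (D : seq R).

(** Off the finite set D the path is smooth, up to and including the end points
    of every interval that has no point of D in its interior. Unlike a
    subdivision, such a set may be enlarged at will and does not depend on the
    interval on which the path is considered. *)
Definition pieces D c : Prop := forall u v, u < v ->
  (forall d, d \in D -> ~~ (u < d < v)) ->
  exists2 sigma, smooth_path sigma & forall t, u <= t <= v -> c t = sigma t.

Lemma smooth_path_cst (a : G) : smooth_path (fun=> a).
Proof. exact: smooth_cst. Qed.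

Lemma pieces_smooth c : smooth_path c -> pieces [::] c.
Proof. by move=> sc u v _ _; exists c. Qed.

Lemma pieces_comp (f : G -> G) D c :
  smooth (lie_atlas G) (lie_atlas G) f -> pieces D c -> pieces D (f \o c).
Proof.
move=> sf pc u v uv Duv; have [sigma ss cs] := pc u v uv Duv.
by exists (f \o sigma) => [|t /cs /= ->//]; exact: smooth_path_comp.
Qed.

Lemma pieces_affine (a b : R) D c : 0 < b -> pieces D c ->
  pieces [seq (d - a) / b | d <- D] (fun t => c (a + b * t)).
Proof.
move=> b0 pc u v uv Duv.
have [||sigma ss cs] := pc (a + b * u) (a + b * v).
- by rewrite ltrD2l ltr_pM2l.
- move=> d dD; have := Duv _ (map_f (fun d => (d - a) / b) dD).
  rewrite ltr_pdivlMr // ltr_pdivrMr // -!(mulrC b) ltrBrDl ltrBlDl.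
  by apply.
exists (fun t => sigma (a + b * t)) => [|t /andP[ut tv]].
  exact: smooth_path_affine.
by apply: cs; rewrite !lerD2l !ler_pM2l // ut.
Qed.

(** 0 and 1 are the points where clamp is not smooth. *)
Lemma pieces_clamp01 D c :
  (forall u v, 0 <= u -> u < v -> v <= 1 ->
    (forall d, d \in D -> ~~ (u < d < v)) ->
    exists2 sigma, smooth_path sigma &
      forall t, u <= t <= v -> c t = sigma t) ->
  pieces [:: 0, 1 & D] (c \o @clamp R).
Proof.
move=> pc u v uv Duv.
have n0 : ~~ (u < 0 < v) by apply: Duv; rewrite !inE eqxx.
have n1 : ~~ (u < 1 < v) by apply: Duv; rewrite !inE eqxx orbT.
have [v0|v0] := leP v 0.
  exists (fun=> c 0) => [|t /andP[_ tv] /=]; first exact: smooth_path_cst.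
  by rewrite clamp_le0 // (le_trans tv).
have [u1|u1] := leP 1 u.
  exists (fun=> c 1) => [|t /andP[ut _] /=]; first exact: smooth_path_cst.
  by rewrite clamp_ge1 // (le_trans u1).
move: n0 n1; rewrite v0 u1 andbT -!leNgt => u0 v1.
have [|sigma ss cs] := pc u v u0 uv v1.
  by move=> d dD; apply: Duv; rewrite !inE dD !orbT.
exists sigma => // t /[dup] /cs <- /andP[ut tv] /=.
by rewrite clamp_id // (le_trans u0 ut) (le_trans tv v1).
Qed.

Lemma pieces_clamp D c : pieces D c -> pieces [:: 0, 1 & D] (c \o @clamp R).
Proof. by move=> pc; apply: pieces_clamp01 => u v _ uv _; exact: pc. Qed.

(** An interval without points of a subdivision in its interior lies between two
    successive points of it; conversely the points of D in ]0, 1[, once sorted,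
    form a subdivision. *)
Lemma piecewise_smooth_pieces c : (forall t, c t = c (clamp t)) ->
  piecewise_smooth c <-> exists D, pieces D c.
Proof.
move=> cc; split.
  move=> [r [sr l1 pr]]; exists [:: 0, 1 & r].
  have -> : c = c \o @clamp R by exact/funext.
  apply: pieces_clamp01 => u v u0 uv v1 Duv.
  have [|i [ir /andP[iu ui]]] := path_locate u0 (r := r).
    by rewrite l1 (lt_le_trans uv).
  have [sigma ss cs] := pr i ir; exists sigma => // t /andP[ut tv] /=.
  have vi : v <= (0 :: r)`_i.+1.
    by have /Duv := mem_nth 0 ir; rewrite ui /= -leNgt.
  by rewrite cs // (le_trans iu ut) (le_trans tv vi).
move=> [D pD].
pose s := sort <=%R (undup [seq d <- D | 0 < d < 1]).
have sP d : (d \in s) = (d \in D) && (0 < d < 1).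
  by rewrite mem_sort mem_undup mem_filter andbC.
have ss : sorted <%R (0 :: rcons s 1%R).
  rewrite lt_sorted_pairwise pairwise_cons pairwise_rcons -lt_sorted_pairwise.
  rewrite sort_lt_sorted undup_uniq andbT all_rcons ltr01 /=.
  by apply/andP; split; apply/allP => d; rewrite sP => /andP[_ /andP[]].
exists (rcons s 1%R); split => //; first by rewrite last_rcons.
move=> i ir; apply: pD.
  by rewrite (lt_sorted_ltn_nth 0 ss) ?inE //= ltnW.
have nth01 j : (j < size (0%R :: rcons s 1%R))%N -> 0 <= (0 :: rcons s 1%R)`_j <= 1.
  move=> /(mem_nth 0); rewrite inE mem_rcons inE sP.
  by case/or3P => [/eqP->|/eqP->|/andP[_ /andP[/ltW-> /ltW->]]]; rewrite ?lexx ?ler01.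
move=> d dD; apply/negP => /andP[id di].
have ds : d \in 0 :: rcons s 1.
  rewrite inE mem_rcons inE sP dD.
  have /andP[h _] := nth01 i (ltnW ir); have /andP[_ h'] := nth01 i.+1 ir.
  by rewrite (le_lt_trans h id) (lt_le_trans di h') !orbT.
move: id di; rewrite -(nth_index 0 ds) !(lt_sorted_ltn_nth 0 ss) ?inE ?index_mem //; last exact: ltnW.
by move=> h; rewrite ltnS leqNgt h.
Qed.

Lemma pw_pathP c :
  pw_path c <-> (exists D, pieces D c) /\ forall t, c t = c (clamp t).
Proof.
by split=> [[pc cc]|[pc cc]]; split => //; apply/piecewise_smooth_pieces.
Qed.

Lemma pw_path_clamp D c : pieces D c -> pw_path (c \o @clamp R).
Proof.
move=> pc; apply/pw_pathP; split; last by move=> t /=; rewrite clampK.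
by exists [:: 0, 1 & D]; exact: pieces_clamp.
Qed.

Lemma pw_path_cst (a : G) : pw_path (fun=> a).
Proof. exact: (pw_path_clamp (pieces_smooth (smooth_path_cst a))). Qed.

Lemma pw_path_comp (f : G -> G) c :
  smooth (lie_atlas G) (lie_atlas G) f -> pw_path c -> pw_path (f \o c).
Proof.
move=> sf /pw_pathP[[D pc] cc]; apply/pw_pathP; split.
  by exists D; exact: pieces_comp.
by move=> t /=; rewrite -cc.
Qed.

(** The points of D other than t keep a positive distance from t. *)
Lemma pieces_left D c t : pieces D c -> exists e sigma,
  [/\ 0 < e, smooth_path sigma & forall x, t - e <= x <= t -> c x = sigma x].
Proof.
move=> pc; have [e e0 De] := gap D t.
have [||sigma ss cs] := pc (t - e) t; first by rewrite ltrBlDr ltrDl.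
  move=> d /De h; apply/negP => /andP[d1 d2].
  by have := h (negbT (lt_eqF d2)); rewrite leNgt ltr_distlC; lra.
by exists e, sigma.
Qed.

Lemma pieces_right D c t : pieces D c -> exists e sigma,
  [/\ 0 < e, smooth_path sigma & forall x, t <= x <= t + e -> c x = sigma x].
Proof.
move=> pc; have [e e0 De] := gap D t.
have [||sigma ss cs] := pc t (t + e); first by rewrite ltrDl.
  move=> d /De h; apply/negP => /andP[d1 d2].
  by have := h (negbT (gt_eqF d1)); rewrite leNgt ltr_distlC; lra.
by exists e, sigma.
Qed.

Lemma pieces_regular D c t : pieces D c -> t \notin D ->
  exists2 sigma, smooth_path sigma & {near t, c =1 sigma}.
Proof.
move=> pc tD; have [e e0 De] := gap D t.
have [||sigma ss cs] := pc (t - e) (t + e).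
- by lra.
- move=> d dD; apply/negP => /andP[d1 d2].
  have dt : d != t by apply: contraNneq tD => <-.
  by have := De d dD dt; rewrite leNgt ltr_distl; lra.
exists sigma => //; apply/nbhs_ballP; exists e => // x.
by rewrite -ball_normE /= => xt; apply: cs; move: xt; rewrite ltr_distlC; lra.
Qed.

Lemma pieces_continuous D c : pieces D c -> continuous c.
Proof.
move=> pc t; have [e [sigma [e0 ss cs]]] := pieces_left t pc.
have [e' [tau [e'0 st ct]]] := pieces_right t pc.
move=> U cU.
have sU : nbhs t (sigma @^-1` U).
  by apply: (smooth_path_continuous ss); rewrite -cs // lexx andbT lerBlDr lerDl ltW.
have tU : nbhs t (tau @^-1` U).
  by apply: (smooth_path_continuous st); rewrite -ct // lexx lerDl ltW.
have be : nbhs t (ball t e) by exact: nbhsx_ballx.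
have be' : nbhs t (ball t e') by exact: nbhsx_ballx.
suff : nbhs t (c @^-1` U) by [].
apply: filterS (filterI (filterI sU tU) (filterI be be')) => x [[sx tx]] [].
rewrite -!ball_normE /= !ltr_distlC => h h'.
rewrite /= /preimage /=; have [xt|tx'] := leP x t.
  by rewrite cs //; lra.
by rewrite ct //; lra.
Qed.

Lemma pw_path_continuous c : pw_path c -> continuous c.
Proof. by move=> /pw_pathP[[D pc] _]; exact: pieces_continuous pc. Qed.

End pieces.

(** * The speed of a path *)

Section inner_product.
Context (R : realType) (G : lie_group R).
Local Notation lalg := 'rV[R]_(lie_dim G).
Context (B : lalg -> lalg -> R) (Binv : invariant_inner_product B).

Let BDl a u v w : B (a *: u + v) w = a * B u w + B v w.
Proof. by case: Binv. Qed.

Let Bsym u v : B u v = B v u.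
Proof. by case: Binv. Qed.

Let B_sumr u v : B u v = \sum_j v ord0 j * B u (delta_mx ord0 j).
Proof.
have lin : linear_for *%R (B u).
  by move=> a x y /=; rewrite !(Bsym u) BDl.
pose linM := GRing.isLinear.Build _ _ _ _ _ lin.
pose L : {linear lalg -> R | *%R} := HB.pack (B u) linM.
rewrite {1}(row_sum_delta v) -[LHS]/(L _) linear_sum.
by apply: eq_bigr => j _; rewrite linearZ.
Qed.

Lemma inner_continuous : continuous (fun v : lalg => B v v).
Proof.
have -> : (fun v => B v v) = (fun v : lalg => \sum_j \sum_i
    v ord0 j * (v ord0 i * B (delta_mx ord0 j) (delta_mx ord0 i))).
  apply/funext => v; rewrite B_sumr; apply: eq_bigr => j _.
  by rewrite Bsym B_sumr mulr_sumr.
apply: continuous_big => [|j _]; first exact: add_continuous.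
apply: continuous_big => [|i _]; first exact: add_continuous.
have cc l : continuous (fun v : lalg => v ord0 l) by exact: coord_continuous.
move=> v; apply: (@continuousM _ _ (fun v : lalg => v ord0 j)); first exact: cc.
by apply: (@continuousM _ _ (fun v : lalg => v ord0 i)); [exact: cc|exact: cst_continuous].
Qed.

Lemma inner0 : B 0 0 = 0.
Proof. by have := BDl (-1) 0 0 0; rewrite scaler0 addr0 mulN1r addNr. Qed.

Lemma innerZ a u : B (a *: u) (a *: u) = a ^+ 2 * B u u.
Proof.
have BZ x v : B (a *: x) v = a * B x v.
  have b0 : B 0 v = 0 by have := BDl (-1) 0 0 v; rewrite scaler0 addr0 mulN1r addNr.
  by have := BDl a x 0 v; rewrite addr0 b0 addr0.
by rewrite BZ Bsym BZ mulrA.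
Qed.

Lemma speed_ge0 c t : 0 <= speed B c t.
Proof. exact: sqrtr_ge0. Qed.

Lemma speed_eq0 c t : speed B c t = 0 -> velocity c t = 0.
Proof.
move/eqP; rewrite sqrtr_eq0 => h; apply/eqP; apply: contraLR h => v0.
by rewrite -ltNge; case: Binv => _ _ /(_ _ v0).
Qed.

Lemma speed_near c c' t : {near t, c =1 c'} -> speed B c t = speed B c' t.
Proof. by move=> h; rewrite /speed (velocity_near h). Qed.

Lemma speed_cst (a : G) t : speed B (fun=> a) t = 0.
Proof. by rewrite /speed velocity_cst inner0 sqrtr0. Qed.

Lemma speed_lmul (a : G) c t : speed B (fun t => a * c t)%g t = speed B c t.
Proof. by rewrite /speed velocity_lmul. Qed.

Lemma speed_conj (g : G) c t : smooth_path c ->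
  speed B (fun t => g * c t * g^-1)%g t = speed B c t.
Proof.
by move=> sc; rewrite /speed velocity_conj //; case: Binv => _ _ _ ->.
Qed.

Lemma speed_affine a b c t : 0 <= b -> smooth_path c ->
  speed B (fun t => c (a + b * t)) t = b * speed B c (a + b * t).
Proof.
move=> b0 sc; rewrite /speed velocity_affine // innerZ sqrtrM ?sqr_ge0 //.
by rewrite sqrtr_sqr ger0_norm.
Qed.

Lemma speed_continuous c : smooth_path c -> continuous (speed B c).
Proof.
move=> sc t; apply: (@continuous_comp _ _ _ (fun t => B (velocity c t) (velocity c t))).
  apply: (@continuous_comp _ _ _ (velocity c) (fun v => B v v)).
    exact: velocity_continuous.
  exact: inner_continuous.
exact: sqrt_continuous.
Qed.

Lemma small_inner (e : R) : 0 < e ->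
  exists2 d, 0 < d & forall v : lalg, `|v| < d -> Num.sqrt (B v v) < e.
Proof.
move=> e0.
have cS : {for (0 : lalg), continuous (fun v => Num.sqrt (B v v))}.
  apply: (@continuous_comp _ _ _ (fun v => B v v)); first exact: inner_continuous.
  exact: sqrt_continuous.
have /cvgr_dist_lt /(_ e e0) /nbhs_ballP[d d0 dS] := cS.
exists d => // v vd; have := dS v; rewrite -ball_normE /= sub0r normrN => /(_ vd).
by rewrite inner0 sqrtr0 sub0r normrN ger0_norm // sqrtr_ge0.
Qed.

Lemma pieces_speed_regular D c t : pieces D c -> t \notin D ->
  exists2 sigma, smooth_path sigma & {near t, speed B c =1 speed B sigma}.
Proof.
move=> pc tD; have [sigma ss cs] := pieces_regular pc tD.
exists sigma => //.
have : \near t, \near t, c t = sigma t by exact: near_join.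
by apply: filterS => x; exact: speed_near.
Qed.

(** The speed is continuous off a finite set. *)
Lemma pieces_speed_measurable D c : pieces D c ->
  measurable_fun [set: R] (speed B c).
Proof.
move=> pc; pose S := [set` D].
have fS : finite_set S by exact: finite_seq.
have mS : measurable (S : set (measurableTypeR R)).
  by apply: countable_measurable; [exact: measurable_set1|exact: finite_set_countable].
rewrite -(setUv S); apply/measurable_funU => //; first exact: measurableC.
split.
  move=> _ Y mY; apply: countable_measurable; first exact: measurable_set1.
  by apply: finite_set_countable; apply: sub_finite_set fS => x [].
apply: open_continuous_measurable_fun.
  by apply: closed_openC; apply: compact_closed => //; exact: finite_compact.
move=> t; rewrite inE => /negP tS.
have [sigma ss cs] := pieces_speed_regular pc tS.
have cst : speed B c t = speed B sigma t by exact: (nbhs_singleton cs).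
move=> U; rewrite cst => /(speed_continuous ss) sU.
suff : nbhs t (speed B c @^-1` U) by [].
by apply: filterS2 cs sU => x /= <-.
Qed.

(** On either side of a point the speed is that of a smooth path, which is
    continuous; so the speed is locally bounded, and the interval is compact. *)
Lemma pieces_speed_bounded D c : pieces D c ->
  exists M, forall t, 0 <= t <= 1 -> speed B c t <= M.
Proof.
move=> pc.
have bnd sigma (t : R) : smooth_path sigma -> \forall x \near t, speed B sigma x <= speed B sigma t + 1.
  move=> ss; have : {for t, continuous (speed B sigma)} by exact: speed_continuous.
  move=> /cvgr_dist_lt /(_ 1 ltr01).
  by apply: filterS => x; rewrite ltr_distlC => /andP[_ /ltW].
have loc (t : R) : exists M, \forall x \near t, speed B c x <= M.
  have [e [sigma [e0 ss cs]]] := pieces_left t pc.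
  have [e' [tau [e'0 st ct]]] := pieces_right t pc.
  pose M := speed B c t + (speed B sigma t + 1) + (speed B tau t + 1).
  exists M.
  have be : nbhs t (ball t e) by exact: nbhsx_ballx.
  have be' : nbhs t (ball t e') by exact: nbhsx_ballx.
  have [M0 M1 M2] : [/\ speed B c t <= M, speed B sigma t + 1 <= M &
      speed B tau t + 1 <= M].
    rewrite /M; move: (speed_ge0 c t) (speed_ge0 sigma t) (speed_ge0 tau t).
    move: (speed B c t) (speed B sigma t) (speed B tau t) => x y z.
    by clear => x0 y0 z0; split; lra.
  clearbody M.
  apply: filterS (filterI (filterI (bnd _ t ss) (bnd _ t st)) (filterI be be')).
  move=> x [[sx tx]] []; rewrite -!ball_normE /= !ltr_distlC => hx hx'.
  have [xt|xt|->] := ltgtP x t; last exact: M0.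
    rewrite (@speed_near _ sigma); first exact: le_trans sx M1.
    have : nbhs x `]t - e, t[%classic.
      by apply: near_in_itvoo; rewrite in_itv /= xt andbT; case/andP: hx.
    apply: filterS => y; rewrite /= in_itv /= => /andP[y1 y2].
    by apply: cs; rewrite !ltW.
  rewrite (@speed_near _ tau); first exact: le_trans tx M2.
  have : nbhs x `]t, t + e'[%classic.
    by apply: near_in_itvoo; rewrite in_itv /= xt; case/andP: hx'.
  apply: filterS => y; rewrite /= in_itv /= => /andP[y1 y2].
  by apply: ct; rewrite !ltW.
have /compact_near_coveringP := @segment_compact R 0 1.
move=> /(_ nat \oo (fun n t => speed B c t <= n%:R) _) [].
  move=> t _; have [M tM] := loc t.
  exists ([set x | speed B c x <= M], [set n | M <= n%:R]).
    by split => //; exact: nbhs_infty_ger.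
  by move=> [x n] [/= xM Mn]; exact: le_trans xM Mn.
move=> N _ /(_ N (leqnn N)) bN; exists N%:R => t t01.
by apply: bN; rewrite /= in_itv.
Qed.

End inner_product.

(** * Affine substitution in an integral *)

Section affine_substitution.
Context (R : realType).
Local Notation mu := (@lebesgue_measure R).
Local Open Scope ereal_scope.

(** The image of the Lebesgue measure by t |-> a + b t, multiplied by b, is again
    the Lebesgue measure, since it agrees with it on half-open intervals. *)
Lemma ge0_integral_affine (a b : R) (f : R -> R) : (0 < b)%R ->
  measurable_fun [set: R] f -> (forall t, 0 <= f t)%R ->
  \int[mu]_(t in `[0%R, 1%R]%classic) (b * f (a + b * t)%R)%:E =
  \int[mu]_(t in `[a, (a + b)%R]%classic) (f t)%:E.
Proof.
move=> b0 mf f0.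
pose phi (t : measurableTypeR R) : measurableTypeR R := (a + b * t)%R.
have mphi : measurable_fun setT phi.
  apply: continuous_measurable_fun => t.
  by apply: continuousD; [exact: cvg_cst|apply: continuousM; [exact: cvg_cst|exact: cvg_id]].
pose bnn : {nonneg R} := NngNum (ltW b0).
(* the measure structure of a push-forward depends on the measurability of
   phi, which is therefore an argument of nu' *)
pose nu' : {measure set (measurableTypeR R) -> \bar R} := mscale bnn (pushforward mu phi).
pose nu := nu' mphi.
have nuE (A : set (measurableTypeR R)) : measurable A -> mu A = nu A.
  apply: lebesgue_measure_unique => _ [[x y] _ <-].
  transitivity (b%:E * mu (phi @^-1` `]x, y])); last by [].
  rewrite (_ : phi @^-1` `]x, y] = `]((x - a) / b)%R, ((y - a) / b)%R]%classic); last first.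
    apply/seteqP; split=> t /=; rewrite !in_itv /= ltr_pdivrMr // ler_pdivlMr //;
      by rewrite ltrBlDl lerBrDl (mulrC t).
  rewrite /= !lebesgue_measure_itv /= !lte_fin ltr_pM2r ?invr_gt0 // ltrD2r.
  case: ifP => xy; last by rewrite mule0.
  by rewrite -!EFinB -EFinM; congr EFin; field; exact: lt0r_neq0.
have preD : phi @^-1` `[a, (a + b)%R]%classic = `[0%R, 1%R]%classic.
  apply/seteqP; split=> t /=; rewrite !in_itv /= -{1}(addr0 a) lerD2l pmulr_rge0 //;
    by rewrite lerD2l ger_pMr.
have mD : measurable (`[a, (a + b)%R]%classic : set (measurableTypeR R)) by [].
have mfE : measurable_fun [set: measurableTypeR R] (fun t => (f t)%:E).
  exact/measurable_EFinP.
transitivity (\int[nu]_(t in `[a, (a + b)%R]%classic) (f t)%:E); last first.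
  by apply: eq_measure_integral => A mA _; rewrite -nuE.
rewrite /nu /nu' ge0_integral_mscale //; last 2 first.
- exact: measurable_funTS.
- by move=> t _; rewrite lee_fin.
rewrite ge0_integral_pushforward //; last 2 first.
- exact: measurable_funTS.
- by move=> t _; rewrite lee_fin.
rewrite preD -ge0_integralZl_EFin //=.
- by move=> t _; rewrite lee_fin.
- apply: measurable_funTS; apply/measurable_EFinP.
  exact: (measurableT_comp mf mphi).
- exact: ltW.
Qed.

End affine_substitution.

(** * Length, energy and Riemannian distance *)

Section null_sets.
Context (R : realType).
Local Notation mu := (@lebesgue_measure R).

Lemma ae_off_seq (D : seq R) (P : R -> Prop) :
  (forall t, t \notin D -> P t) -> \forall t \ae mu, P t.
Proof.
move=> h; exists [set` D]; split.
- by apply: countable_measurable; [exact: measurable_set1|exact/finite_set_countable/finite_seq].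
- exact/countable_lebesgue_measure0/finite_set_countable/finite_seq.
- by move=> t /= nP; apply: contrapT => tD; apply/nP/h/negP.
Qed.

Lemma eq_integral_off_seq (D : seq R) (f g : R -> R) :
  measurable_fun [set: R] f -> measurable_fun [set: R] g ->
  (forall t, 0 < t < 1 -> t \notin D -> f t = g t) ->
  (\int[mu]_(t in `[0%R, 1%R]) (f t)%:E = \int[mu]_(t in `[0%R, 1%R]) (g t)%:E)%E.
Proof.
move=> mf mg fg; apply: ae_eq_integral => //.
- by apply: measurable_funTS; exact/measurable_EFinP.
- by apply: measurable_funTS; exact/measurable_EFinP.
apply: (@ae_off_seq [:: 0, 1 & D]) => t.
rewrite !inE !negb_or => /and3P[t0 t1 tD].
rewrite /= in_itv /= !le_eqVlt eq_sym (negPf t0) (negPf t1) /= => t01.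
by rewrite fg.
Qed.

(** The function vanishes almost everywhere, and no interval is negligible. *)
Lemma integral0_dense (f : R -> R) : measurable_fun [set: R] f ->
  (forall t, 0 <= f t) -> (\int[mu]_(t in `[0%R, 1%R]) (f t)%:E = 0)%E ->
  forall x y, 0 <= x -> x < y -> y <= 1 -> exists2 z, x < z < y & f z = 0.
Proof.
move=> mf f0 int0 x y x0 xy y1; apply: contrapT => nz.
have mfE : measurable_fun (`[0, 1]%classic : set (measurableTypeR R)) (fun t => (f t)%:E).
  by apply: measurable_funTS; exact/measurable_EFinP.
have : ae_eq mu `[0, 1]%classic (fun t => (f t)%:E) (cst 0%E).
  apply/ae_eq_integral_abs => //; rewrite -[RHS]int0.
  by apply: eq_integral => t _; rewrite gee0_abs // lee_fin.
move=> [A [mA A0 hA]].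
have sub : `]x, y[%classic `<=` A.
  move=> z /=; rewrite in_itv /= => /andP[xz zy]; apply: hA => /= h.
  apply: nz; exists z; first by rewrite xz.
  have : `[0, 1]%classic z by rewrite /= in_itv /= (le_trans x0 (ltW xz)) (le_trans (ltW zy) y1).
  by move=> /h [].
have : (mu `]x, y[%classic <= mu A)%E.
  by apply: le_measure => //; rewrite inE //; exact: measurable_itv.
rewrite A0 lebesgue_measure_itv /= lte_fin xy -EFinB lee_fin subr_le0.
by rewrite leNgt xy.
Qed.

End null_sets.

Section lengths.
Context (R : realType) (G : lie_group R).
Local Notation lalg := 'rV[R]_(lie_dim G).
Context (B : lalg -> lalg -> R) (Binv : invariant_inner_product B).
Local Notation mu := (@lebesgue_measure R).
Local Notation A := (lie_atlas G).

Lemma pieces_speedX_integrable k D c : pieces D c ->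
  mu.-integrable `[0, 1]%classic (EFin \o (fun t => speed B c t ^+ k)).
Proof.
move=> pc; apply: measurable_bounded_integrable => //.
- by rewrite /= lebesgue_measure_itv /= lte_fin ltr01 -EFinB ltry.
- apply: measurable_funTS; apply: measurable_funX.
  exact: pieces_speed_measurable pc.
- have [M bM] := pieces_speed_bounded Binv pc.
  exists (M ^+ k); split; first exact: num_real.
  move=> M' MM' t /=; rewrite in_itv /= => t01.
  rewrite ger0_norm ?exprn_ge0 ?speed_ge0 // (le_trans _ (ltW MM')) //.
  by rewrite lerXn2r ?nnegrE ?speed_ge0 ?bM // (le_trans _ (bM t t01)) ?speed_ge0.
Qed.

Lemma pieces_lengthE D c : pieces D c ->
  (path_length B c)%:E = (\int[mu]_(t in `[0%R, 1%R]) (speed B c t)%:E)%E.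
Proof.
move=> pc; rewrite /path_length /Rintegral fineK //.
apply: integrable_fin_num => //.
exact: (pieces_speedX_integrable 1 pc).
Qed.

Lemma pieces_energyE D c : pieces D c ->
  (path_energy B c)%:E = (\int[mu]_(t in `[0%R, 1%R]) (speed B c t ^+ 2)%:E)%E.
Proof.
move=> pc; rewrite /path_energy /Rintegral fineK //.
by apply: integrable_fin_num => //; exact: pieces_speedX_integrable pc.
Qed.

Lemma path_length_ge0 c : 0 <= path_length B c.
Proof. by apply: Rintegral_ge0 => t _; exact: speed_ge0. Qed.

Lemma path_length_cst (a : G) : path_length B (fun=> a) = 0.
Proof.
rewrite /path_length /Rintegral integral0_eq // => t _.
by rewrite speed_cst.
Qed.

Lemma path_energy_cst (a : G) : path_energy B (fun=> a) = 0.
Proof.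
rewrite /path_energy /Rintegral integral0_eq // => t _.
by rewrite speed_cst // expr0n.
Qed.

Lemma smooth_velocity0 (c : R -> G) (x y : R) : smooth_path c ->
  (forall u v, x < u -> u < v -> v < y -> exists2 z, u < z < v & velocity c z = 0) ->
  forall w, x < w < y -> velocity c w = 0.
Proof.
move=> sc dz w /andP[xw wy]; apply/eqP/negPn/negP => vw.
have : {for w, continuous (velocity c)} by exact: velocity_continuous.
have vw0 : 0 < `|velocity c w| by rewrite normr_gt0.
move=> /cvgr_dist_lt /(_ _ vw0) /nbhs_ballP[e e0 eV].
pose v := Num.min (w + e) ((w + y) / 2).
have wv : w < v by rewrite /v lt_min ltrDl e0 midf_lt.
have vy : v < y by rewrite /v gt_min midf_lt // orbT.
have vwe : v <= w + e by rewrite /v ge_min lexx.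
have [z /andP[wz zv] vz] := dz w v xw wv vy.
have : ball w e z.
  rewrite -ball_normE /= ltr_distlC (lt_le_trans zv vwe) andbT.
  by rewrite ltrBlDr (lt_trans wz) // ltrDl.
by move=> /eV /=; rewrite vz subr0 ltxx.
Qed.

(** On each smooth piece the velocity is continuous, so it vanishes identically
    once it does on a dense set. *)
Lemma speed0_dense_cst c : pw_path c ->
  (forall x y, 0 <= x -> x < y -> y <= 1 -> exists2 z, x < z < y & speed B c z = 0) ->
  forall t, c t = c 0.
Proof.
move=> /pw_pathP[[D pc] cc] dz.
have cst p q sigma : 0 <= p -> q <= 1 -> smooth_path sigma ->
    (forall x, p <= x <= q -> c x = sigma x) ->
    forall x, p <= x <= q -> c x = c p.
  move=> p0 q1 ss cs x /[dup] /andP[px xq] xpq.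
  have pq := le_trans px xq; rewrite cs // cs ?lexx //.
  apply: (velocity0_cst (b := q)) => //.
  apply: smooth_velocity0 => // u v pu uv vq.
  have [z /andP[uz zv] vz] := dz u v (le_trans p0 (ltW pu)) uv (le_trans (ltW vq) q1).
  exists z; first by rewrite uz.
  rewrite -(speed_eq0 Binv vz); apply/esym/velocity_near.
  have : nbhs z `]p, q[%classic.
    by apply: near_in_itvoo; rewrite in_itv /= (lt_trans pu uz) (lt_trans zv vq).
  apply: filterS => y; rewrite /= in_itv /= => /andP[y1 y2].
  by apply: cs; rewrite !ltW.
suff c01 t : 0 <= t <= 1 -> c t = c 0.
  by move=> t; rewrite cc c01 // clamp_ge0 clamp_le1.
apply: locally_cst_itv => {}t /andP[t0 t1].
have [e [sigma [e0 ss cs]]] := pieces_left t pc.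
have [e' [tau [e'0 st ct]]] := pieces_right t pc.
have be : nbhs t (ball t e) by exact: nbhsx_ballx.
have be' : nbhs t (ball t e') by exact: nbhsx_ballx.
apply: filterS2 be be' => u.
rewrite -!ball_normE /= !ltr_distlC => /andP[eu _] /andP[_ ue'] /andP[u0 u1].
have [ut|/ltW tu] := leP u t.
  pose p := Num.max 0 (t - e).
  have h : forall x, p <= x <= t -> c x = c p.
    apply: (cst p t sigma) => // [|x /andP[px xt]]; first by rewrite le_max lexx.
    by apply: cs; rewrite xt andbT (le_trans _ px) // le_max lexx orbT.
  rewrite h ?h //; first by rewrite lexx andbT ge_max t0 gerBl ltW.
  by rewrite ut andbT ge_max u0 ltW.
pose q := Num.min 1 (t + e').
have h : forall x, t <= x <= q -> c x = c t.
  apply: (cst t q tau) => // [|x /andP[tx xq]]; first by rewrite ge_min lexx.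
  by apply: ct; rewrite tx (le_trans xq) // ge_min lexx orbT.
by rewrite h // tu le_min u1 ltW.
Qed.

Lemma length0_cst c : pw_path c -> path_length B c = 0 -> forall t, c t = c 0.
Proof.
move=> pwc l0; have /pw_pathP[[D pc] _] := pwc.
apply: speed0_dense_cst => //; apply: integral0_dense.
- exact: pieces_speed_measurable pc.
- by move=> t; exact: speed_ge0.
- by rewrite -(pieces_lengthE pc) l0.
Qed.

Lemma energy0_cst c : pw_path c -> path_energy B c = 0 -> forall t, c t = c 0.
Proof.
move=> pwc l0; have /pw_pathP[[D pc] _] := pwc.
apply: speed0_dense_cst => // x y x0 xy y1.
have m2 : measurable_fun [set: R] (fun t => speed B c t ^+ 2).
  by apply: measurable_funX; exact: pieces_speed_measurable pc.
have s2 t : 0 <= speed B c t ^+ 2 by exact: sqr_ge0.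
have i2 : (\int[mu]_(t in `[0%R, 1%R]) (speed B c t ^+ 2)%:E = 0)%E.
  by rewrite -(pieces_energyE pc) l0.
have [z xzy /eqP] := integral0_dense m2 s2 i2 x0 xy y1.
by rewrite sqrf_eq0 => /eqP; exists z.
Qed.

Lemma pw_path_conj_length (g : G) c : pw_path c ->
  path_length B (fun t => g * c t * g^-1)%g = path_length B c.
Proof.
move=> /pw_pathP[[D pc] _].
have pgc : pieces D (fun t => g * c t * g^-1)%g.
  exact: (pieces_comp (smooth_conj g) pc).
have le := pieces_lengthE pgc; have le' := pieces_lengthE pc.
apply: EFin_inj; apply: (etrans le); apply: (etrans _ (esym le')).
apply: (eq_integral_off_seq (D := D)).
- exact: pieces_speed_measurable pgc.
- exact: pieces_speed_measurable pc.
move=> t _ tD.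
have [sigma ss cs] := pieces_regular pc tD.
rewrite (speed_near B cs) -(speed_conj Binv g t ss); apply: speed_near.
by apply: filterS cs => x ->.
Qed.

Lemma path_length_lmul (g : G) c :
  path_length B (fun t => g * c t)%g = path_length B c.
Proof.
have e : speed B (fun t => g * c t)%g = speed B c.
  by apply/funext => t; exact: speed_lmul.
by rewrite /path_length e.
Qed.

Lemma path_length_clamp D c : pieces D c ->
  path_length B (c \o @clamp R) = path_length B c.
Proof.
move=> pc; have le := pieces_lengthE (pieces_clamp pc).
have le' := pieces_lengthE pc.
apply: EFin_inj; apply: (etrans le); apply: (etrans _ (esym le')).
apply: (eq_integral_off_seq (D := [::])).
+ exact: pieces_speed_measurable (pieces_clamp pc).
+ exact: pieces_speed_measurable pc.
move=> t t01 _; apply: speed_near; have : nbhs t `]0, 1[%classic.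
  by apply: near_in_itvoo; rewrite in_itv.
apply: filterS => y; rewrite /= in_itv /= => /andP[y0 y1].
by rewrite clamp_id // !ltW.
Qed.

Local Open Scope ereal_scope.

Lemma riem_dist_ge0 (a b : G) : 0 <= riem_dist B a b.
Proof. by apply: le_ereal_inf_tmp => _ [c _ <-]; rewrite lee_fin path_length_ge0. Qed.

Lemma riem_dist_le c (a b : G) : pw_path c -> c 0%R = a -> c 1%R = b ->
  riem_dist B a b <= (path_length B c)%:E.
Proof. by move=> pc c0 c1; apply: ereal_inf_lbound; exists c. Qed.

Lemma riem_dist_lmul (g a b : G) :
  riem_dist B (g * a)%g (g * b)%g <= riem_dist B a b.
Proof.
apply: le_ereal_inf_tmp => _ [c [pc c0 c1] <-]; apply: ereal_inf_lbound.
exists (fun t => g * c t)%g; last by rewrite path_length_lmul.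
by split; [exact: (pw_path_comp (smooth_lmul g))|rewrite c0|rewrite c1].
Qed.

Lemma riem_dist_conj (g a b : G) :
  riem_dist B (g * a * g^-1)%g (g * b * g^-1)%g <= riem_dist B a b.
Proof.
apply: le_ereal_inf_tmp => _ [c [pc c0 c1] <-]; apply: ereal_inf_lbound.
exists (fun t => g * c t * g^-1)%g; last by rewrite pw_path_conj_length.
by split; [exact: (pw_path_comp (smooth_conj g))|rewrite c0|rewrite c1].
Qed.

(** Elements near the identity are reached by slow paths, and the length of a path
    on [0, 1] is at most its greatest speed. *)
Lemma riem_dist_near1 (e : R) : (0 < e)%R ->
  \forall g \near (1%g : G), riem_dist B 1%g g < e%:E.
Proof.
move=> e0; have e2 : (e / 2 < e)%R by rewrite ltr_pdivrMr // ltr_pMr // ltr1n.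
have [d d0 dB] := small_inner Binv (divr_gt0 e0 (ltr0Sn R 1)).
have : \forall g \near (1%g : G), exists c : R -> G, [/\ smooth_path c, c 0%R = 1%g,
    c 1%R = psi1 (phi1 g) & forall t, (`|velocity c t| < d)%R].
  exact: (phi1_continuous (lie_oneP G) (slow_path G d0)).
apply: filterS2 (nbhs1U1 G) => g Ug [c [sc c0 c1 cd]].
have pc := pieces_smooth sc.
apply: (@le_lt_trans _ _ (e / 2)%:E); last by rewrite lte_fin.
apply: (@le_trans _ _ (path_length B (c \o @clamp R))%:E).
  apply: riem_dist_le.
  - exact: pw_path_clamp pc.
  - by rewrite /= clamp_le0.
  - by rewrite /= clamp_ge1 // c1; exact: phi1K.
have le := pieces_lengthE pc.
rewrite (path_length_clamp pc) le.
apply: (@le_trans _ _ (\int[mu]_(t in `[0%R, 1%R]) (e / 2)%:E)).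
  apply: ge0_le_integral => //.
  - by move=> t _; rewrite lee_fin speed_ge0.
  - apply: measurable_funTS; apply/measurable_EFinP.
    exact: pieces_speed_measurable pc.
  - by move=> t _; rewrite lee_fin; exact/ltW/dB/cd.
by rewrite integral_cst //= lebesgue_measure_itv /= lte_fin ltr01 sube0 mule1.
Qed.

(** The arc from a to b, reparametrized affinely by [0, 1], is one of the paths
    whose lengths define the distance. *)
Lemma riem_dist_pieces D c (a b : R) : pieces D c -> (a < b)%R ->
  riem_dist B (c a) (c b) <= \int[mu]_(t in `[a, b]) (speed B c t)%:E.
Proof.
move=> pc ab; pose k := (b - a)%R; have k0 : (0 < k)%R by rewrite subr_gt0.
have -> : b = (a + k)%R by rewrite /k addrC subrK.
rewrite -ge0_integral_affine //; last 2 first.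
- exact: pieces_speed_measurable pc.
- by move=> t; exact: speed_ge0.
pose c' t := c (a + k * t)%R.
have pc' := @pieces_affine _ _ a k D c k0 pc.
have pcc := pieces_clamp pc'.
apply: (@le_trans _ _ (path_length B (c' \o @clamp R))%:E).
  apply: riem_dist_le.
  - exact: pw_path_clamp pc'.
  - by rewrite /= clamp_le0 // /c' mulr0 addr0.
  - by rewrite /= clamp_ge1 // /c' mulr1.
rewrite (pieces_lengthE pcc) le_eqVlt; apply/orP; left; apply/eqP.
have aff : measurable_fun [set: R] (fun t => k * speed B c (a + k * t))%R.
  apply: measurable_funM => //.
  apply: (measurableT_comp (pieces_speed_measurable Binv pc)).
  apply: continuous_measurable_fun => t.
  by apply: continuousD; [exact: cvg_cst|apply: continuousM; [exact: cvg_cst|exact: cvg_id]].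
apply: (eq_integral_off_seq (D := [seq (d - a) / k | d <- D]%R)) => //.
  exact: pieces_speed_measurable pcc.
move=> t t01 tD.
rewrite (@speed_near _ _ _ _ c'); last first.
  have : nbhs t `]0%R, 1%R[%classic by apply: near_in_itvoo; rewrite in_itv.
  apply: filterS => y; rewrite /= in_itv /= => /andP[y0 y1].
  by rewrite clamp_id // !ltW.
have [|sigma ss cs] := @pieces_regular _ _ D c (a + k * t)%R pc.
  apply: contra tD => atD; apply/mapP; exists (a + k * t)%R => //.
  by rewrite addrAC subrr add0r mulrAC divff ?mul1r // lt0r_neq0.
rewrite (speed_near B cs) -(speed_affine Binv a t (ltW k0) ss).
apply: speed_near.
have : {for t, continuous (fun t => a + k * t)%R}.
  by apply: continuousD; [exact: cvg_cst|apply: continuousM; [exact: cvg_cst|exact: cvg_id]].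
by move=> /(_ [set y | c y = sigma y] cs).
Qed.

(** Each edge is at most as long as the arc that it spans. *)
Lemma sum_riem_dist D c n : pieces D c -> (0 < n)%N ->
  \sum_(0 <= i < n) riem_dist B (c (i%:R / n%:R)%R) (c (i.+1%:R / n%:R)%R) <=
  (path_length B c)%:E.
Proof.
move=> pc n0; have n0' : (0 < n%:R :> R)%R by rewrite ltr0n.
have mf : measurable_fun [set: R] (fun t => (speed B c t)%:E).
  by apply/measurable_EFinP; exact: pieces_speed_measurable pc.
have I0 S : 0 <= \int[mu]_(t in S) (speed B c t)%:E.
  by apply: integral_ge0 => t _; rewrite lee_fin speed_ge0.
suff H m : \sum_(0 <= i < m) riem_dist B (c (i%:R / n%:R)%R) (c (i.+1%:R / n%:R)%R) <=
    \int[mu]_(t in `[0%R, (m%:R / n%:R)%R]) (speed B c t)%:E.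
  by have := H n; rewrite divff ?lt0r_neq0 // (pieces_lengthE pc).
elim: m => [|m IH]; first by rewrite big_nil.
rewrite big_nat_recr //=.
have mn : (m%:R / n%:R < m.+1%:R / n%:R :> R)%R.
  by rewrite ltr_pM2r ?invr_gt0 // ltr_nat.
apply: le_trans (leeD IH (riem_dist_pieces pc mn)) _.
rewrite le_eqVlt; apply/orP; left; apply/eqP.
have i1 : (BLeft 0%R <= BRight (m%:R / n%:R)%R :> itv_bound R)%O.
  by rewrite bnd_simp divr_ge0.
have i2 : (BRight (m%:R / n%:R)%R <= BRight (m.+1%:R / n%:R)%R :> itv_bound R)%O.
  by rewrite bnd_simp ltW.
rewrite -integral_itv_obnd_cbnd; last exact: measurable_funTS.
rewrite -ge0_integral_setU //.
- by rewrite -(itv_bndbnd_setU i1 i2).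
- exact: measurable_funTS.
- by move=> t _; rewrite lee_fin speed_ge0.
- apply/disj_setPRL => t /=; rewrite !in_itv /= => /andP[t0 t1].
  by move=> /andP[_]; rewrite leNgt t0.
Qed.

End lengths.

(** * Infinite linear systems over a field *)

Section linear_systems.
Context (K : fieldType) (T I : eqType) (row : I -> seq (K * T)) (rhs : I -> K).

Let rowv i t : K := \sum_(p <- row i) p.1 * (p.2 == t)%:R.

Let comb (l : seq (K * I)) (t : T) : K := \sum_(x <- l) x.1 * rowv x.2 t.

Let subspace (S : set ((T -> K) * K)) : Prop := S (fun=> 0, 0) /\
  forall a v r w q, S (v, r) -> S (w, q) -> S (fun t => a * v t + w t, a * r + q).

Let graph0 : set ((T -> K) * K) :=
  [set vr | exists l, vr = (comb l, \sum_(x <- l) x.1 * rhs x.2)].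

Let single_valued (S : set ((T -> K) * K)) : Prop :=
  forall r, S (fun=> 0, r) -> r = 0.

Lemma sum_row (phi : T -> K) (l : seq (K * T)) (u : seq T) :
  uniq u -> {subset [seq p.2 | p <- l] <= u} ->
  \sum_(p <- l) p.1 * phi p.2 =
  \sum_(t <- u) phi t * \sum_(p <- l) p.1 * (p.2 == t)%:R.
Proof.
move=> uu; elim: l => [|p l IH] lu.
  by rewrite big_nil big1 // => t _; rewrite big_nil mulr0.
rewrite big_cons IH => [|q ql]; last by apply: lu; rewrite inE ql orbT.
have -> : p.1 * phi p.2 = \sum_(t <- u) phi t * (p.1 * (p.2 == t)%:R).
  rewrite (bigD1_seq p.2) //=; last by apply: lu; rewrite inE eqxx.
  rewrite eqxx mulr1 mulrC big1 ?addr0 // => t tp.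
  by rewrite eq_sym (negPf tp) !mulr0.
by rewrite -big_split /=; apply: eq_bigr => t _; rewrite big_cons mulrDr.
Qed.

(** A solution is a linear functional on the space of vectors T -> K with
    prescribed values on the rows. Solvability of the finite subsystems says that
    the prescription extends to combinations of the rows: the set graph0 of the
    pairs of a combination of rows and the same combination of right-hand sides
    is the graph of a partial functional. A maximal such graph is that of a total
    functional, whose values on the basis vectors are the solution. *)
Lemma linear_system_compactness :
  (forall s : seq I, exists phi : T -> K, forall i, i \in s ->
     \sum_(p <- row i) p.1 * phi p.2 = rhs i) ->
  exists phi : T -> K, forall i, \sum_(p <- row i) p.1 * phi p.2 = rhs i.
Proof.
move=> fin.
have sub0 : subspace graph0.
  split.
    by exists [::]; rewrite big_nil; congr pair; apply/funext => t; rewrite /comb big_nil.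
  move=> a v r w q [l [-> ->]] [l' [-> ->]].
  exists ([seq (a * x.1, x.2) | x <- l] ++ l'); rewrite big_cat big_map /=.
  congr pair.
    apply/funext => t; rewrite /comb big_cat big_map /= mulr_sumr; congr (_ + _).
    by apply: eq_bigr => x _; rewrite mulrA.
  by rewrite mulr_sumr; congr (_ + _); apply: eq_bigr => x _; rewrite mulrA.
have sv0 : single_valued graph0.
  move=> r [l [l0 ->]]; have [phi phiE] := fin [seq x.2 | x <- l].
  pose u := undup (flatten [seq [seq p.2 | p <- row x.2] | x <- l]).
  have rowE x : x \in l ->
      rhs x.2 = \sum_(t <- u) phi t * rowv x.2 t.
    move=> xl; rewrite -phiE ?map_f //; apply: sum_row; first exact: undup_uniq.
    move=> t tx; rewrite mem_undup; apply/flattenP.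
    by exists [seq p.2 | p <- row x.2] => //; exact: map_f.
  rewrite (eq_big_seq (fun x => \sum_(t <- u) phi t * (x.1 * rowv x.2 t))).
    rewrite exchange_big /= big1_seq // => t _; rewrite -mulr_sumr.
    by rewrite -/(comb l t) -(congr1 (fun f => f t) l0) mulr0.
  by move=> x xl /=; rewrite rowE // mulr_sumr; apply: eq_bigr => t _; rewrite mulrCA.
(* the empty set is the union of the empty chain *)
pose P (S : set ((T -> K) * K)) :=
  S = set0 \/ [/\ subspace S, single_valued S & graph0 `<=` S].
have [|S [PS maxS]] := @Zorn_bigcup _ P.
  move=> F FP totF.
  have [[S0 FS0 S0n]|nF] := pselect (exists2 S, F S & S <> set0); last first.
    left; apply/seteqP; split=> // x [S FS Sx].
    by apply: nF; exists S => // S0; rewrite S0 in Sx.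
  have FP' S : F S -> S !=set0 -> [/\ subspace S, single_valued S & graph0 `<=` S].
    by move=> /FP [->|//] [].
  have [sS0 vS0 gS0] : [/\ subspace S0, single_valued S0 & graph0 `<=` S0].
    by have /FP [] := FS0.
  right; split.
  - split; first by exists S0 => //; case: sS0.
    move=> a v r w q [S1 FS1 S1v] [S2 FS2 S2w].
    have [S12|S21] := totF _ _ FS1 FS2.
      have [[_ s2] _ _] : [/\ subspace S2, single_valued S2 & graph0 `<=` S2].
        by apply: FP' => //; exists (w, q).
      by exists S2 => //; apply: s2 => //; exact: S12.
    have [[_ s1] _ _] : [/\ subspace S1, single_valued S1 & graph0 `<=` S1].
      by apply: FP' => //; exists (v, r).
    by exists S1 => //; apply: s1 => //; exact: S21.
  - move=> r [S1 FS1 S1r].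
    have [_ v1 _] : [/\ subspace S1, single_valued S1 & graph0 `<=` S1].
      by apply: FP' => //; exists (fun=> 0, r).
    exact: v1.
  - by move=> x /gS0 S0x; exists S0.
have {PS} [[S0 Slin] vS gS] : [/\ subspace S, single_valued S & graph0 `<=` S].
  case: PS => // S0; exfalso; apply: (maxS graph0); last by right; split.
  rewrite S0; split; first exact: sub0set.
  by case: sub0 => g0 _ /(_ _ g0).
have tot x : exists r, S (x, r).
  apply: contrapT => nx.
  pose S' : set ((T -> K) * K) := [set vr | exists v a, S (v, vr.2) /\
    vr.1 = fun t => v t + a * x t].
  apply: (maxS S').
    split.
      move=> [v r] Sv; exists v, 0; split => //.
      by apply/funext => t; rewrite mul0r addr0.
    move=> S'S; apply: nx; exists 0; apply: S'S; exists (fun=> 0), 1; split => //.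
    by apply/funext => t; rewrite mul1r add0r.
  right; split.
  - split.
      exists (fun=> 0), 0; split => //.
      by apply/funext => t; rewrite mul0r addr0.
    move=> a v r w q [v' [b [Sv' /= ->]]] [w' [b' [Sw' /= ->]]].
    exists (fun t => a * v' t + w' t), (a * b + b'); split; first exact: Slin.
    by apply/funext => t /=; rewrite mulrDr mulrDl mulrA addrACA.
  - move=> r [v [a [/= Sv /(congr1 (fun f : T -> K => f)) e]]].
    have [a0|a0] := eqVneq a 0.
      apply: vS; rewrite (_ : (fun=> 0) = v) //.
      by rewrite e; apply/funext => t; rewrite a0 mul0r addr0.
    exfalso; apply: nx; exists (- a^-1 * r + 0).
    rewrite (_ : x = fun t => - a^-1 * v t + 0); first exact: Slin.
    apply/funext => t; have := congr1 (fun f : T -> K => f t) e => /= /eqP.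
    rewrite eq_sym addr_eq0 => /eqP ->.
    by rewrite mulNr mulrN opprK addr0 mulKf.
  - by move=> [v r] /gS Sv; exists v, 0; split => //; apply/funext => t; rewrite mul0r addr0.
pose phi t := sval (cid (tot (fun t' => (t == t')%:R))).
have phiP t : S (fun t' => (t == t')%:R, phi t) by exact: svalP (cid (tot _)).
have Ssum (l : seq (K * T)) : S (fun t => \sum_(p <- l) p.1 * (p.2 == t)%:R,
    \sum_(p <- l) p.1 * phi p.2).
  elim: l => [|p l IH]; first by under eq_fun do rewrite big_nil; rewrite big_nil.
  by under eq_fun do rewrite big_cons; rewrite big_cons; exact: Slin.
exists phi => i; apply/eqP; rewrite -subr_eq0; apply/eqP; apply: vS.
have g0i : S (rowv i, rhs i).
  apply: gS; exists [:: (1, i)]; rewrite big_seq1 mul1r; congr pair.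
  by apply/funext => t; rewrite /comb big_seq1 mul1r.
have := Slin (-1) _ _ _ _ g0i (Ssum (row i)); rewrite mulN1r addrC.
by under eq_fun do rewrite mulN1r addNr.
Qed.

End linear_systems.

(** * Cohomology of subspaces *)

Section coboundary_theory.
Context (R : realType).

Let coord k (x : 'rV[R]_k) (n : nat) : R := oapp (fun i => x ord0 i) 0 (insub n).

Let coordE k (x : 'rV[R]_k) (i : 'I_k) : coord x i = x ord0 i.
Proof. by rewrite /coord valK. Qed.

Let coord_out k (x : 'rV[R]_k) n : (k <= n)%N -> coord x n = 0.
Proof. by move=> kn; rewrite /coord insubF // ltnNge kn. Qed.

Let coord_insert0 k (i : 'I_k.+2) (x : 'rV[R]_k.+1) n :
  coord (insert0 i x) n = if n == i then 0 else coord x (unbump i n).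
Proof.
have [nk|kn] := ltnP n k.+2; last first.
  have ik := ltn_ord i; have ni : (i < n)%N by apply: leq_trans kn.
  rewrite !coord_out //; first by rewrite if_same.
  by rewrite /unbump ni subn1 -ltnS prednK // (leq_ltn_trans _ ni).
rewrite -[n in LHS]/(nat_of_ord (Ordinal nk)) coordE mxE.
case: unliftP => [j|] nE.
  have -> : n = lift i j by rewrite -nE.
  by rewrite /= bumpK coordE eq_sym (negPf (neq_bump _ _)).
by have -> : n == i by rewrite -nE.
Qed.

(** Both sides insert a zero at the places i and j + 1 of the result. *)
Lemma face_face k (i j : nat) (ik : (i < k.+3)%N) (jk : (j < k.+2)%N)
    (jk' : (j.+1 < k.+3)%N) (ik' : (i < k.+2)%N) (x : @std_simplex R k) : (i <= j)%N ->
  face (Ordinal ik) (face (Ordinal jk) x) = face (Ordinal jk') (face (Ordinal ik') x).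
Proof.
move=> ij; apply: val_inj => /=; apply/rowP => m; rewrite -!coordE.
rewrite !coord_insert0 /= /unbump.
have [mi|im|->] := ltngtP m i; rewrite /= ?subn0 ?subn1.
- have [-> -> ->] : [/\ (m == j :> nat) = false, (m == j.+1 :> nat) = false &
    (j.+1 < m)%N = false] by split; lia.
  have -> : (j < m)%N = false by lia.
  by rewrite !subn0 (ltn_eqF mi) ltnNge (ltnW mi) subn0.
- have [mj|jm|->] := ltngtP m j.+1; rewrite /= ?subn0 ?subn1 /= ?eqxx //.
  + have [-> ->] : (m.-1 == j) = false /\ (j < m.-1)%N = false by lia.
    by rewrite (gtn_eqF im) im subn0 subn1.
  + have [-> ->] : (m.-1 == j) = false /\ (m.-1 == i) = false by lia.
    by have [-> ->] : (j < m.-1)%N /\ (i < m.-1)%N by lia.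
- have [-> ->] : (i == j.+1) = false /\ (j.+1 < i)%N = false by lia.
  by rewrite subn0 eqxx.
Qed.

Section space.
Context (W : topologicalType).
Implicit Types A B : set W.

Lemma simplex_eq k A (s s' : singular_simplex R k A) : sval s = sval s' -> s = s'.
Proof. by case: s s' => s p [s' p'] /= h; exact: eq_exist. Qed.

(** The iterated faces (i, j) with i <= j cancel against (j + 1, i). *)
Lemma coboundaryK k A (c : cochain R k A) : coboundary (coboundary c) = fun=> 0.
Proof.
apply/funext => s; rewrite /coboundary.
under eq_bigr do rewrite mulr_sumr.
rewrite pair_big /=.
rewrite (bigID (fun p : 'I_k.+3 * 'I_k.+2 => (p.1 <= p.2)%N)) /=.
apply/eqP; rewrite addr_eq0 -sumrN; apply/eqP.
pose h (p : 'I_k.+3 * 'I_k.+2) : 'I_k.+3 * 'I_k.+2 := (inord p.2.+1, inord p.1).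
pose h' (p : 'I_k.+3 * 'I_k.+2) : 'I_k.+3 * 'I_k.+2 := (inord p.2, inord p.1.-1).
rewrite [RHS](reindex_onto h h'); last first.
  move=> [i j] /=; rewrite -ltnNge => ji; rewrite /h /h' /=.
  have ik := ltn_ord i; have jk := ltn_ord j.
  have i0 : (0 < i)%N by exact: leq_ltn_trans ji.
  rewrite !inordK //; [|lia..].
  by rewrite prednK // !inord_val.
apply: eq_big => [[i j] /=|[i j] /= ij].
  have ik := ltn_ord i; have jk := ltn_ord j.
  rewrite /h /h' /=; apply/idP/idP => [ij|].
    rewrite !inordK; try lia.
    rewrite -ltnNge ltnS ij /=; apply/eqP; congr pair; apply: val_inj => /=.
      by rewrite inordK //; lia.
    by rewrite inordK.
  move=> /andP[+ /eqP[e1 _]]; move: e1 => /(congr1 val) /=.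
  rewrite inordK => [ei|]; last by apply: leq_trans (ltn_ord _) _.
  have ik' : (i < k.+2)%N by rewrite -ei ltn_ord.
  by rewrite !inordK //; lia.
case: i j ij => [i ik] [j jk] /= ij; rewrite /h /=.
have jk' : (j.+1 < k.+3)%N by rewrite ltnS.
have ik' : (i < k.+2)%N by apply: leq_ltn_trans jk.
have -> : inord j.+1 = Ordinal jk' by apply: val_inj; rewrite /= inordK.
have -> : inord i = Ordinal ik' by apply: val_inj; rewrite /= inordK.
rewrite /= exprS mulN1r !mulNr opprK mulrCA; congr (_ * (_ * c _)).
apply: simplex_eq => /=; apply/funext => x /=; congr (sval s _).
exact: face_face.
Qed.

(** A partial inverse of simplex_incl, by means of which cochains are extended by
    zero. *)
Definition corestrict k A B (s : singular_simplex R k A) : option (singular_simplex R k B) :=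
  if pselect (forall x, B (sval s x)) is left h then
    Some (exist _ (sval s) (conj (svalP s).1 h)) else None.

Lemma extend_cochain k A B (AB : A `<=` B) (c : cochain R k A) :
  exists c' : cochain R k B, forall s, c' (simplex_incl AB s) = c s.
Proof.
exists (fun s => oapp c 0 (corestrict A s)) => s; rewrite /corestrict.
case: pselect => [h|[]] /=; last by case: s => s [].
by congr c; exact: simplex_eq.
Qed.

Lemma coboundaryB k A (c c' : cochain R k A) s :
  coboundary (fun x => c x - c' x) s = coboundary c s - coboundary c' s.
Proof.
rewrite /coboundary -sumrB; apply: eq_bigr => i _.
by rewrite mulrBr.
Qed.

Lemma cocycle_eq k A (c c' : cocycle R k A) : sval c = sval c' -> c = c'.
Proof. by case: c c' => c p [c' p'] /= h; exact: eq_exist. Qed.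

Definition coclass k A (c : cocycle R k A) : cohomology R k A :=
  (\pi_({eq_quot (@cohomologous_equiv R W k A)}) c)%qT.

Lemma coclassP k A (c c' : cocycle R k A) :
  coclass c = coclass c' <-> cohomologous c c'.
Proof. by split=> [/eqmodP|h] //; exact/eqmodP. Qed.

Lemma coclassK k A (h : cohomology R k A) : coclass (repr h) = h.
Proof. exact: reprK. Qed.

Lemma restriction_coclass k A B (AB : A `<=` B) (c : cocycle R k B) :
  restriction AB (coclass c) = coclass (restrict_cocycle AB c).
Proof.
apply/coclassP; have : cohomologous (repr (coclass c)) c.
  by apply/coclassP; rewrite coclassK.
move=> /asboolP h; apply/asboolP; case: k c h => [|k] c /= h.
  by apply/funext => s; rewrite (congr1 (fun f => f (simplex_incl AB s)) h).
have [b bE] := h; exists (b \o simplex_incl AB (l := k)).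
rewrite coboundary_incl; apply/funext => s /=.
by rewrite -(congr1 (fun f => f (simplex_incl AB s)) bE).
Qed.

(** If a cocycle z' extends z up to the coboundary of b, then the difference of
    z' and the coboundary of an extension of b extends z exactly. *)
Lemma restriction_surjP k A B (AB : A `<=` B) :
  set_surj [set: cohomology R k B] [set: cohomology R k A] (restriction AB) <->
  forall c : cochain R k A, coboundary c = (fun=> 0) ->
    exists2 c' : cochain R k B, coboundary c' = (fun=> 0) &
      forall s, c' (simplex_incl AB s) = c s.
Proof.
split=> [surj c dc|ext].
  pose z : cocycle R k A := exist _ c dc.
  have [h _ hz] := surj (coclass z) I.
  pose z' := repr h; have dz' := svalP z'.
  have : cohomologous (restrict_cocycle AB z') z.
    by apply/coclassP; rewrite -restriction_coclass coclassK.
  have zc : sval z = c by [].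
  rewrite -zc; move: (z) (z') dz' => {zc z' z hz h surj dc c}.
  case: k => [|k] z z' dz' /asboolP /= e.
    exists (sval z') => // s; apply/eqP; rewrite -subr_eq0; apply/eqP.
    exact: (congr1 (fun f => f s) e).
  have [b bE] := e; have [b' b'E] := extend_cochain AB b.
  exists (fun s => sval z' s - coboundary b' s).
    by apply/funext => s; rewrite coboundaryB dz' coboundaryK subrr.
  move=> s; have := congr1 (fun f => f s) bE => /= es.
  have -> : coboundary b' (simplex_incl AB s) = coboundary b s.
    rewrite -[LHS]/((coboundary b' \o simplex_incl AB (l := k.+1)) s).
    by rewrite -coboundary_incl; congr coboundary; exact/funext.
  by rewrite -es opprB addrC subrK.
move=> q _; have [c' dc' c'c] := ext _ (svalP (repr q)).
pose z' : cocycle R k B := exist _ c' dc'.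
exists (coclass z') => //; rewrite restriction_coclass -[RHS]coclassK.
by congr coclass; apply: cocycle_eq; apply/funext => s; exact: c'c.
Qed.

End space.

(** Surjectivity of a restriction in cohomology with rational coefficients is
    injectivity in homology, hence may be tested on finitely many simplices. Let
    F send A to A' and have a left inverse S there, and let F send the simplices
    of a given finite chain to B': a cocycle c of A is carried by S to A',
    extended to B', and pulled back by F to a cochain that extends c and
    vanishes on the boundary of that chain. The equations defining an extension
    of c to a cocycle of B are thus solvable finitely many at a time. *)
Lemma restriction_surj_finitary k (W : topologicalType) (A B : set W) (AB : A `<=` B) :
  (forall bs : seq {classic singular_simplex R k.+1 B},
    exists (W' : topologicalType) (A' B' : set W') (A'B' : A' `<=` B')
      (F : W -> W') (S : W' -> W),
    [/\ continuous F /\ continuous S,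
        forall x, A x -> A' (F x) /\ S (F x) = x,
        forall x, A' x -> A (S x),
        forall b, b \in bs -> forall x, B' (F (sval b x)) &
        set_surj [set: cohomology R k B'] [set: cohomology R k A']
          (restriction A'B')]) ->
  set_surj [set: cohomology R k B] [set: cohomology R k A] (restriction AB).
Proof.
move=> approx; apply/restriction_surjP => c dc.
pose T : eqType := {classic singular_simplex R k B}.
pose I : eqType := {classic (singular_simplex R k A + singular_simplex R k.+1 B)%type}.
pose row (i : I) : seq (rat * T) := match i with
  | inl a => [:: (1, simplex_incl AB a)]
  | inr b => map (fun j : 'I_k.+2 => ((-1) ^+ (j : nat), simplex_face j b)) (enum 'I_k.+2) end.
pose rhs (i : I) : rat := if i is inl a then c a else 0.
have rowr b (phi : T -> rat) :
    \sum_(p <- row (inr b)) p.1 * phi p.2 = coboundary (phi : cochain R k B) b.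
  by rewrite big_map big_enum.
have [s|phi phiE] := @linear_system_compactness rat T I row rhs.
  pose bs : seq {classic singular_simplex R k.+1 B} :=
    pmap (fun i : I => if i is inr b then Some b else None) s.
  have [W' [A' [B' [A'B' [F [S [[cF cS] FA SA' Fb surj]]]]]]] := approx bs.
  pose push l (X : set W) (Y : set W') (t : singular_simplex R l X)
      (h : forall x, Y (F (sval t x))) : singular_simplex R l Y :=
    exist _ (F \o sval t) (conj (fun x => continuous_comp ((svalP t).1 x) (cF _)) h).
  pose pull l (t : singular_simplex R l A') : singular_simplex R l A :=
    exist _ (S \o sval t) (conj (fun x => continuous_comp ((svalP t).1 x) (cS _))
      (fun x => SA' _ ((svalP t).2 x))).
  have dSc : coboundary (c \o @pull k) = fun=> 0.
    apply/funext => t; rewrite -(congr1 (fun f => f (pull _ t)) dc) /coboundary.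
    by apply: eq_bigr => j _; congr (_ * c _); exact: simplex_eq.
  have [z dz zE] := (@restriction_surjP _ k _ _ A'B').1 surj _ dSc.
  pose phi (t : singular_simplex R k B) : rat :=
    if pselect (forall x, B' (F (sval t x))) is left h then z (push k B B' t h) else 0.
  exists phi => -[a|b] ins.
    rewrite /= big_seq1 mul1r /phi; case: pselect => [h|[]]; last first.
      by move=> x; exact: (A'B' _ (FA _ ((svalP a).2 x)).1).
    pose a' : singular_simplex R k A' := push k A A' a (fun x => (FA _ ((svalP a).2 x)).1).
    have -> : push k B B' (simplex_incl AB a) h = simplex_incl A'B' a'.
      exact: simplex_eq.
    rewrite zE /=; congr c; apply: simplex_eq; apply/funext => x /=.
    exact: (FA _ ((svalP a).2 x)).2.
  rewrite rowr; have hb : forall x, B' (F (sval b x)).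
    apply: Fb; rewrite mem_pmap; apply/mapP; exists (inr b) => //.
  rewrite -[RHS](congr1 (fun f => f (push k.+1 B B' b hb)) dz) /coboundary.
  apply: eq_bigr => j _; congr (_ * _); rewrite /phi; case: pselect => [h|[]].
    by congr z; exact: simplex_eq.
  by move=> x; exact: hb.
exists phi.
  by apply/funext => b; have := phiE (inr b); rewrite rowr.
by move=> a; have := phiE (inl a); rewrite /= big_seq1 mul1r.
Qed.

End coboundary_theory.

(** * Borel constructions and singular simplices *)

Section quotient_maps.
Context (T : topologicalType) (r : T -> set T).

Lemma to_quotient_eq p q : to_quotient r p = to_quotient r q <-> r p = r q.
Proof.
split=> [/(congr1 sval)//|e]; rewrite /to_quotient.
exact: eq_exist.
Qed.

Lemma representativeK (q : quotient r) : to_quotient r (representative q) = q.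
Proof.
rewrite /to_quotient /representative; case: cid => x /= e.
by case: q e => C [y Cy] /= e; apply: eq_exist; rewrite e.
Qed.

Lemma open_quotient (U : set (quotient r)) :
  open (to_quotient r @^-1` U) -> open U.
Proof. by []. Qed.

Lemma to_quotient_continuous : continuous (to_quotient r).
Proof. by apply/continuousP => U. Qed.

End quotient_maps.

Section borel_maps.
Context (R : realType) (G : topGroupType) (E : universal_bundle R G).

(** The image of an orbit by an equivariant map is the orbit of the image, so the
    class of the image does not depend on the representative. *)
Section map.
Context (T T' : topologicalType) (act : G -> T -> T) (act' : G -> T' -> T').
Context (f : T -> T') (fE : forall g t, f (act g t) = act' g (f t)).
Hypothesis f_continuous : continuous f.

Definition borel_map (q : borel_construction E act) : borel_construction E act' :=
  to_quotient (borel_orbit act') ((representative q).1, f (representative q).2).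

Lemma borel_mapE p : borel_map (to_quotient (borel_orbit act) p) =
  to_quotient (borel_orbit act') (p.1, f p.2).
Proof.
apply/to_quotient_eq.
set p' := representative _.
have orbE : borel_orbit act p' = borel_orbit act p.
  exact/to_quotient_eq/representativeK.
have img (x : E * T) : borel_orbit act' (x.1, f x.2) =
    (fun y : E * T => (y.1, f y.2)) @` borel_orbit act x.
  apply/seteqP; split=> [_ [g ->]|_ [_ [g ->] <-]] /=.
    by exists (ub_act g x.1, act g x.2) => /=; [exists g|rewrite fE].
  by exists g; rewrite fE.
by rewrite !img orbE.
Qed.

Lemma borel_map_continuous : continuous borel_map.
Proof.
apply/continuousP => U oU; apply: open_quotient.
have -> : to_quotient (borel_orbit act) @^-1` (borel_map @^-1` U) =
    (fun p : E * T => to_quotient (borel_orbit act') (p.1, f p.2)) @^-1` U.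
  by apply/seteqP; split=> p; rewrite /preimage /= borel_mapE.
have cg : continuous (fun p : E * T => to_quotient (borel_orbit act') (p.1, f p.2)).
  move=> p; apply: (@continuous_comp _ _ _ (fun p : E * T => (p.1, f p.2))).
    apply: cvg_pair; first exact: cvg_fst.
    by apply: (@continuous_comp _ _ _ snd f); [exact: cvg_snd|exact: f_continuous].
  exact: to_quotient_continuous.
by move/continuousP: cg; exact.
Qed.

Lemma borel_map_subspace (A : set T) (A' : set T') :
  (forall t, A t -> A' (f t)) ->
  forall q, borel_subspace (E := E) (act := act) A q -> borel_subspace (E := E) (act := act') A' (borel_map q).
Proof.
move=> AA' _ [p [_ Ap] <-]; rewrite borel_mapE.
by exists (p.1, f p.2) => //; split => //; exact: AA'.
Qed.

End map.

Lemma borel_saturated (T : topologicalType) (act : G -> T -> T) (P : set T) :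
  (forall g t, P t <-> P (act g t)) ->
  forall p q, to_quotient (borel_orbit (E := E) act) p = to_quotient (borel_orbit act) q ->
  P p.2 -> P q.2.
Proof.
move=> PE p q /to_quotient_eq e Pp.
have : borel_orbit act p (ub_act 1%g q.1, act 1%g q.2) by rewrite e; exists 1%g.
by move=> [g [_ eg]]; apply/(PE 1%g); rewrite eg; exact: (PE g _).1 Pp.
Qed.

Lemma borel_open (T : topologicalType) (act : G -> T -> T) (P : set T) :
  (forall g t, P t <-> P (act g t)) -> open P ->
  open [set q : borel_construction E act | P (representative q).2].
Proof.
move=> PE oP; apply: open_quotient.
have -> : to_quotient (borel_orbit act) @^-1`
    [set q : borel_construction E act | P (representative q).2] = snd @^-1` P.
  apply/seteqP; split=> p /=.
    exact: (borel_saturated PE (representativeK _)).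
  exact: (borel_saturated PE (esym (representativeK _))).
by apply: open_comp oP => p _; exact: cvg_snd.
Qed.

End borel_maps.

Section simplex.
Context (R : realType) (k : nat).

Lemma std_simplex_compact : compact [set: @std_simplex R k].
Proof.
pose D : set 'rV[R]_k.+1 := @std_simplex R k.
have cD : compact D.
  apply: bounded_closed_compact.
    exists 1; split => // M M1 x [x0 x1] /=.
    rewrite [leLHS]/Num.Def.normr /= mx_normrE (bigmax_le _ (ltW (lt_trans ltr01 M1))) //.
    move=> [i j] _ /=; rewrite (ord1 i) ger0_norm //; apply: le_trans (ltW M1).
    by rewrite -x1 (bigD1 j) //= lerDl sumr_ge0.
  have c0 : closed [set x : 'rV[R]_k.+1 | forall i, 0 <= x ord0 i].
    rewrite (_ : [set x | _] =
        \bigcap_(i in [set: 'I_k.+1]) ((fun x : 'rV[R]_k.+1 => x ord0 i) @^-1` [set y | 0 <= y])); last first.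
      by apply/seteqP; split=> x h i; [move=> _; exact: h|exact: h i I].
    apply: closed_bigI => i _; apply: closed_comp; last exact: closed_ge.
    by move=> x _; exact: coord_continuous.
  have c1 : closed [set x : 'rV[R]_k.+1 | \sum_i x ord0 i = 1].
    apply: (@closed_comp _ _ (fun x : 'rV[R]_k.+1 => \sum_i x ord0 i) [set 1]).
      move=> x _; apply: continuous_big => [|i _]; first exact: add_continuous.
      exact: coord_continuous.
    exact: closed_eq.
  exact: closedI c0 c1.
move=> F FF _.
pose F' : set_system 'rV[R]_k.+1 := [set Y | F (set_val @^-1` Y)].
have PF : ProperFilter F' by exact: fmap_proper_filter.
have FD : F' D.
  suff -> : F' D = F setT by exact: filterT.
  by rewrite /F' /=; congr F; apply/seteqP; split=> x // _; exact: set_valP.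
have [x [Dx Fx]] := cD _ PF FD.
exists (SigSub (mem_set Dx)); split => // A C FA.
rewrite nbhsE => -[V [[U oU UV] Vx] VC].
have nU : nbhs x U by apply: open_nbhs_nbhs; split => //; move: Vx; rewrite -UV.
have FA' : F' (set_val @` A).
  by rewrite /F' /=; apply: filterS FA => y Ay; exists y.
have [] := Fx (set_val @` A) U FA' nU.
move=> _ [[y Ay <-] Uy]; exists y; split => //.
by apply: VC; rewrite -UV.
Qed.

(** By compactness finitely many of the open sets cover the image; the last of
    these contains the others. *)
Lemma simplex_in_stage (W : topologicalType) (sigma : @std_simplex R k -> W)
    (O : nat -> set W) : continuous sigma -> (forall n, open (O n)) ->
  (forall m n, (m <= n)%N -> O m `<=` O n) ->
  (forall x, exists n, O n (sigma x)) -> exists n, forall x, O n (sigma x).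
Proof.
move=> cs oO monO covO.
have /compact_near_coveringP := std_simplex_compact.
move=> /(_ nat \oo (fun n x => O n (sigma x)) _) [].
  move=> x _; have [m Om] := covO x.
  exists (sigma @^-1` O m, [set n | (m <= n)%N]).
    split; last exact: nbhs_infty_ge.
    by apply: cs; apply: open_nbhs_nbhs; split => //; exact: oO.
  by move=> [y n] [/= Oy mn]; exact: (monO _ _ mn).
by move=> N _ /(_ N (leqnn N)) h; exists N => x; exact: h.
Qed.

End simplex.

(** * The space of based paths *)

Lemma ptws_continuous (T V : topologicalType) n (f : T -> 'I_n -> V) :
  (forall i, continuous (fun t => f t i)) ->
  continuous (f : T -> {ptws 'I_n -> V}).
Proof.
move=> fc x; apply/cvg_sup => i U.
rewrite nbhsE => -[V' [[W oW WV] Vx] VU].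
suff : nbhs x (f @^-1` U) by [].
have nW : nbhs (f x i) W by apply: open_nbhs_nbhs; split => //; move: Vx; rewrite -WV.
have fW : nbhs x ((fun t => f t i) @^-1` W) by exact: (fc i x _ nW).
by apply: filterS fW => y Wy; apply: VU; rewrite -WV.
Qed.

Section path_space_theory.
Context (R : realType) (G : lie_group R).
Context (B : 'rV[R]_(lie_dim G) -> 'rV[R]_(lie_dim G) -> R).
Context (Binv : invariant_inner_product B).
Context (dist : G -> G -> R) (dist_inv : invariant_metric dist).
Context (Gcompact : compact [set: G]).

Let dist_ge0 x y : 0 <= dist x y. Proof. by case: dist_inv => -[]. Qed.
Let distxx x : dist x x = 0.
Proof. by case: dist_inv => -[_ h _ _] _ _; apply/h. Qed.
Let dist_sym x y : dist x y = dist y x. Proof. by case: dist_inv => -[]. Qed.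
Let dist_triangle x y z : dist x z <= dist x y + dist y z.
Proof. by case: dist_inv => -[]. Qed.
Let dist_lmul g x y : dist (g * x)%g (g * y)%g = dist x y.
Proof. by case: dist_inv => _ _ /(_ g x y) []. Qed.
Let dist_rmul g x y : dist (x * g)%g (y * g)%g = dist x y.
Proof. by case: dist_inv => _ _ /(_ g x y) []. Qed.

Lemma dist_ball_nbhs x (e : R) : 0 < e -> nbhs x [set y | dist x y < e].
Proof.
move=> e0; apply: open_nbhs_nbhs; split; last by rewrite /= distxx.
case: dist_inv => _ oE _; apply/oE => y /= xy.
exists (e - dist x y); first by rewrite subr_gt0.
move=> z yz; apply: le_lt_trans (dist_triangle x y z) _.
by rewrite -ltrBrDl.
Qed.

Lemma nbhs_dist_ball x (U : set G) : nbhs x U ->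
  exists2 e : R, 0 < e & forall y, dist x y < e -> U y.
Proof.
rewrite nbhsE => -[V [oV Vx] VU].
case: dist_inv => _ oE _; have [e e0 eV] := (oE V).1 oV x Vx.
by exists e => // y /eV /VU.
Qed.

Lemma dist_bounded : exists C, forall x y, dist x y <= C.
Proof.
have /compact_near_coveringP := Gcompact.
move=> /(_ nat \oo (fun n x => dist 1%g x <= n%:R) _) [].
  move=> x _; exists ([set y | dist x y < 1], [set n | dist 1%g x + 1 <= n%:R]).
    by split; [exact: dist_ball_nbhs|exact: nbhs_infty_ger].
  move=> [y n] [/= xy xn]; apply: le_trans (dist_triangle _ x _) _.
  by apply: le_trans xn; rewrite lerD2l ltW.
move=> N _ /(_ N (leqnn N)) bN; exists (N%:R + N%:R) => x y.
apply: le_trans (dist_triangle x 1%g y) _.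
by rewrite lerD // ?(dist_sym x); exact: bN.
Qed.

Notation path := (path_space B dist).
Notation metric := (path_metric B dist).
Notation spread c c' := (sup [set dist (sval c t) (sval c' t) | t in `[0, 1]%classic]).

Let pwc (c : path) : pw_path (sval c). Proof. by case: c => c []. Qed.
Let path0 (c : path) : sval c 0 = 1%g. Proof. by case: c => c []. Qed.

Lemma spread_ub (c c' : path) t : dist (sval c t) (sval c' t) <= spread c c'.
Proof.
have [_ cc] := pwc c; have [_ cc'] := pwc c'.
rewrite cc cc'; apply: ub_le_sup.
  have [C hC] := dist_bounded; exists C => _ [u _ <-]; exact: hC.
by exists (clamp t) => //; rewrite /= in_itv /= clamp_ge0 clamp_le1.
Qed.

Lemma spread_le (c c' : path) M :
  (forall t, dist (sval c t) (sval c' t) <= M) -> spread c c' <= M.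
Proof.
move=> h; apply: ge_sup; last by move=> _ [t _ <-].
by exists (dist (sval c 0) (sval c' 0)), 0 => //; rewrite /= in_itv /= lexx ler01.
Qed.

Lemma path_metric_dist (c c' : path) t :
  dist (sval c t) (sval c' t) <= metric c c'.
Proof.
by apply: le_trans (spread_ub c c' t) _; rewrite lerDl.
Qed.

Lemma path_metric_length (c c' : path) :
  path_length B (sval c') <= path_length B (sval c) + metric c c'.
Proof.
rewrite -lerBlDl; apply: le_trans (ler_norm _) _; rewrite distrC lerDr.
exact: le_trans (dist_ge0 _ _) (spread_ub c c' 0).
Qed.

Lemma path_metric_triangle (c c' c'' : path) :
  metric c c'' <= metric c c' + metric c' c''.
Proof.
rewrite /path_metric addrACA lerD //.
  apply: spread_le => t; apply: le_trans (dist_triangle _ (sval c' t) _) _.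
  by apply: lerD; exact: spread_ub.
exact: ler_distD.
Qed.

Lemma path_metricxx (c : path) : metric c c = 0.
Proof.
rewrite /path_metric subrr normr0 addr0.
apply/eqP; rewrite eq_le; apply/andP; split.
  by apply: spread_le => t; rewrite distxx.
exact: le_trans (dist_ge0 _ _) (spread_ub c c 0).
Qed.

Lemma path_openP (U : set path) : open U <->
  forall c, U c -> exists2 e : R, 0 < e & forall c', metric c c' < e -> U c'.
Proof. by []. Qed.

Lemma path_eval_continuous t : continuous (fun c : path => sval c t).
Proof.
apply/continuousP => U oU; apply/path_openP => c Uc.
have [e e0 eU] := nbhs_dist_ball (open_nbhs_nbhs (conj oU Uc)).
exists e => // c' cc'; apply: eU; exact: le_lt_trans (path_metric_dist c c' t) cc'.
Qed.

Lemma sval_path_act (g : G) (c : path) : sval (path_act g c) = conjugate g (sval c).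
Proof.
rewrite /path_act; case: pselect => // -[]; split.
  have -> : conjugate g (sval c) = (fun x => g^-1 * x * g^-1^-1)%g \o sval c.
    by apply/funext => t; rewrite /conjugate /= invgK.
  exact: pw_path_comp (smooth_conj _) (pwc c).
by rewrite /conjugate path0 mulg1 mulVg.
Qed.

Lemma path_eq (c c' : path) : sval c = sval c' -> c = c'.
Proof. by case: c c' => c p [c' p'] /= h; exact: eq_exist. Qed.

Lemma path_actK (g : G) (c : path) : path_act g^-1%g (path_act g c) = c.
Proof.
apply: path_eq; rewrite !sval_path_act; apply/funext => t; rewrite /conjugate.
by rewrite invgK -!mulgA mulgV mulg1 mulVKg.
Qed.

Lemma path_length_act (g : G) (c : path) :
  path_length B (sval (path_act g c)) = path_length B (sval c).
Proof.
rewrite sval_path_act -(pw_path_conj_length Binv g^-1%g (pwc c)).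
by congr path_length; apply/funext => t; rewrite /conjugate invgK.
Qed.

Lemma path_metric_act (g : G) (c c' : path) :
  metric (path_act g c) (path_act g c') = metric c c'.
Proof.
rewrite /path_metric !path_length_act; congr (sup _ + _).
have e t : dist (sval (path_act g c) t) (sval (path_act g c') t) =
    dist (sval c t) (sval c' t).
  by rewrite !sval_path_act /conjugate dist_rmul dist_lmul.
by apply/seteqP; split=> _ [t t01 <-]; exists t.
Qed.

(** The energy of the polygon with vertices c(i / n), up to the factor n. *)
Definition polygon_energy n (c : path) : \bar R :=
  (\sum_(0 <= i < n)
    riem_dist B (sval c (i%:R / n%:R)%R) (sval c (i.+1%:R / n%:R)%R) ^+ 2)%E.

Lemma polygon_energy_act n (g : G) (c : path) :
  (polygon_energy n (path_act g c) <= polygon_energy n c)%E.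
Proof.
apply: lee_sum => i _; rewrite !expe2 sval_path_act.
have h : (riem_dist B (conjugate g (sval c) (i%:R / n%:R)%R)
    (conjugate g (sval c) (i.+1%:R / n%:R)%R) <=
    riem_dist B (sval c (i%:R / n%:R)%R) (sval c (i.+1%:R / n%:R)%R))%E.
  by have := riem_dist_conj Binv g^-1%g (sval c (i%:R / n%:R)%R) (sval c (i.+1%:R / n%:R)%R);
    rewrite invgK.
by apply: lee_pmul => //; exact: riem_dist_ge0.
Qed.

Lemma riem_dist_small (e : R) : 0 < e -> exists2 d, 0 < d &
  forall a b : G, dist a b < d -> (riem_dist B a b < e%:E)%E.
Proof.
move=> e0; have [d d0 dB] := nbhs_dist_ball (riem_dist_near1 Binv e0).
exists d => // a b ab.
have : (riem_dist B 1%g (a^-1 * b)%g < e%:E)%E.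
  by apply: dB; rewrite -(dist_lmul a) mulg1 mulVKg.
apply: le_lt_trans.
by have := riem_dist_lmul B a 1%g (a^-1 * b)%g; rewrite mulg1 mulVKg.
Qed.

Lemma path_uniformly_continuous (c : path) (d : R) : 0 < d ->
  exists N, forall n, (N <= n)%N -> forall t s, 0 <= t <= 1 ->
    `|s - t| <= n%:R^-1 -> dist (sval c s) (sval c t) < d.
Proof.
move=> d0; have cc := pw_path_continuous (pwc c).
have d2 : 0 < d / 2 by rewrite divr_gt0.
have /compact_near_coveringP := @segment_compact R 0 1.
move=> /(_ nat \oo (fun n t => forall s, `|s - t| <= n%:R^-1 ->
    dist (sval c s) (sval c t) < d) _) [].
  move=> t _.
  have : nbhs t (sval c @^-1` [set y | dist (sval c t) y < d / 2]).
    by apply: cc; exact: dist_ball_nbhs.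
  move=> /nbhs_ballP[r r0 rc].
  have r2 : 0 < r / 2 by rewrite divr_gt0.
  exists (ball t (r / 2), [set n | 2 / r < n%:R]).
    by split; [exact: nbhsx_ballx|exact: nbhs_infty_gtr].
  move=> [t' n] [/= tt' nr] s st'.
  have n0 : 0 < n%:R :> R by apply: lt_trans nr; rewrite divr_gt0.
  have nr' : n%:R^-1 < r / 2.
    by rewrite -[ltRHS]invrK invf_div ltf_pV2 ?posrE ?divr_gt0.
  move: tt'; rewrite -ball_normE /= => tt'.
  have cs : dist (sval c t) (sval c s) < d / 2.
    apply: rc; rewrite -ball_normE /= (splitr r).
    rewrite (le_lt_trans (ler_distD t' t s)) // ltrD // distrC.
    exact: le_lt_trans st' nr'.
  have ct' : dist (sval c t) (sval c t') < d / 2.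
    apply: rc; rewrite -ball_normE /=; apply: lt_trans tt' _.
    by rewrite ltr_pdivrMr // ltr_pMr // ltr1n.
  apply: le_lt_trans (dist_triangle _ (sval c t) _) _.
  by rewrite (splitr d) dist_sym ltrD.
move=> N _ hN; exists N => n Nn t s t01 st.
by apply: (hN n Nn t _ s st); rewrite /= in_itv.
Qed.

(** Near c and for large n, all edges of the polygons are short: they are so for
    c by uniform continuity, and hence uniformly near c. Their total length is
    at most the length of the path, which is locally bounded by the choice of
    the metric; thus the sum of the squares of the edges is small. *)
Lemma polygon_energy_small (q : R) (c : path) : 0 < q ->
  exists N, exists2 e : R, 0 < e & forall c', metric c c' < e ->
    forall n, (N <= n)%N -> (0 < n)%N -> (polygon_energy n c' < q%:E)%E.
Proof.
move=> q0; pose J := path_length B (sval c) + 1.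
have J0 : 0 < J by rewrite ltr_wpDl // path_length_ge0.
(* the energy of the polygon is at most eps times the length of the path, and J
   bounds the length near c *)
pose eps := q / 2 / J; have eps0 : 0 < eps by rewrite !divr_gt0.
have [d d0 dE] := riem_dist_small eps0.
(* an edge of c' is compared with the edge of c, through the two pairs of ends *)
have d3 : 0 < d / 3 by rewrite divr_gt0.
have [N hN] := path_uniformly_continuous c d3.
exists N, (Num.min 1 (d / 3)); first by rewrite lt_min ltr01.
move=> c'; rewrite lt_min => /andP[m1 md] n Nn n0.
have n0' : 0 < n%:R :> R by rewrite ltr0n.
have edge i : (i < n)%N ->
    (riem_dist B (sval c' (i%:R / n%:R)%R) (sval c' (i.+1%:R / n%:R)%R) <= eps%:E)%E.
  move=> iltn; apply/ltW/dE.
  set x := i%:R / n%:R; set y := i.+1%:R / n%:R.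
  have h1 : dist (sval c' x) (sval c x) < d / 3.
    by rewrite dist_sym; apply: le_lt_trans md; exact: path_metric_dist.
  have h2 : dist (sval c x) (sval c y) < d / 3.
    apply: (hN n Nn).
      by rewrite divr_ge0 // ler_pdivrMr // mul1r ler_nat.
    by rewrite /x /y -mulrBl -natr1 opprD addrA subrr sub0r mulN1r normrN ger0_norm // invr_ge0 ltW.
  have h3 : dist (sval c y) (sval c' y) < d / 3.
    by apply: le_lt_trans md; exact: path_metric_dist.
  apply: le_lt_trans (dist_triangle _ (sval c x) _) _.
  apply: le_lt_trans (lerD (lexx _) (dist_triangle _ (sval c y) _)) _.
  have -> : d = d / 3 + (d / 3 + d / 3) by field.
  by rewrite !ltrD.
have [D pD] : exists D, pieces D (sval c') by case/pw_pathP: (pwc c').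
have Jc' : path_length B (sval c') <= J.
  by apply: le_trans (path_metric_length c c') _; rewrite lerD2l ltW.
apply: (@le_lt_trans _ _ (eps%:E * (path_length B (sval c'))%:E)%E).
  have epsE : (0 <= eps%:E)%E by rewrite lee_fin ltW.
  apply: (le_trans _ (lee_wpmul2l epsE (sum_riem_dist Binv pD n0))).
  rewrite ge0_sume_distrr; last by move=> i _; exact: riem_dist_ge0.
  rewrite /polygon_energy big_nat_cond [leRHS]big_nat_cond.
  apply: lee_sum => i /andP[/andP[_ iltn] _]; rewrite expe2.
  apply: lee_wpmul2r; first exact: riem_dist_ge0.
  exact: edge.
rewrite -EFinM lte_fin; apply: (@le_lt_trans _ _ (eps * J)).
  by rewrite ler_pM2l.
by rewrite /eps divfK ?lt0r_neq0 // ltr_pdivrMr // ltr_pMr // ltr1n.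
Qed.

(** The condition is imposed on a ball around c to make the set open, and on all
    n >= N to make it increase with N. *)
Definition stage (q : R) (N : nat) : set path := [set c |
  exists2 e : R, 0 < e & forall c', metric c c' < e ->
    forall n, (N <= n)%N -> (0 < n)%N -> (polygon_energy n c' < q%:E)%E].

Lemma stage_open q N : open (stage q N).
Proof.
apply/path_openP => c [e e0 he]; have e2 : 0 < e / 2 by rewrite divr_gt0.
exists (e / 2) => // c' cc'; exists (e / 2) => // c'' c'c''.
apply: he; apply: le_lt_trans (path_metric_triangle c c' c'') _.
by rewrite (splitr e); exact: ltrD cc' c'c''.
Qed.

Lemma stage_le q M N : (M <= N)%N -> stage q M `<=` stage q N.
Proof.
move=> MN c [e e0 he]; exists e => // c' cc' n Nn.
by apply: he => //; exact: leq_trans Nn.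
Qed.

Lemma stage_act q N (g : G) (c : path) : stage q N c <-> stage q N (path_act g c).
Proof.
suff h g' c' : stage q N c' -> stage q N (path_act g' c').
  by split=> [|/(h g^-1%g)]; [exact: h|rewrite path_actK].
move=> [e e0 he]; exists e; first exact: e0.
move=> c'' mc n Nn n0.
have cE : path_act g' (path_act g'^-1%g c'') = c''.
  by have := path_actK g'^-1%g c''; rewrite invgK.
rewrite -cE; apply: le_lt_trans (polygon_energy_act n g' _) _.
apply: (he _ _ n Nn n0); rewrite -(path_metric_act g') cE.
exact: mc.
Qed.

Lemma stage_cover q (c : path) : 0 < q -> exists N, stage q N c.
Proof. by move=> /(polygon_energy_small c)[N hN]; exists N. Qed.

Lemma stage_energy q N (c : path) n : stage q N c -> (N <= n)%N -> (0 < n)%N ->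
  (polygon_energy n c < q%:E)%E.
Proof. by move=> [e e0 he]; apply: he; rewrite path_metricxx. Qed.

End path_space_theory.

(** * Comparison of the approximating spaces *)

Section approximation.
Context (R : realType) (G : lie_group R) (Gcompact : compact [set: G]).
Context (EG : universal_bundle R G).
Context (B : 'rV[R]_(lie_dim G) -> 'rV[R]_(lie_dim G) -> R).
Context (Binv : invariant_inner_product B).
Context (dist : G -> G -> R) (dist_inv : invariant_metric dist).
Context (rhobar : R) (rhobar_gt0 : 0 < rhobar).
Context (rhobarP : forall a b : G, (riem_dist B a b < rhobar%:E)%E ->
  exists! c, shortest_geodesic B a b c).

Lemma riem_distxx (a : G) : riem_dist B a a = 0%E.
Proof.
apply/eqP; rewrite eq_le; apply/andP; split; last exact: riem_dist_ge0.
rewrite [leRHS](_ : _ = (path_length B (fun=> a))%:E).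
  exact: riem_dist_le (pw_path_cst a) erefl erefl.
by rewrite path_length_cst.
Qed.

(** The infimum that defines the distance is attained below the radius, and a
    path without length is constant. *)
Lemma riem_dist_eq0 (a b : G) : riem_dist B a b = 0%E -> a = b.
Proof.
move=> ab0; have [|c [[pc c0 c1 lc _] _]] := @rhobarP a b.
  by rewrite ab0 lte_fin.
have l0 : path_length B c = 0 by apply: EFin_inj; rewrite lc.
by rewrite -c0 -c1 (length0_cst Binv pc l0 1).
Qed.

Section space.
Context (M : topologicalType) (actM : G -> M -> M) (Phi : M -> G).
Notation path := (path_space B dist).

Let pwc (c : path) : pw_path (sval c). Proof. by case: c => c []. Qed.
Let path0 (c : path) : sval c 0 = 1%g. Proof. by case: c => c []. Qed.

(** The polygon inscribed in a path, and the constant path at any polygon: they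
    are inverse to each other where the energies vanish. *)
Definition inscribe n (x : path * M) : {ptws 'I_n -> G} * M :=
  ((fun i : 'I_n => sval x.1 (i.+1%:R / n%:R)), x.2).

Definition cst_path : path := exist _ (fun=> 1%g) (conj (pw_path_cst 1%g) erefl).

Definition collapse n (x : {ptws 'I_n -> G} * M) : path * M := (cst_path, x.2).

Lemma inscribe_continuous n : continuous (@inscribe n).
Proof.
pose ev (c : path) : {ptws 'I_n -> G} := fun i : 'I_n => sval c (i.+1%:R / n%:R).
have cev : continuous ev.
  by apply: ptws_continuous => i; exact: (path_eval_continuous dist_inv Gcompact).
move=> x; apply: (@continuous_pair _ _ _ (ev \o fst) snd); last exact: cvg_snd.
by apply: continuous_comp; [exact: cvg_fst|exact: cev].
Qed.

Lemma collapse_continuous n : continuous (@collapse n).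
Proof.
move=> x; apply: (@continuous_pair _ _ _ (fun=> cst_path) snd).
  exact: cvg_cst.
exact: cvg_snd.
Qed.

Lemma inscribe_act n g x :
  inscribe n (hat_act actM dist g x) = fin_act actM n g (inscribe n x).
Proof. by rewrite /inscribe /fin_act /hat_act /= sval_path_act. Qed.

Lemma collapse_act n g x :
  @collapse n (fin_act actM n g x) = hat_act actM dist g (collapse x).
Proof.
rewrite /collapse /hat_act /=; congr pair; apply: path_eq.
by rewrite sval_path_act; apply/funext => t; rewrite /conjugate /= mulg1 mulVg.
Qed.

Lemma vertex_inscribe n (x : path * M) i : (i <= n)%N ->
  vertex (inscribe n x).1 i = sval x.1 (i%:R / n%:R).
Proof.
case: i => [|i] ilen; first by rewrite mul0r path0.
by rewrite /vertex insubT.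
Qed.

Lemma fin_energy_inscribe n (x : path * M) :
  fin_energy B (inscribe n x) = (n%:R%:E * polygon_energy n x.1)%E.
Proof.
rewrite /fin_energy /polygon_energy; congr (_ * _)%E.
rewrite big_nat_cond [RHS]big_nat_cond; apply: eq_bigr => i /andP[/andP[_ iltn] _].
by rewrite !vertex_inscribe // ltnW.
Qed.

Lemma inscribe_space n (x : path * M) : (0 < n)%N ->
  hat_space Phi x -> fin_space Phi (inscribe n x).
Proof.
by move=> n0 hx; rewrite /fin_space /= vertex_inscribe // divff ?pnatr_eq0 -?lt0n.
Qed.

Lemma hat_zero_cst (x : path * M) : hat_zero Phi x -> sval x.1 = fun=> 1%g.
Proof.
move=> [_ e0]; apply/funext => t.
by rewrite (energy0_cst Binv (pwc x.1) e0 t) path0.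
Qed.

Lemma inscribe_zero n (x : path * M) : (0 < n)%N ->
  hat_zero Phi x -> fin_zero B Phi rhobar (inscribe n x).
Proof.
move=> n0 hx; have xE := hat_zero_cst hx; have [hs _] := hx.
have e0 : fin_energy B (inscribe n x) = 0%E.
  rewrite fin_energy_inscribe /polygon_energy big1 ?mule0 // => i _.
  by rewrite xE riem_distxx expe2 mule0.
split=> //; split; first exact: inscribe_space.
by rewrite /= e0 lte_fin !mulr_gt0 ?invr_gt0 ?ltr0n ?exprn_gt0.
Qed.

Lemma collapse_zero n (x : {ptws 'I_n -> G} * M) : (0 < n)%N ->
  fin_zero B Phi rhobar x -> hat_zero Phi (collapse x).
Proof.
move=> n0 [[hx _] e0]; have n0' : (0 < n%:R :> R) by rewrite ltr0n.
split; last exact: path_energy_cst.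
rewrite /hat_space /= -hx.
have s0 : (\sum_(0 <= i < n) riem_dist B (vertex x.1 i) (vertex x.1 i.+1) ^+ 2 = 0)%E.
  move: e0 => /eqP; rewrite /fin_energy mule_eq0 => /orP[|/eqP//].
  by rewrite eqe gt_eqF.
have edge i : (i < n)%N -> vertex x.1 i = vertex x.1 i.+1.
  move=> iltn; apply: riem_dist_eq0; apply/eqP; rewrite -[_ == _]orbb -mule_eq0.
  rewrite -expe2; apply/eqP; move: s0; rewrite /index_iota subn0.
  move=> /eqP; rewrite seq_psume_eq0 => [/allP/(_ i)|j _]; last first.
    by rewrite expe2 mule_ge0 // riem_dist_ge0.
  by rewrite mem_iota add0n iltn => /(_ isT) /eqP.
suff H i : (i <= n)%N -> vertex x.1 i = 1%g by exact: H.
by elim: i => [//|i IH] ilen; rewrite -edge // IH // ltnW.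
Qed.

Lemma collapseK n (x : path * M) : hat_zero Phi x -> collapse (inscribe n x) = x.
Proof.
move=> /hat_zero_cst xE; case: x xE => c m /= cE.
by congr pair; apply: path_eq; rewrite cE.
Qed.

(** The open sets U N of the Borel construction that come from the stages increase
    to the whole of it, so that one of them contains the simplices of a given
    finite chain; with n = N + 1 the inscribed polygons of these are in Y_n. *)
Lemma hat_restriction_surjective :
  (forall n : nat, (0 < n)%N ->
     restriction_surjective EG (fin_act actM n) (fin_zeroS B Phi n rhobar)) ->
  restriction_surjective EG (hat_act actM dist) (hat_zeroS B Phi dist).
Proof.
move=> surj k; apply: restriction_surj_finitary => bs.
(* the energy that defines Y_n is n times polygon_energy, and n q is its bound *)
pose q := 2^-1 * rhobar ^+ 2.
have q0 : 0 < q by rewrite mulr_gt0 ?invr_gt0 ?exprn_gt0.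
pose P N : set (path * M) := fst @^-1` stage q N.
have PE N g (x : path * M) : P N x <-> P N (hat_act actM dist g x).
  exact: (stage_act Binv dist_inv).
pose U N := [set y : borel_construction EG (hat_act actM dist) | P N (representative y).2].
have oU N : open (U N).
  apply: (borel_open (PE N)); apply: open_comp => [x _|]; first exact: cvg_fst.
  exact: (stage_open dist_inv Gcompact).
have leU m n : (m <= n)%N -> U m `<=` U n.
  by move=> mn y; exact: (stage_le mn).
have [N hN] : exists N, forall b, b \in bs -> forall x, U N (sval b x).
  elim: bs => [|b bs [N hN]]; first by exists 0%N.
  have [|N' hN'] := @simplex_in_stage R k.+1 _ (sval b) U (svalP b).1 oU leU.
    by move=> x; exact: (stage_cover Binv dist_inv Gcompact).
  exists (maxn N N') => b'; rewrite inE => /predU1P[->|b'bs] x.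
    exact: (leU _ _ (leq_maxr _ _)).
  by apply: (leU _ _ (leq_maxl _ _)); exact: hN.
pose n := N.+1.
exists (borel_construction EG (fin_act actM n)), (borel_subspace (fin_zero B Phi rhobar)),
  (borel_subspace (fin_manifold B Phi rhobar)), (borel_subspaceS (fin_zeroS B Phi n rhobar)),
  (borel_map (E := EG) (act := hat_act actM dist) (fin_act actM n) (inscribe n)),
  (borel_map (E := EG) (act := fin_act actM n) (hat_act actM dist) (@collapse n)).
split.
- split; apply: borel_map_continuous.
  + exact: inscribe_act.
  + exact: inscribe_continuous.
  + exact: collapse_act.
  + exact: collapse_continuous.
- move=> y hy; split.
    apply: borel_map_subspace hy; first exact: inscribe_act.
    by move=> x; exact: inscribe_zero.
  move: hy => [p [_ pz] <-]; rewrite borel_mapE; last exact: inscribe_act.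
  rewrite borel_mapE /=; last exact: collapse_act.
  by rewrite collapseK //; case: p {pz}.
- move=> y hy; apply: borel_map_subspace hy; first exact: collapse_act.
  by move=> x; exact: collapse_zero.
- move=> b /hN hb x; have := (svalP b).2 x => -[p [_ ps] pE].
  have := hb x; rewrite -pE => /(borel_saturated (PE N) (representativeK _)) st.
  rewrite borel_mapE; last exact: inscribe_act.
  exists (p.1, inscribe n p.2) => //; split=> //; split.
    exact: inscribe_space.
  rewrite /= fin_energy_inscribe mulrAC mulrC EFinM lte_pmul2l ?lte_fin ?ltr0n //.
  exact: (stage_energy dist_inv Gcompact st (leqnSn N)).
- exact: surj.
Qed.

End space.
End approximation.

Theorem proposition2 (R : realType) (G : lie_group R)
  (Gcompact : compact [set: G])
  (EG : universal_bundle R G)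
  (B : 'rV[R]_(lie_dim G) -> 'rV[R]_(lie_dim G) -> R)
  (Binv : invariant_inner_product B)
  (dist : G -> G -> R) (dist_inv : invariant_metric dist)
  (rhobar : R) (rhobar_gt0 : 0 < rhobar)
  (rhobarP : forall a b : G, (riem_dist B a b < rhobar%:E)%E ->
     exists! c, shortest_geodesic B a b c)
  (s : R) (s_gt : 2^-1 < s)
  (X : banach_manifold R) (act : (R -> G) -> X -> X) (omega : local_forms X)
  (mu : X -> connection G s)
  (Xham : hamiltonian_space B act omega mu) (mu_proper : proper_map mu) :
  (forall n : nat, (0 < n)%N ->
     restriction_surjective EG (fin_act (assoc_act s act) n)
       (fin_zeroS B (assoc_Phi act mu) n rhobar)) ->
  restriction_surjective EG (hat_act (assoc_act s act) dist)
    (hat_zeroS B (assoc_Phi act mu) dist).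
Proof.
exact: (hat_restriction_surjective Gcompact Binv dist_inv rhobar_gt0 rhobarP).
Qed.
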